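(* The coideal subalgebras of dimension $4$ of $KD(2m)$ are: - in $K_3$: the $m$ coideal subalgebras $J_k$, $k$ odd; - in $K_4$: the $m$ coideal subalgebras $J_k$, $k$ even; - in $K_2$: when $m$ is odd, the unique coideal subalgebra $J_{20}$ of dimension $4$ (of $K_2$); when $m$ is even, the five coideal subalgebras of dimension $4$ (of $K_2$).
   Context: A coideal subalgebra of a finite-dimensional Kac algebra ($C^*$-Hopf algebra) $K$ is a unital $*$-subalgebra $I$ with $\Delta(I)\subset K\otimes I$. Its Jones projection $p_I$ is the unique nonzero projection in $I$ with $yp_I=\varepsilon(y)p_I$ for all $y\in I$. $I(f)$ is the smallest coideal subalgebra containing the projection $f$. $KD(n)$ ($n\ge1$): let $D_{2n}=\langle a,b\mid a^{2n}=b^2=1,\ ba=a^{-1}b\rangle$ (order $4n$), with canonical basis $\lambda(g)$ of $\mathbb{C}[D_{2n}]$, and $\Delta_s(\lambda(g))=\lambda(g)\otimes\lambda(g)$. Put $h_1=1,h_2=a^n,h_3=b,h_4=ba^n$, $\nu=-1+2\mathrm{i}$, and $\Omega=\sum_{i,j}c_{i,j}\lambda(h_i)\otimes\lambda(h_j)$ with $$(c_{i,j})=\frac18\begin{pmatrix}5&1&1&1\\1&1&\bar\nu&\nu\\1&\nu&1&\bar\nu\\1&\bar\nu&\nu&1\end{pmatrix}.$$ $\Omega$ is unitary. $KD(n)$ is the $*$-algebra $\mathbb{C}[D_{2n}]$ with its usual counit and antipode and the coproduct $\Delta(x)=\Omega\Delta_s(x)\Omega^*$. Here $n=2m$. With $\epsilon=\mathrm{e}^{\mathrm{i}\pi/n}$,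 sums over $k=0,\dots,2n-1$, and $1\le j\le n-1$: $e_1=\frac1{4n}\sum(\lambda(a^k)+\lambda(ba^k))$, $e_2=\frac1{4n}\sum(\lambda(a^k)-\lambda(ba^k))$, $e_3=\frac1{4n}\sum(-1)^k(\lambda(a^k)-\lambda(ba^k))$, $e_4=\frac1{4n}\sum(-1)^k(\lambda(a^k)+\lambda(ba^k))$, $e^j_{1,1}=\frac1{2n}\sum\epsilon^{-jk}\lambda(a^k)$, $e^j_{2,2}=\frac1{2n}\sum\epsilon^{jk}\lambda(a^k)$, $e^j_{1,2}=\frac1{2n}\sum\epsilon^{jk}\lambda(ba^k)$, $e^j_{2,1}=\frac1{2n}\sum\epsilon^{-jk}\lambda(ba^k)$, and $q(0,\beta,j)=\frac12(e^j_{1,1}+\mathrm{e}^{-\mathrm{i}\beta}e^j_{1,2}+\mathrm{e}^{\mathrm{i}\beta}e^j_{2,1}+e^j_{2,2})$. $K_i=I(e_1+e_i)$ for $i=2,3,4$ (dimension $2n$). For $k=0,\dots,n-1$, $J_k$ is the coideal subalgebra of dimension $4$ with Jones projection $e_1+e_i+\sum_{j=1}^{m-1}q(0,\frac{2kj\pi}n,2j)$, where $i=3$ for $k$ odd and $i=4$ for $k$ even. $K_2$ is isomorphic to the Kac algebra of functions on the dihedral group $D_n=\langle\alpha,\beta\rangle$ of order $2n$ ($\alpha$ of order $n$, $\beta$ of order $2$), and $J_{20}\subset K_2$ corresponds to the functions constant on the right cosets of $\langle\alpha^2\rangle$. *)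

(* Defs.v *)
From HB Require Import structures.
From mathcomp Require Import all_boot all_order all_algebra all_fingroup all_field.
From mathcomp Require Import complex.
From mathcomp Require Import all_classical all_reals trigo.

Set Implicit Arguments.
Unset Strict Implicit.
Unset Printing Implicit Defensive.

Import GRing.Theory.

Local Open Scope ring_scope.

(* <x, y | x^k = y^2 = 1, y x = x^-1 y>: a group generated by such x and y is a
   quotient of the dihedral group of order 2k, and the cardinal condition says
   that it is not a proper one. *)
Definition dihedral_generators (gT : finGroupType) (k : nat) (x y : gT) : Prop :=
  [/\ (x ^+ k = 1)%g, (y ^+ 2 = 1)%g, (y * x = x^-1 * y)%g,
      <<[set x; y]>>%g = [set: gT] & #|gT| = (2 * k)%N].

(* The group algebra F[gT].  It is an alias of {ffun gT -> F^o}, whose own ring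
   structure is pointwise; here the product is the convolution. *)
Definition group_algebra (F : fieldType) (gT : finGroupType) : Type :=
  {ffun gT -> F^o}.

Section GroupAlgebra.

Variables (F : fieldType) (gT : finGroupType).
Local Notation A := (group_algebra F gT).

HB.instance Definition _ := Vector.copy A {ffun gT -> F^o}.

Definition ga_lambda (g : gT) : A := [ffun h => (h == g)%:R : F^o].

Definition ga_mul (x y : A) : A :=
  [ffun g => \sum_(h : gT) x h * y (h^-1 * g)%g : F^o].

Fact ga_mulA : associative ga_mul.
Proof.
move=> x y z; apply/ffunP=> g; rewrite !ffunE.
under eq_bigr do rewrite ffunE mulr_sumr.
under [RHS]eq_bigr do rewrite ffunE mulr_suml.
rewrite [RHS]exchange_big /=; apply: eq_bigr => h _.
rewrite [RHS](reindex_inj (mulgI h)) /=; apply: eq_bigr => k _.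
by rewrite mulrA mulKg invMg mulgA.
Qed.

Fact ga_mul1 : left_id (ga_lambda 1%g) ga_mul.
Proof.
move=> x; apply/ffunP=> g; rewrite ffunE (bigD1 1%g) //= big1 => [|h h1].
  by rewrite ffunE eqxx mul1r invg1 mul1g addr0.
by rewrite ffunE (negbTE h1) mul0r.
Qed.

Fact ga_mulr1 : right_id (ga_lambda 1%g) ga_mul.
Proof.
move=> x; apply/ffunP=> g; rewrite ffunE (bigD1 g) //= big1 => [|h hg].
  by rewrite ffunE mulVg eqxx mulr1 addr0.
by rewrite ffunE -eq_mulVg1 (negbTE hg) mulr0.
Qed.

Fact ga_mulDl : left_distributive ga_mul +%R.
Proof.
move=> x y z; apply/ffunP=> g; rewrite !ffunE -big_split /=.
by apply: eq_bigr => h _; rewrite !ffunE mulrDl.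
Qed.

Fact ga_mulDr : right_distributive ga_mul +%R.
Proof.
move=> x y z; apply/ffunP=> g; rewrite !ffunE -big_split /=.
by apply: eq_bigr => h _; rewrite !ffunE mulrDr.
Qed.

Fact ga_1neq0 : ga_lambda 1%g != 0.
Proof.
apply/eqP=> /ffunP/(_ 1%g)/eqP; rewrite !ffunE eqxx.
by rewrite oner_eq0.
Qed.

HB.instance Definition _ := GRing.Zmodule_isNzRing.Build A
  ga_mulA ga_mul1 ga_mulr1 ga_mulDl ga_mulDr ga_1neq0.

Fact ga_scaleAl (c : F) (x y : A) : c *: (x * y) = (c *: x) * y.
Proof.
apply/ffunP=> g; rewrite !ffunE scaler_sumr.
by apply: eq_bigr => h _; rewrite ffunE scalerAl.
Qed.

HB.instance Definition _ := GRing.Lmodule_isLalgebra.Build F A ga_scaleAl.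

Fact ga_scaleAr (c : F) (x y : A) : c *: (x * y) = x * (c *: y).
Proof.
apply/ffunP=> g; rewrite !ffunE scaler_sumr.
by apply: eq_bigr => h _; rewrite ffunE scalerAr.
Qed.

HB.instance Definition _ := GRing.Lalgebra_isAlgebra.Build F A ga_scaleAr.
HB.instance Definition _ := Algebra_isFalgebra.Build F A.

(* F[gT] (x) F[gT] is identified with F[gT * gT], as an algebra. *)
Definition tensor (x y : A) : group_algebra F (gT * gT)%type :=
  [ffun gh => x gh.1 * y gh.2 : F^o].

Definition tensorv (U V : {vspace A}) :
    {vspace group_algebra F (gT * gT)%type} :=
  <<[seq tensor u v | u <- vbasis U, v <- vbasis V]>>%VS.

Definition slice (g : gT) (z : group_algebra F (gT * gT)%type) : A :=
  [ffun h => z (g, h)].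

Fact slice_is_linear g : linear (slice g).
Proof. by move=> c x y; apply/ffunP=> h; rewrite !ffunE. Qed.
HB.instance Definition _ g := GRing.isLinear.Build F
  (group_algebra F (gT * gT)%type) A *:%R (slice g) (slice_is_linear g).

Fact tensor_is_linear x : linear (tensor x).
Proof.
by move=> c y z; apply/ffunP=> h; rewrite !ffunE mulrDr scalerAr.
Qed.
HB.instance Definition _ x := GRing.isLinear.Build F A
  (group_algebra F (gT * gT)%type) *:%R (tensor x) (tensor_is_linear x).

Definition tensorr (y x : A) := tensor x y.
Fact tensorr_is_linear y : linear (tensorr y).
Proof.
by move=> c x z; apply/ffunP=> h; rewrite !ffunE mulrDl scalerAl.
Qed.
HB.instance Definition _ x := GRing.isLinear.Build F A
  (group_algebra F (gT * gT)%type) *:%R (tensorr x) (tensorr_is_linear x).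

Lemma mem_tensorv (U V : {vspace A}) u v : u \in U -> v \in V -> tensor u v \in tensorv U V.
Proof.
move=> /coord_vbasis-> /coord_vbasis->.
rewrite -[tensor _ _]/(tensorr _ _) linear_sum.
apply: rpred_sum => i _; rewrite linearZ rpredZ //= /tensorr linear_sum.
apply: rpred_sum => j _; rewrite linearZ rpredZ //=.
by apply/memv_span/allpairs_f; rewrite mem_nth ?size_tuple.
Qed.

Lemma tensor_fullvP (I : {vspace A}) z :
  reflect (forall g, slice g z \in I) (z \in tensorv fullv I).
Proof.
apply: (iffP idP) => [zI g | zI].
  suff /subvP/(_ _ zI) : (tensorv fullv I <= linfun (slice g) @^-1: I)%VS.
    by rewrite -memv_preim lfunE.
  apply/span_subvP=> _ /allpairsP[[u v] /= [_ vI ->]].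
  rewrite -memv_preim lfunE /=.
  suff -> : slice g (tensor u v) = (u g : F) *: v.
    by rewrite rpredZ ?vbasis_mem.
  by apply/ffunP=> h; rewrite !ffunE.
have -> : z = \sum_g tensor (ga_lambda g) (slice g z).
  apply/ffunP=> -[g h]; rewrite sum_ffunE (bigD1 g) //= !ffunE eqxx mul1r.
  rewrite big1 ?addr0 // => k kg.
  by rewrite !ffunE /= eq_sym (negbTE kg) mul0r.
by apply: rpred_sum => g _; rewrite mem_tensorv ?memvf.
Qed.

End GroupAlgebra.

Local Open Scope complex_scope.
Local Open Scope classical_set_scope.

(* exp(i t) *)
Definition expi (R : realType) (t : R) : R[i] := cos t +i* sin t.

Section KD.

Variables (R : realType) (gT : finGroupType).
Local Notation C := R[i].
Local Notation KD := (group_algebra C gT).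
Local Notation lam := (@ga_lambda C gT).

Definition ga_star (hT : finGroupType) (x : group_algebra C hT) :
  group_algebra C hT := [ffun g => (x g^-1%g)^* : C^o].

Definition counit (x : KD) : C := \sum_g x g.

Definition antipode (x : KD) : KD := [ffun g => x g^-1%g].

Definition Delta_s (x : KD) : group_algebra C (gT * gT)%type :=
  \sum_g (x g : C) *: tensor (lam g) (lam g).

(* gT stands for D_{2n}, generated by a and b; the elements of KD(n) are those
   of C[gT], and only the coproduct depends on n, a and b. *)
Variables (n : nat) (a b : gT).

Definition Omega_index : 4.-tuple gT := [tuple 1; a ^+ n; b; b * a ^+ n]%g.

Definition Omega_coef : 'M[C]_4 :=
  let nu : C := -1 +i* 2 in
  8^-1 *: \matrix_(i, j) nth 0 (nth [::]
    [:: [:: 5; 1; 1; 1];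
        [:: 1; 1; nu^*; nu];
        [:: 1; nu; 1; nu^*];
        [:: 1; nu^*; nu; 1]] i) j.

Definition Omega : group_algebra C (gT * gT)%type :=
  \sum_(i < 4) \sum_(j < 4) Omega_coef i j *:
    tensor (lam (tnth Omega_index i)) (lam (tnth Omega_index j)).

Definition Delta (x : KD) : group_algebra C (gT * gT)%type :=
  Omega * Delta_s x * ga_star Omega.

Definition coideal_subalgebra (I : {vspace KD}) : Prop :=
  [/\ 1 \in I,
      (forall x y, x \in I -> y \in I -> x * y \in I),
      (forall x, x \in I -> ga_star x \in I) &
      (forall x, x \in I -> Delta x \in tensorv fullv I)].

Definition jones_projection (I : {vspace KD}) (p : KD) : Prop :=
  [/\ p \in I, p != 0, p * p = p, ga_star p = p &
      forall y, y \in I -> y * p = counit y *: p].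

Definition smallest_coideal (f : KD) (I : {vspace KD}) : Prop :=
  [/\ coideal_subalgebra I, f \in I &
      forall J, coideal_subalgebra J -> f \in J -> (I <= J)%VS].

(* I(f); the default value fullv is never used, by gen_coidealP. *)
Definition gen_coideal (f : KD) : {vspace KD} :=
  xget fullv [set I | smallest_coideal f I].

Lemma coideal_fullv : coideal_subalgebra fullv.
Proof.
by split=> // *; rewrite ?memvf //; apply/tensor_fullvP => g; rewrite memvf.
Qed.

Lemma coideal_capv I J : coideal_subalgebra I -> coideal_subalgebra J ->
  coideal_subalgebra (I :&: J).
Proof.
move=> [I1 IM IS ID] [J1 JM JS JD]; split.
- by rewrite memv_cap I1.
- by move=> x y /memv_capP[xI xJ] /memv_capP[yI yJ]; rewrite memv_cap IM ?JM.
- by move=> x /memv_capP[xI xJ]; rewrite memv_cap IS ?JS.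
move=> x /memv_capP[/ID/tensor_fullvP xI /JD/tensor_fullvP xJ].
by apply/tensor_fullvP=> g; rewrite memv_cap xI xJ.
Qed.

Lemma gen_coidealP f : smallest_coideal f (gen_coideal f).
Proof.
apply: (@xgetPex _ fullv [set I | smallest_coideal f I]).
pose P d := `[< exists I, [/\ coideal_subalgebra I, f \in I & \dim I = d] >].
have exP : exists d, P d.
  by exists (\dim {: KD}); apply/asboolP; exists fullv; split;
     rewrite ?memvf //; exact: coideal_fullv.
case: (ex_minnP exP) => d /asboolP[I [cI fI dI]] dmin.
exists I; split=> // J cJ fJ.
suff /eqP <- : (I :&: J)%VS == I by exact: capvSr.
rewrite eqEdim capvSl dI dmin //; apply/asboolP; exists (I :&: J)%VS.
by rewrite memv_cap fI; split=> //; exact: coideal_capv.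
Qed.

Definition e1 : KD := (4 * n)%:R^-1 *:
  \sum_(k < 2 * n) (lam (a ^+ k)%g + lam (b * a ^+ k)%g).
Definition e2 : KD := (4 * n)%:R^-1 *:
  \sum_(k < 2 * n) (lam (a ^+ k)%g - lam (b * a ^+ k)%g).
Definition e3 : KD := (4 * n)%:R^-1 *:
  \sum_(k < 2 * n) (-1) ^+ k *: (lam (a ^+ k)%g - lam (b * a ^+ k)%g).
Definition e4 : KD := (4 * n)%:R^-1 *:
  \sum_(k < 2 * n) (-1) ^+ k *: (lam (a ^+ k)%g + lam (b * a ^+ k)%g).

Definition epsilon : C := expi (pi / n%:R).

Definition e11 (j : nat) : KD := (2 * n)%:R^-1 *:
  \sum_(k < 2 * n) epsilon ^- (j * k) *: lam (a ^+ k)%g.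
Definition e22 (j : nat) : KD := (2 * n)%:R^-1 *:
  \sum_(k < 2 * n) epsilon ^+ (j * k) *: lam (a ^+ k)%g.
Definition e12 (j : nat) : KD := (2 * n)%:R^-1 *:
  \sum_(k < 2 * n) epsilon ^+ (j * k) *: lam (b * a ^+ k)%g.
Definition e21 (j : nat) : KD := (2 * n)%:R^-1 *:
  \sum_(k < 2 * n) epsilon ^- (j * k) *: lam (b * a ^+ k)%g.

(* q(0, beta, j) *)
Definition q0 (beta : R) (j : nat) : KD :=
  2^-1 *: (e11 j + expi (- beta) *: e12 j + expi beta *: e21 j + e22 j).

Definition K2 : {vspace KD} := gen_coideal (e1 + e2).
Definition K3 : {vspace KD} := gen_coideal (e1 + e3).
Definition K4 : {vspace KD} := gen_coideal (e1 + e4).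

Definition coideals4 (K : {vspace KD}) : set {vspace KD} :=
  [set I | [/\ coideal_subalgebra I, \dim I = 4 & (I <= K)%VS]].

Definition pJ (k : nat) : KD :=
  e1 + (if odd k then e3 else e4) +
  \sum_(1 <= j < n./2) q0 ((2 * k * j)%:R * pi / n%:R) (2 * j).

Definition is_J (k : nat) (I : {vspace KD}) : Prop :=
  [/\ coideal_subalgebra I, \dim I = 4 & jones_projection I (pJ k)].

(* Phi is an isomorphism of Kac algebras from the algebra of functions on the
   finite group hT, with coproduct f |-> ((s, t) |-> f (s t)), onto K. *)
Definition kac_iso_functions (hT : finGroupType)
    (Phi : 'Hom({ffun hT -> C^o}, KD)) (K : {vspace KD}) : Prop :=
  let Fun : Type := {ffun hT -> C^o} in
  let delta (s : hT) : Fun := [ffun t => (t == s)%:R : C^o] in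
  [/\ lker Phi = 0%VS /\ limg Phi = K,
      Phi [ffun=> 1] = 1 /\
        (forall f g : Fun, Phi [ffun s => f s * g s] = Phi f * Phi g),
      (forall f : Fun, Phi [ffun s => (f s)^* : C^o] = ga_star (Phi f)),
      (forall f : Fun, Delta (Phi f) = \sum_s \sum_t
         (f (s * t)%g : C) *: tensor (Phi (delta s)) (Phi (delta t))) &
      (forall f : Fun, counit (Phi f) = f 1%g) /\
        (forall f : Fun, antipode (Phi f) = Phi [ffun s => f s^-1%g])].

(* hT stands for D_n, generated by al and an involution. *)
Definition is_J20 (hT : finGroupType) (al : hT) (I : {vspace KD}) : Prop :=
  exists2 Phi, kac_iso_functions Phi K2 &
  forall x, x \in I <-> exists2 f : {ffun hT -> C^o},
    (forall s t, t \in (<[al ^+ 2]> :* s)%g -> f t = f s) & x = Phi f.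

End KD.

(* Main.v *)
From HB Require Import structures.
From mathcomp Require Import all_boot all_order all_algebra all_fingroup all_solvable all_field.
From mathcomp Require Import complex.
From mathcomp Require Import all_classical all_reals trigo.
From mathcomp Require Import ring zify.
Require Import Defs.

(** Let z = a^n, a central involution, and let P+ = (1 + z) / 2 and P- = (1 - z) / 2
    be its spectral projections ([Pp], [Pm]).  The unitary
    U = P+ + P- ((1 + b) / 2 + i (1 - b) / 2) of the group algebra of the Klein
    group <z, b> satisfies Omega Delta_s(U) = (U (x) U) (P+ (x) 1 + P- (x) b)
    ([Omega_gauge]).  Hence the inner automorphism x |-> U x U* ([gauge]) carries
    the coproduct that maps a group element g to
    P+ g (x) g + P- g (x) b g b to the coproduct of KD(n) ([Delta_gauge],
    [twisted_Delta_lam]).  Everything is done for this simpler coproduct.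
    Its slices show that a *-subalgebra I is a left coideal exactly when, for
    every x in I and every g, with u and v the sum and the difference of the
    coefficients of x at g and g z, both u P+ g + v P- g and
    v P+ bgb + u P- bgb belong to I ([twisted_coideal], [coideal_gauge]).
    For instance the span of the kernel of a linear character of the dihedral
    group is such an I; K_2, K_3 and K_4 come from the three nontrivial
    characters of order two ([K2E], [K3E], [K4E]).

    Let I have dimension 4.  If P+ lies in I, then I contains the two halves of
    its elements separately, and with P+ h it contains P- bhb, so I is spanned
    by P+, P-, P+ h and P- bhb for some h with h^2 in <z>
    ([split_coideal]); modulo z, this h is a reflection b a^k or the rotation
    a^m.  If P+ is not in I, then every u P+ g + v P- g in I has |u| = |v|,
    because its product with its adjoint is a combination of P+ and P- in I.
    So I has at most one such element for each g, up to a scalar, and I is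
    complementary to z I in the span of the group L of those g for which there
    is one; thus L has order 8 ([card_nonsplit]).  A group of order 8 contains
    a^m ([order8_quarter]).  It contains no reflection g, for the elements of I
    above g and a^m would both commute and commute up to z.  So L is generated
    by w = a^(m/2), with m even, and I is spanned by the P+ w^i + c^i P- w^i
    with c^4 = -1, which gives four coideals ([nonsplit_classification]).

    The projection that defines J_k is P+ (1 + b a^k) / 2 ([pJE]); it is fixed by
    [gauge], so J_k is the coideal of the reflection b a^k.  Which coideal lies
    in which K_i is read off the characters.  The coideal of a^m and the four
    cyclic ones are those of K_2.

    The coideal of a^m is the span of <a^m> ([involution_coideal_center]).  For
    the identification with J_20, the elements of D_n are parametrised by
    the 2n-th roots of unity, al^r by eps^(2r) and be al^r by eps^(1 - 2r)
    ([root_of]).  The root attached to s t is that of s times that of t or its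
    inverse, according to whether s is a rotation or a reflection
    ([root_ofM]).  This is the rule that the twisted coproduct follows on the
    powers of a, so the Fourier transform from functions on D_n to the span of
    <a>, followed by [gauge], is an isomorphism of Kac algebras onto K_2
    ([kac_isoP]); it maps the functions constant on the cosets of <al^2> onto
    the span of <a^m> ([J20_dual]). *)

Set Implicit Arguments.
Unset Strict Implicit.
Unset Printing Implicit Defensive.

Import GRing.Theory Num.Theory.

Local Open Scope ring_scope.

(** * Group algebras and their tensor squares *)

Section GroupAlgebraTheory.

Variables (F : fieldType) (gT : finGroupType).
Local Notation A := (group_algebra F gT).
Local Notation lam := (@ga_lambda F gT).
Implicit Types x y : A.

Lemma ga_addE x y g : (x + y) g = x g + y g.
Proof. exact: ffunE. Qed.

Lemma ga_oppE x g : (- x) g = - x g.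
Proof. exact: ffunE. Qed.

Lemma ga_scaleE c x g : (c *: x) g = c * x g.
Proof. exact: ffunE. Qed.

Lemma ga_sumE I (r : seq I) P (f : I -> A) g :
  (\sum_(i <- r | P i) f i) g = \sum_(i <- r | P i) f i g.
Proof. by elim/big_rec2: _ => [|i y1 y2 _ <-]; exact: ffunE. Qed.

Lemma ga_mulE x y g : (x * y) g = \sum_h x h * y (h^-1 * g)%g.
Proof. exact: ffunE. Qed.

Lemma lamE g h : lam g h = (h == g)%:R.
Proof. exact: ffunE. Qed.

Lemma ga_expand x : x = \sum_g (x g : F) *: lam g.
Proof.
apply/ffunP=> h; rewrite ga_sumE (bigD1 h) //= ga_scaleE lamE eqxx mulr1.
rewrite big1 ?addr0 // => g gh.
by rewrite ga_scaleE lamE eq_sym (negbTE gh) mulr0.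
Qed.

Lemma mullamE g x h : (lam g * x) h = x (g^-1 * h)%g.
Proof.
rewrite ga_mulE (bigD1 g) //= lamE eqxx mul1r big1 ?addr0 // => k kg.
by rewrite lamE (negbTE kg) mul0r.
Qed.

Lemma lamM g h : lam g * lam h = lam (g * h)%g.
Proof.
by apply/ffunP=> k; rewrite mullamE !lamE -(inj_eq (mulgI g)) mulKVg.
Qed.

Lemma lam1 : lam 1%g = 1.
Proof. by []. Qed.

Lemma mul_commlam z x : (forall g, z * g = g * z)%g -> lam z * x = x * lam z.
Proof.
move=> zC; rewrite [x]ga_expand mulr_sumr mulr_suml; apply: eq_bigr => g _.
by rewrite -scalerAl -scalerAr !lamM zC.
Qed.

End GroupAlgebraTheory.

Section TensorTheory.

Variables (F : fieldType) (gT : finGroupType).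
Local Notation A := (group_algebra F gT).
Local Notation A2 := (group_algebra F (gT * gT)%type).
Local Notation lam := (@ga_lambda F gT).
Implicit Types x y : A.

Lemma tensorE x y g h : tensor x y (g, h) = x g * y h.
Proof. exact: ffunE. Qed.

Lemma sliceE g (z : A2) h : slice g z h = z (g, h).
Proof. exact: ffunE. Qed.

Lemma tensor_lam g h : tensor (lam g) (lam h) = @ga_lambda F (gT * gT)%type (g, h).
Proof.
by apply/ffunP=> -[k l]; rewrite tensorE !lamE xpair_eqE -natrM mulnb.
Qed.

Lemma tensorZl c x y : tensor (c *: x) y = c *: tensor x y.
Proof. exact: (linearZ_LR (tensorr y)). Qed.
Lemma tensorZr c x y : tensor x (c *: y) = c *: tensor x y.
Proof. exact: (linearZ_LR (tensor x)). Qed.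
Lemma tensor_suml I (r : seq I) P (f : I -> A) y :
  tensor (\sum_(i <- r | P i) f i) y = \sum_(i <- r | P i) tensor (f i) y.
Proof. exact: (linear_sum (tensorr y)). Qed.
Lemma tensor_sumr I (r : seq I) P (f : I -> A) x :
  tensor x (\sum_(i <- r | P i) f i) = \sum_(i <- r | P i) tensor x (f i).
Proof. exact: (linear_sum (tensor x)). Qed.

Lemma tensorM x y x' y' : tensor x y * tensor x' y' = tensor (x * x') (y * y').
Proof.
apply/ffunP=> -[g h]; rewrite tensorE !ga_mulE big_distrlr /= pair_bigA /=.
apply: eq_bigr => -[k l] _ /=; rewrite !tensorE mulrACA.
by [].
Qed.

Lemma slice_tensor g x y : slice g (tensor x y) = (x g : F) *: y.
Proof. by apply/ffunP=> h; rewrite sliceE tensorE ga_scaleE. Qed.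

Lemma tensor_slices (z : A2) : z = \sum_g tensor (lam g) (slice g z).
Proof.
apply/ffunP=> -[g h]; rewrite ga_sumE (bigD1 g) //= tensorE sliceE lamE eqxx.
rewrite mul1r big1 ?addr0 // => k kg.
by rewrite tensorE lamE eq_sym (negbTE kg) mul0r.
Qed.

(** The cross terms contain the product of two central idempotents with product 0. *)
Lemma central_idempotents_conj p q x y :
    p * p = p -> q * q = q -> p * q = 0 -> q * p = 0 ->
    (forall w, p * w = w * p) -> (forall w, q * w = w * q) ->
  (tensor p 1 + tensor q y) * tensor x x * (tensor p 1 + tensor q y) =
  tensor (p * x) x + tensor (q * x) (y * x * y).
Proof.
move=> pp qq pq qp pC qC.
rewrite mulrDl mulrDr !mulrDl !tensorM !mul1r !mulr1.
rewrite -![p * x * _]mulrA -![q * x * _]mulrA -!pC -!qC !mulrA pp qq pq qp !mul0r.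
by rewrite -![tensor 0 _]/(tensorr _ 0) !linear0 addr0 add0r.
Qed.

Lemma tensorv_conj (I J : {vspace A}) u v u' v' (w : A2) :
    (forall y, y \in I -> v * y * v' \in J) -> w \in tensorv fullv I ->
  tensor u v * w * tensor u' v' \in tensorv fullv J.
Proof.
move=> IJ /tensor_fullvP wI; rewrite [w]tensor_slices mulr_sumr mulr_suml.
apply: rpred_sum => g _; rewrite !tensorM mem_tensorv ?memvf ?IJ //.
Qed.

End TensorTheory.

Section StarTheory.

Variables (F : numClosedFieldType) (gT : finGroupType).
Local Notation C := F.
Local Notation A := (group_algebra C gT).
Local Notation lam := (@ga_lambda C gT).
Implicit Types x y : A.

(** [star], [dcop], [aug] and [inva] are [ga_star], [Delta_s], [counit] and [antipode]
    over an abstract field [F], and are convertible to them for [F := R[i]]. *)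
Definition star (hT : finGroupType) (x : group_algebra F hT) :
  group_algebra F hT := [ffun g => (x g^-1%g)^* : F^o].

Definition dcop (x : A) : group_algebra F (gT * gT)%type :=
  \sum_g (x g : F) *: tensor (lam g) (lam g).

Definition aug (x : A) : F := \sum_g x g.

Definition inva (x : A) : A := [ffun g => x g^-1%g].

Lemma starE x g : star x g = (x g^-1%g)^*.
Proof. exact: ffunE. Qed.

Lemma star_lam g : star (lam g) = lam g^-1%g.
Proof.
by apply/ffunP=> h; rewrite starE !lamE rmorph_nat -(inj_eq invg_inj) invgK.
Qed.

Lemma starD x y : star (x + y) = star x + star y.
Proof. by apply/ffunP=> h; rewrite !(starE, ga_addE) rmorphD. Qed.

Lemma starZ (c : F) x : star (c *: x) = c^* *: star x.
Proof. by apply/ffunP=> h; rewrite !(starE, ga_scaleE) rmorphM. Qed.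

Lemma star0 : star (0 : A) = 0.
Proof. by rewrite -(scale0r (0 : A)) starZ rmorph0 !scale0r. Qed.

Lemma star_sum I (r : seq I) P (f : I -> A) :
  star (\sum_(i <- r | P i) f i) = \sum_(i <- r | P i) star (f i).
Proof. exact: (big_morph _ starD star0). Qed.

Lemma starM x y : star (x * y) = star y * star x.
Proof.
rewrite [x]ga_expand [y]ga_expand mulr_suml !star_sum mulr_sumr.
apply: eq_bigr => g _; rewrite mulr_sumr star_sum mulr_suml.
apply: eq_bigr => h _.
rewrite -scalerAl -scalerAr !starZ -scalerAl -scalerAr lamM !star_lam.
by rewrite lamM invMg !scalerA mulrC.
Qed.

Lemma starK : involutive (@star gT).
Proof. by move=> x; apply/ffunP=> h; rewrite !starE invgK conjCK. Qed.

Lemma star1 : star (1 : A) = 1.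
Proof. by rewrite -lam1 star_lam invg1. Qed.

Lemma dcop_lam g : dcop (lam g) = tensor (lam g) (lam g).
Proof.
rewrite /dcop (bigD1 g) //= lamE eqxx scale1r big1 ?addr0 // => h hg.
by rewrite lamE (negbTE hg) scale0r.
Qed.

Lemma dcop_linear : linear dcop.
Proof.
move=> c x y; rewrite /dcop scaler_sumr -big_split /=; apply: eq_bigr => g _.
by rewrite ga_addE ga_scaleE scalerDl scalerA.
Qed.
HB.instance Definition _ := GRing.isLinear.Build C A
  (group_algebra C (gT * gT)%type) *:%R dcop dcop_linear.

Lemma dcopM x y : dcop (x * y) = dcop x * dcop y.
Proof.
rewrite [x]ga_expand [y]ga_expand mulr_suml !linear_sum /= mulr_suml.
apply: eq_bigr => g _; rewrite mulr_sumr linear_sum mulr_sumr.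
apply: eq_bigr => h _; rewrite -scalerAl -scalerAr lamM !linearZ /= !dcop_lam.
by rewrite -scalerAl -scalerAr tensorM !lamM.
Qed.

Lemma aug_linear : linear (aug : A -> C^o).
Proof.
move=> c x y; rewrite /aug scaler_sumr -big_split /=; apply: eq_bigr => g _.
by rewrite ga_addE ga_scaleE.
Qed.
HB.instance Definition _ := GRing.isLinear.Build C A C^o *:%R
  (aug : A -> C^o) aug_linear.

Lemma aug_lam g : aug (lam g) = 1.
Proof.
rewrite /aug (bigD1 g) //= lamE eqxx big1 ?addr0 // => h hg.
by rewrite lamE (negbTE hg).
Qed.

Lemma augM x y : aug (x * y) = aug x * aug y.
Proof.
rewrite [x]ga_expand [y]ga_expand mulr_suml !linear_sum /= mulr_suml.
apply: eq_bigr => g _; rewrite mulr_sumr linear_sum mulr_sumr.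
apply: eq_bigr => h _.
rewrite -scalerAl -scalerAr lamM !linearZ /= !aug_lam.
by rewrite /GRing.scale /= !mulr1.
Qed.

Lemma inva_linear : linear inva.
Proof. by move=> c x y; apply/ffunP=> g; rewrite !ffunE. Qed.
HB.instance Definition _ := GRing.isLinear.Build C A A *:%R
  inva inva_linear.

Lemma inva_lam g : inva (lam g) = lam g^-1%g.
Proof.
by apply/ffunP=> h; rewrite ffunE !lamE -(inj_eq invg_inj) invgK.
Qed.

Lemma invaM x y : inva (x * y) = inva y * inva x.
Proof.
rewrite [x]ga_expand [y]ga_expand mulr_suml !linear_sum mulr_sumr.
apply: eq_bigr => g _; rewrite mulr_sumr linear_sum mulr_suml.
apply: eq_bigr => h _; rewrite -scalerAl -scalerAr lamM !linearZ /= !inva_lam.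
by rewrite -scalerAl -scalerAr lamM invMg !scalerA mulrC.
Qed.

End StarTheory.

Lemma star_tensor (F : numClosedFieldType) (gT : finGroupType)
    (x y : group_algebra F gT) :
  star (tensor x y) = tensor (star x) (star y).
Proof. by apply/ffunP=> -[g h]; rewrite starE !tensorE !starE rmorphM. Qed.

Lemma star_twist (F : numClosedFieldType) (gT : finGroupType)
    (p q y : group_algebra F gT) :
    star p = p -> star q = q -> star y = y ->
  star (tensor p 1 + tensor q y) = tensor p 1 + tensor q y.
Proof.
by move=> pS qS yS; rewrite starD !star_tensor star1 pS qS yS.
Qed.

Lemma dcop_star (F : numClosedFieldType) (gT : finGroupType) (x : group_algebra F gT) :
  dcop (star x) = star (dcop x).
Proof.
rewrite [x]ga_expand star_sum !linear_sum star_sum; apply: eq_bigr => g _.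
rewrite linearZ !starZ star_lam linearZ /= !dcop_lam.
by rewrite star_tensor star_lam.
Qed.

(** * The cocycle Omega is a twisted coboundary *)

(** The group law of the Klein group, for the numbering of its elements by
    [Omega_index]. *)
Definition klein_mul (i j : 'I_4) : 'I_4 :=
  let o k : 'I_4 := nth ord0 [:: ord0; lift ord0 ord0; lift ord0 (lift ord0 ord0); ord_max] k in
  nth ord0 (nth [::] [:: [:: o 0; o 1; o 2; o 3]; [:: o 1; o 0; o 3; o 2];
                         [:: o 2; o 3; o 0; o 1]; [:: o 3; o 2; o 1; o 0]] i) j.

Lemma ord4_ind (P : 'I_4 -> Prop) :
  P ord0 -> P (lift ord0 ord0) -> P (lift ord0 (lift ord0 ord0)) ->
  P (lift ord0 (lift ord0 (lift ord0 ord0))) -> forall i, P i.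
Proof.
move=> P0 P1 P2 P3 [[|[|[|[|//]]]] lti];
  [move: P0 | move: P1 | move: P2 | move: P3]; by congr P; apply: val_inj.
Qed.

Lemma klein_mulK i : involutive (klein_mul i).
Proof.
by move=> j; apply: val_inj; elim/ord4_ind: i; elim/ord4_ind: j.
Qed.

Lemma klein_mulC i j : klein_mul i j = klein_mul j i.
Proof. by apply: val_inj; elim/ord4_ind: i; elim/ord4_ind: j. Qed.

Lemma sum4 (V : nmodType) (f : 'I_4 -> V) :
  \sum_i f i = f ord0 + f (lift ord0 ord0) + f (lift ord0 (lift ord0 ord0)) + f ord_max.
Proof.
rewrite !big_ord_recl big_ord0 addr0 !addrA; congr (_ + f _).
exact: val_inj.
Qed.

Section GaugeCoefficients.

Variables (F : numFieldType) (I : F).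
Hypothesis II : I * I = -1.

(** The coefficients of P+ + P- ((1 + b) / 2 + I (1 - b) / 2) on 1, z, b and bz,
    where P+ = (1 + z) / 2 and P- = (1 - z) / 2. *)
Definition gauge_coef (i : 'I_4) : F :=
  nth 0 [:: (3 + I) / 4; (1 - I) / 4; (1 - I) / 4; (I - 1) / 4] i.
Definition gauge_coef_conj (i : 'I_4) : F :=
  nth 0 [:: (3 - I) / 4; (1 + I) / 4; (1 + I) / 4; (- I - 1) / 4] i.

Lemma gauge_coefV i : \sum_k gauge_coef (klein_mul i k) * gauge_coef_conj k =
  nth 0 [:: 1; 0; 0; 0] i.
Proof.
by rewrite sum4 /gauge_coef /gauge_coef_conj; elim/ord4_ind: i => /=; field: II.
Qed.

Definition Pp_coef (i : 'I_4) : F := nth 0 [:: 2^-1; 2^-1; 0; 0] i.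
Definition Pm_coef (i : 'I_4) : F := nth 0 [:: 2^-1; - 2^-1; 0; 0] i.
Definition b_coef (i : 'I_4) : F := nth 0 [:: 0; 0; 1; 0] i.

(** [Omega_gauge] read on coefficients: the sixteen identities hold in the field
    generated by a square root of -1. *)
Lemma gauge_coef_Omega (nu nub : F) : nu = -1 + 2 * I -> nub = -1 - 2 * I ->
  forall i j : 'I_4,
  \sum_k 8^-1 * nth 0 (nth [::] [:: [:: 5; 1; 1; 1]; [:: 1; 1; nub; nu];
      [:: 1; nu; 1; nub]; [:: 1; nub; nu; 1]] (klein_mul i k)) (klein_mul j k) *
      gauge_coef k =
  (\sum_k gauge_coef (klein_mul i k) * Pp_coef k) * gauge_coef j +
  (\sum_k gauge_coef (klein_mul i k) * Pm_coef k) *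
    (\sum_k gauge_coef (klein_mul j k) * b_coef k).
Proof.
move=> -> -> i j; rewrite !sum4 /gauge_coef /Pp_coef /Pm_coef /b_coef.
elim/ord4_ind: i; elim/ord4_ind: j; rewrite /= ?(mulr0, addr0, add0r, mulr1);
  by field: II.
Qed.

End GaugeCoefficients.

Section Gauge.

Variables (F : numClosedFieldType) (I : F) (gT : finGroupType) (n : nat) (a b : gT).
Local Notation C := F.
Hypothesis II : I * I = -1.
Hypothesis Ic : I^* = - I.
Local Notation A := (group_algebra C gT).
Local Notation A2 := (group_algebra C (gT * gT)%type).
Local Notation lam := (@ga_lambda C gT).
Local Notation lam2 := (@ga_lambda C (gT * gT)%type).
Local Notation z := (a ^+ n)%g.
Hypothesis zC : forall g, (z * g = g * z)%g.
Hypothesis zz : (z * z = 1)%g.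
Hypothesis bb : (b * b = 1)%g.

Local Notation h := (tnth (Omega_index n a b)).

Lemma Omega_indexM i j : (h i * h j = h (klein_mul i j))%g.
Proof.
elim/ord4_ind: i; elim/ord4_ind: j; rewrite !(tnth_nth 1%g) /= ?mul1g ?mulg1 ?zz ?bb ?zC //.
all: try by rewrite -mulgA zz mulg1.
all: try by rewrite mulgA bb mul1g.
all: by rewrite ?mulgA -(mulgA b z b) zC !mulgA bb mul1g ?zz.
Qed.

Definition klein (c : 'I_4 -> C) : A := \sum_i c i *: lam (h i).
Definition klein2 (c : 'I_4 -> 'I_4 -> C) : A2 :=
  \sum_i \sum_j c i j *: lam2 (h i, h j).

(** Products are convolutions over the Klein group, where each element is its own
    inverse. *)
Lemma kleinM c d :
  klein c * klein d = klein (fun i => \sum_k c (klein_mul i k) * d k).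
Proof.
rewrite /klein mulr_sumr [RHS](eq_bigr (fun i => \sum_k
  (c (klein_mul i k) * d k) *: lam (h i))); last first.
  by move=> i _; rewrite scaler_suml.
rewrite [RHS]exchange_big /=; apply: eq_bigr => k _; rewrite mulr_suml.
rewrite [RHS](reindex_inj (can_inj (klein_mulK k))) /=.
apply: eq_bigr => i _; rewrite -scalerAl -scalerAr lamM Omega_indexM scalerA.
by rewrite ![klein_mul _ k]klein_mulC klein_mulK.
Qed.

Lemma klein2_diagM c d :
  klein2 c * (\sum_k d k *: lam2 (h k, h k)) =
  klein2 (fun i j => \sum_k c (klein_mul i k) (klein_mul j k) * d k).
Proof.
rewrite /klein2 mulr_sumr [RHS](eq_bigr (fun i => \sum_k \sum_j
  (c (klein_mul i k) (klein_mul j k) * d k) *: lam2 (h i, h j))); last first.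
  move=> i _; rewrite exchange_big; apply: eq_bigr => j _.
  by rewrite scaler_suml.
rewrite [RHS]exchange_big /=; apply: eq_bigr => k _; rewrite mulr_suml.
rewrite [RHS](reindex_inj (can_inj (klein_mulK k))) /=.
apply: eq_bigr => i _; rewrite mulr_suml.
rewrite [RHS](reindex_inj (can_inj (klein_mulK k))) /=.
apply: eq_bigr => j _.
rewrite ![klein_mul _ k]klein_mulC !klein_mulK -scalerAl -scalerAr lamM scalerA.
by rewrite ![klein_mul k _]klein_mulC -!Omega_indexM.
Qed.

Lemma tensor_klein c d : tensor (klein c) (klein d) = klein2 (fun i j => c i * d j).
Proof.
rewrite tensor_suml; apply: eq_bigr => i _; rewrite tensor_sumr.
by apply: eq_bigr => j _; rewrite tensorZl tensorZr tensor_lam scalerA.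
Qed.

Lemma klein2D c d : klein2 c + klein2 d = klein2 (fun i j => c i j + d i j).
Proof.
rewrite -big_split; apply: eq_bigr => i _; rewrite -big_split.
by apply: eq_bigr => j _; rewrite scalerDl.
Qed.

Lemma eq_klein2 c d : c =2 d -> klein2 c = klein2 d.
Proof. by move=> cd; apply: eq_bigr => i _; apply: eq_bigr => j _; rewrite cd. Qed.

Lemma eq_klein c d : c =1 d -> klein c = klein d.
Proof. by move=> cd; apply: eq_bigr => i _; rewrite cd. Qed.

Definition gauge_unitary : A := klein (gauge_coef I).
Local Notation U := gauge_unitary.

Definition Pp : A := 2^-1 *: (1 + lam z).
Definition Pm : A := 2^-1 *: (1 - lam z).

Definition twist : A2 := tensor Pp 1 + tensor Pm (lam b).

Lemma Pp_klein : Pp = klein (Pp_coef C).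
Proof. by rewrite /klein sum4 !(tnth_nth 1%g) /= !scale0r !addr0 -scalerDr. Qed.

Lemma Pm_klein : Pm = klein (Pm_coef C).
Proof.
by rewrite /klein sum4 !(tnth_nth 1%g) /= !scale0r !addr0 scaleNr -scalerBr.
Qed.

Lemma lamb_klein : lam b = klein (b_coef C).
Proof.
by rewrite /klein sum4 !(tnth_nth 1%g) /= !scale0r !addr0 !add0r scale1r.
Qed.

(** Omega is the product of the coboundary of [U] and of [twist], whose effect on a
    group element is explicit: this is what makes the coproduct of KD(n)
    tractable. *)
Lemma Omega_gauge (c : 'I_4 -> 'I_4 -> F) (nu nub : F) :
    nu = -1 + 2 * I -> nub = -1 - 2 * I ->
    (forall i j : 'I_4, c i j = 8^-1 * nth 0 (nth [::]
      [:: [:: 5; 1; 1; 1]; [:: 1; 1; nub; nu];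
          [:: 1; nu; 1; nub]; [:: 1; nub; nu; 1]] i) j) ->
  klein2 c * dcop U = tensor U U * twist.
Proof.
move=> nuE nubE cE.
have -> : dcop U = \sum_k gauge_coef I k *: lam2 (h k, h k).
  rewrite linear_sum; apply: eq_bigr => k _.
  by rewrite linearZ /= dcop_lam tensor_lam.
have -> : tensor U U * twist = klein2 (fun i j =>
    (\sum_k gauge_coef I (klein_mul i k) * Pp_coef F k) * gauge_coef I j +
    (\sum_k gauge_coef I (klein_mul i k) * Pm_coef F k) *
      (\sum_k gauge_coef I (klein_mul j k) * b_coef F k)).
  rewrite -klein2D -!tensor_klein mulrDr !tensorM mulr1.
  rewrite Pp_klein Pm_klein lamb_klein.
  by congr (tensor _ _ + tensor _ _); exact: kleinM.
rewrite klein2_diagM; apply: eq_klein2 => i j.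
rewrite -(gauge_coef_Omega II nuE nubE); apply: eq_bigr => k _.
by rewrite cE.
Qed.

Lemma Omega_indexV i : (h i)^-1%g = h i.
Proof.
apply: (mulgI (h i)); rewrite mulgV Omega_indexM.
by elim/ord4_ind: i.
Qed.

Lemma lam_inv_klein i : star (lam (h i)) = lam (h i).
Proof. by rewrite star_lam Omega_indexV. Qed.

Lemma gauge_unitaryE : U * star U = 1.
Proof.
have conj_coef i : (gauge_coef I i)^* = gauge_coef_conj I i.
  rewrite /gauge_coef /gauge_coef_conj; elim/ord4_ind: i => /=;
  by rewrite rmorphM fmorphV rmorph_nat !(rmorphD, rmorphN, rmorph_nat, rmorph1) /= Ic ?opprK.
have -> : star U = klein (gauge_coef_conj I).
  rewrite star_sum; apply: eq_bigr => i _.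
  by rewrite starZ lam_inv_klein; congr (_ *: _); exact: conj_coef.
have -> : 1 = klein (fun i => nth 0 [:: 1; 0; 0; 0] i).
  by rewrite /klein sum4 !(tnth_nth 1%g) /= !scale0r !addr0 scale1r.
by rewrite kleinM; apply: eq_klein => i; rewrite (gauge_coefV II).
Qed.

End Gauge.

(** * Coideal subalgebras in twisted coordinates *)

Lemma scaler_half (F : numFieldType) (V : lmodType F) (v : V) :
  2^-1 *: (v + v) = v.
Proof. by rewrite -mulr2n -[v *+ 2]scaler_nat scalerA mulVf ?scale1r ?pnatr_eq0. Qed.

Lemma scaler_half_sum (F : numFieldType) (V : lmodType F) (p q : V) :
  2^-1 *: (p + q) + 2^-1 *: (p - q) = p.
Proof. by rewrite -scalerDr addrACA subrr addr0 scaler_half. Qed.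

Lemma scaler_half_diff (F : numFieldType) (V : lmodType F) (p q : V) :
  2^-1 *: (p + q) - 2^-1 *: (p - q) = q.
Proof. by rewrite -scalerBr opprB addrC addrA subrK scaler_half. Qed.

Section LmodIdentities.

Variables (F : fieldType) (V : lmodType F).
Implicit Types (r s t : F) (p q : V).

Lemma scaler_sum_diff s t p q :
  (s + t) *: p + (s - t) *: q = s *: (p + q) + t *: (p - q).
Proof. by rewrite !scalerDr !scalerDl scalerN scaleNr addrACA. Qed.

Lemma scaler_diff_sum s t p q :
  (s - t) *: p + (s + t) *: q = s *: (p + q) - t *: (p - q).
Proof.
by rewrite !scalerDr !scalerDl scalerN scaleNr opprD opprK addrACA.
Qed.

Lemma scaler_sum_diffA r s t u p q :
  u *: ((r * (s + t)) *: p + (r * (s - t)) *: q) =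
  u *: (r *: (s *: (p + q))) + u *: (r *: (t *: (p - q))).
Proof.
rewrite -!(scalerA r) -scalerDr scaler_sum_diff [r *: (_ + _)]scalerDr.
rewrite [u *: (_ + _)]scalerDr !scalerA.
by congr (_ *: _ + _ *: _); ring.
Qed.

Lemma scaler_regroup r s t p q p' q' :
  s *: (r *: (p + q)) + t *: (r *: (p' - q')) =
  r *: (s *: p + t *: p' + (s *: q - t *: q')).
Proof.
rewrite (scalerA s) (scalerA t) (mulrC s) (mulrC t) -!scalerA -scalerDr.
by rewrite !scalerDr scalerN addrACA.
Qed.

End LmodIdentities.

Section GaugeAutomorphism.

Variables (F : numClosedFieldType) (i0 : F) (gT : finGroupType) (n : nat) (a b : gT).
Local Notation C := F.
Hypothesis II : i0 * i0 = -1.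
Hypothesis Ic : i0^* = - i0.
Local Notation A := (group_algebra C gT).
Local Notation A2 := (group_algebra C (gT * gT)%type).
Local Notation lam := (@ga_lambda C gT).
Local Notation z := (a ^+ n)%g.
Hypothesis zC : forall g, (z * g = g * z)%g.
Hypothesis zz : (z * z = 1)%g.
Hypothesis bb : (b * b = 1)%g.
Implicit Types (x y : A) (I J : {vspace A}) (g h : gT).

Local Notation U := (gauge_unitary i0 n a b).
Local Notation Pp := (Pp F n a).
Local Notation Pm := (Pm F n a).

Definition gauge x : A := U * x * star U.
Definition ungauge x : A := star U * x * U.

Fact gauge_linear : linear gauge.
Proof.
by move=> c x y; rewrite /gauge mulrDr mulrDl -scalerAr -scalerAl.
Qed.
HB.instance Definition _ := GRing.isLinear.Build C A A *:%R gauge gauge_linear.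

Fact ungauge_linear : linear ungauge.
Proof.
by move=> c x y; rewrite /ungauge mulrDr mulrDl -scalerAr -scalerAl.
Qed.
HB.instance Definition _ := GRing.isLinear.Build C A A *:%R ungauge ungauge_linear.

Lemma klein_comm (c : 'I_4 -> C) (x : A) :
    (forall i, x * lam (tnth (Omega_index n a b) i) =
               lam (tnth (Omega_index n a b) i) * x) ->
  x * klein n a b c = klein n a b c * x.
Proof.
move=> xC; rewrite mulr_sumr mulr_suml; apply: eq_bigr => i _.
by rewrite -scalerAr -scalerAl xC.
Qed.

Lemma gauge_unitaryV : star U * U = 1.
Proof.
rewrite -(gauge_unitaryE II Ic zC zz bb) -[in RHS](starK U).
have starC i : star U * lam (tnth (Omega_index n a b) i) =
    lam (tnth (Omega_index n a b) i) * star U.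
  rewrite -(lam_inv_klein F zC zz bb i) -!starM; congr star.
  apply: klein_comm => j; rewrite !lamM !(Omega_indexM zC zz bb).
  by elim/ord4_ind: i; elim/ord4_ind: j.
by rewrite (klein_comm _ starC) starK.
Qed.

Lemma gaugeK : cancel gauge ungauge.
Proof.
by move=> x; rewrite /ungauge /gauge !mulrA gauge_unitaryV mul1r -mulrA gauge_unitaryV mulr1.
Qed.

Lemma ungaugeK : cancel ungauge gauge.
Proof.
have UU := gauge_unitaryE II Ic zC zz bb.
by move=> x; rewrite /ungauge /gauge !mulrA UU mul1r -mulrA UU mulr1.
Qed.

Lemma gaugeM x y : gauge (x * y) = gauge x * gauge y.
Proof.
by rewrite /gauge !mulrA -(mulrA (U * x) (star U)) gauge_unitaryV mulr1.
Qed.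

Lemma gauge1 : gauge 1 = 1.
Proof. by rewrite /gauge mulr1 (gauge_unitaryE II Ic zC zz bb). Qed.

Lemma gauge_star x : star (gauge x) = gauge (star x).
Proof. by rewrite /gauge !starM starK mulrA. Qed.

Lemma aug_gauge x : aug (gauge x) = aug x.
Proof.
rewrite !augM mulrAC -augM (gauge_unitaryE II Ic zC zz bb) -(lam1 F gT).
by rewrite aug_lam mul1r.
Qed.

(** The coproduct of KD(n), transported by [gauge]: see [Delta_gauge]. *)
Definition twisted_Delta x : A2 := twist F n a b * dcop x * star (twist F n a b).

Variable Om : A2.
Hypothesis Om_gauge : Om * dcop U = tensor U U * twist F n a b.
(** For [F := R[i]] and [Om := Omega], the coproduct [Delta] of KD(n). *)
Definition Delta_by x : A2 := Om * dcop x * star Om.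

Lemma Delta_gauge x : Delta_by (gauge x) =
  tensor U U * twisted_Delta x * tensor (star U) (star U).
Proof.
rewrite /Delta_by /gauge 2!dcopM.
rewrite dcop_star.
rewrite !mulrA Om_gauge -(mulrA _ (star (dcop U))).
rewrite -starM Om_gauge starM star_tensor.
by rewrite /twisted_Delta !mulrA.
Qed.

Lemma PpPp : Pp * Pp = Pp.
Proof.
have sq : (1 + lam z) * (1 + lam z) = 2 *: (1 + lam z) :> A.
  rewrite mulrDr mulr1 mulrDl mul1r lamM zz lam1 [lam z + 1]addrC.
  by rewrite -mulr2n scaler_nat.
by rewrite /Pp -scalerAl -scalerAr sq !scalerA mulfVK // pnatr_eq0.
Qed.

Lemma PpDPm : Pp + Pm = 1.
Proof.
by rewrite /Pp /Pm -scalerDr addrACA subrr addr0 scaler_half.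
Qed.

Lemma PmE : Pm = 1 - Pp.
Proof. by rewrite -PpDPm addrAC subrr add0r. Qed.

Lemma PmPm : Pm * Pm = Pm.
Proof. by rewrite !PmE mulrBr mulr1 mulrBl mul1r PpPp subrr subr0. Qed.

Lemma PpPm : Pp * Pm = 0.
Proof. by rewrite PmE mulrBr mulr1 PpPp subrr. Qed.

Lemma PmPp : Pm * Pp = 0.
Proof. by rewrite PmE mulrBl mul1r PpPp subrr. Qed.

Lemma PpC x : Pp * x = x * Pp.
Proof.
rewrite /Pp -scalerAl -scalerAr mulrDl mulrDr mul1r mulr1.
by rewrite (mul_commlam _ zC).
Qed.

Lemma PmC x : Pm * x = x * Pm.
Proof. by rewrite PmE mulrBl mulrBr mul1r mulr1 PpC. Qed.

Lemma zV : (z^-1 = z)%g.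
Proof. by apply: (mulgI z); rewrite mulgV zz. Qed.

Lemma Pp_star : star Pp = Pp.
Proof.
by rewrite /Pp starZ starD star1 star_lam zV fmorphV rmorph_nat.
Qed.

Lemma Pm_star : star Pm = Pm.
Proof.
by rewrite PmE starD star1 -scaleN1r starZ Pp_star rmorphN1 scaleN1r.
Qed.

Lemma Pp_lamz : Pp * lam z = Pp.
Proof. by rewrite /Pp -scalerAl mulrDl mul1r lamM zz lam1 addrC. Qed.

Lemma Pm_lamz : Pm * lam z = - Pm.
Proof.
by rewrite /Pm -scalerAl mulrBl mul1r lamM zz lam1 -scalerN opprB.
Qed.

(** The eigencomponents of [lam g] for multiplication by [z], of eigenvalues 1 and -1. *)
Definition pl g : A := Pp * lam g.
Definition mi g : A := Pm * lam g.

Lemma lam_pl_mi g : lam g = pl g + mi g.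
Proof. by rewrite -mulrDl PpDPm mul1r. Qed.

Lemma pl_mulz g : pl (g * z)%g = pl g.
Proof. by rewrite /pl -zC -lamM mulrA Pp_lamz. Qed.

Lemma mi_mulz g : mi (g * z)%g = - mi g.
Proof. by rewrite /mi -zC -lamM mulrA Pm_lamz mulNr. Qed.

Lemma zNK g : (g * z * z = g)%g.
Proof. by rewrite -mulgA zz mulg1. Qed.

Lemma plE g h : pl g h = 2^-1 * ((h == g)%:R + (h == (g * z)%g)%:R).
Proof.
by rewrite /pl /Pp -scalerAl mulrDl mul1r lamM ga_scaleE ga_addE !lamE zC.
Qed.

Lemma miE g h : mi g h = 2^-1 * ((h == g)%:R - (h == (g * z)%g)%:R).
Proof.
by rewrite /mi /Pm -scalerAl mulrBl mul1r lamM ga_scaleE ga_addE ga_oppE !lamE zC.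
Qed.

Lemma plM g h : pl g * pl h = pl (g * h)%g.
Proof. by rewrite /pl mulrA -(mulrA Pp) -PpC mulrA PpPp -mulrA lamM. Qed.
Lemma miM g h : mi g * mi h = mi (g * h)%g.
Proof. by rewrite /mi mulrA -(mulrA Pm) -PmC mulrA PmPm -mulrA lamM. Qed.
Lemma pl_mi g h : pl g * mi h = 0.
Proof. by rewrite /pl /mi mulrA -(mulrA Pp) -PmC mulrA PpPm !mul0r. Qed.
Lemma mi_pl g h : mi g * pl h = 0.
Proof. by rewrite /pl /mi mulrA -(mulrA Pm) -PpC mulrA PmPp !mul0r. Qed.
Lemma pl_star g : star (pl g) = pl g^-1.
Proof. by rewrite /pl starM star_lam Pp_star PpC. Qed.
Lemma mi_star g : star (mi g) = mi g^-1.
Proof. by rewrite /mi starM star_lam Pm_star PmC. Qed.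

Lemma twisted_Delta_lam g :
  twisted_Delta (lam g) = tensor (pl g) (lam g) + tensor (mi g) (lam (b * g * b)%g).
Proof.
have bV : (b^-1)%g = b by apply: (mulgI b); rewrite mulgV bb.
have starT : star (twist F n a b) = twist F n a b.
  apply: star_twist Pp_star Pm_star _.
  by rewrite star_lam bV.
rewrite /twisted_Delta starT dcop_lam -!lamM.
exact: (central_idempotents_conj _ _ PpPp PmPm PpPm PmPp PpC PmC).
Qed.

(** The coordinates of [x] on [pl g] and [mi g]. *)
Definition pcoef g x : C := (x g : C) + x (g * z)%g.
Definition mcoef g x : C := (x g : C) - x (g * z)%g.

(** [homog g x] is the component of [x] on the coset of [g] modulo [z];
    [hflip g x] exchanges its two coordinates and conjugates [g] by [b].  They are
    the two terms of a slice of the twisted coproduct. *)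
Definition homog g x : A := pcoef g x *: pl g + mcoef g x *: mi g.
Definition hflip g x : A :=
  mcoef g x *: pl (b * g * b)%g + pcoef g x *: mi (b * g * b)%g.

Lemma homogE g x : homog g x = (x g : C) *: lam g + (x (g * z)%g : C) *: lam (g * z)%g.
Proof.
by rewrite !lam_pl_mi pl_mulz mi_mulz; exact: scaler_sum_diff.
Qed.

Lemma hflipE g x : hflip g x =
  (x g : C) *: lam (b * g * b)%g - (x (g * z)%g : C) *: lam (b * (g * z) * b)%g.
Proof.
have -> : (b * (g * z) * b = b * g * b * z)%g by rewrite -!mulgA zC.
by rewrite !lam_pl_mi pl_mulz mi_mulz; exact: scaler_diff_sum.
Qed.

Lemma homog_mulz g x : homog (g * z)%g x = homog g x.
Proof. by rewrite !homogE zNK addrC. Qed.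

Lemma hflip_mulz g x : hflip (g * z)%g x = - hflip g x.
Proof. by rewrite !hflipE zNK opprB. Qed.

Lemma twisted_Delta_linear : linear twisted_Delta.
Proof.
move=> c x y; rewrite /twisted_Delta linearP mulrDr mulrDl.
by rewrite -scalerAr -scalerAl.
Qed.
HB.instance Definition _ := GRing.isLinear.Build C A A2 *:%R
  twisted_Delta twisted_Delta_linear.

Lemma sum_delta (V : lmodType C) h (f : gT -> V) :
  \sum_g ((h == g)%:R : C) *: f g = f h.
Proof.
rewrite (bigD1 h) //= eqxx scale1r big1 ?addr0 // => g gh.
by rewrite eq_sym (negbTE gh) scale0r.
Qed.

Lemma slice_twisted_Delta g x :
  slice g (twisted_Delta x) = 2^-1 *: (homog g x + hflip g x).
Proof.
rewrite [x in LHS]ga_expand !linear_sum /=.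
pose f (s : C) h : A := (x h : C) *: (2^-1 *: (lam h + s *: lam (b * h * b)%g)).
transitivity (\sum_h (((g == h)%:R : C) *: f 1 h + ((g == h * z)%g%:R : C) *: f (-1) h)).
  apply: eq_bigr => h _; rewrite !linearZ /= twisted_Delta_lam linearD /=.
  rewrite !slice_tensor plE miE /f !scale1r !scaleN1r.
  exact: scaler_sum_diffA.
transitivity (f 1 g + f (-1) (g * z)%g); last first.
  rewrite /f homogE hflipE scale1r scaleN1r; exact: scaler_regroup.
rewrite big_split /=; congr (_ + _); first exact: sum_delta.
rewrite (reindex_inj (mulIg z)) /=; under eq_bigr do rewrite zNK.
exact: (sum_delta g (fun h => f (-1) (h * z)%g)).
Qed.

(** These are the *-subalgebras that [gauge] maps to coideal subalgebras: see
    [coideal_gauge]. *)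
Definition twisted_coideal I : Prop :=
  [/\ 1 \in I, (forall x y, x \in I -> y \in I -> x * y \in I),
      (forall x, x \in I -> star x \in I) &
      forall x g, x \in I -> homog g x \in I /\ hflip g x \in I].

Definition gauge_img I : {vspace A} := (linfun gauge @: I)%VS.

Lemma mem_gauge_img I x : (gauge x \in gauge_img I) = (x \in I).
Proof.
apply/idP/idP => [/memv_imgP[y yI]|xI].
  by rewrite lfunE /= => /(can_inj gaugeK)->.
by apply/memv_imgP; exists x; rewrite ?lfunE.
Qed.

Lemma mem_gauge_imgE I x : (x \in gauge_img I) = (ungauge x \in I).
Proof. by rewrite -{1}[x]ungaugeK mem_gauge_img. Qed.

Lemma gauge_imgK J : gauge_img (linfun ungauge @: J)%VS = J.
Proof.
apply/vspaceP => x; rewrite mem_gauge_imgE; apply/memv_imgP/idP.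
  by case=> y yJ; rewrite lfunE /= => /(can_inj ungaugeK) ->.
by move=> xJ; exists x; rewrite ?lfunE.
Qed.

Lemma gauge_img_sub I J : (gauge_img I <= gauge_img J)%VS = (I <= J)%VS.
Proof.
apply/subvP/subvP => IJ x; first by rewrite -(mem_gauge_img I) -(mem_gauge_img J); exact: IJ.
by rewrite !mem_gauge_imgE; exact: IJ.
Qed.

Lemma gauge_img_inj : injective gauge_img.
Proof. by move=> I J IJ; apply/vspaceP => x; rewrite -(mem_gauge_img I) -(mem_gauge_img J) IJ. Qed.

Lemma dim_gauge_img I : \dim (gauge_img I) = \dim I.
Proof.
apply: limg_dim_eq; apply/eqP; rewrite -subv0; apply/subvP => x /memv_capP[_].
rewrite memv_ker lfunE memv0 /= => /eqP gx0.
by rewrite -[x]gaugeK gx0 linear0.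
Qed.

(** Replacing [g] by [g * z] changes the sign of [hflip] alone, so half-sums and
    half-differences of the slices at [g] and [g * z] isolate [homog] and [hflip]. *)
Lemma mem_slice_twisted_Delta I :
  (forall x g, x \in I -> homog g x \in I /\ hflip g x \in I) <->
  (forall x, x \in I -> twisted_Delta x \in tensorv fullv I).
Proof.
split=> [IH x xI | ID x g xI].
  apply/tensor_fullvP => g; rewrite slice_twisted_Delta memvZ //.
  by have [? ?] := IH x g xI; rewrite memvD.
have /tensor_fullvP sI := ID x xI.
have := sI g; have := sI (g * z)%g; rewrite !slice_twisted_Delta.
rewrite homog_mulz hflip_mulz => m p; split.
  rewrite (_ : homog g x = 2^-1 *: (homog g x + hflip g x) +
     2^-1 *: (homog g x - hflip g x)) ?memvD //.
  by rewrite scaler_half_sum.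
rewrite (_ : hflip g x = 2^-1 *: (homog g x + hflip g x) -
     2^-1 *: (homog g x - hflip g x)) ?memvB //.
by rewrite scaler_half_diff.
Qed.

Definition coideal_by I : Prop :=
  [/\ 1 \in I, (forall x y, x \in I -> y \in I -> x * y \in I),
      (forall x, x \in I -> star x \in I) &
      (forall x, x \in I -> Delta_by x \in tensorv fullv I)].

(** The conjugating unitary of [Delta_gauge] is a tensor square, hence compatible with
    the tensor products by [I] and by its image. *)
Lemma coideal_gauge I : coideal_by (gauge_img I) <-> twisted_coideal I.
Proof.
split=> [[I1 IM IS ID] | [I1 IM IS /mem_slice_twisted_Delta ID]].
  split.
  - by rewrite -mem_gauge_img gauge1.
  - by move=> x y; rewrite -!(mem_gauge_img I) gaugeM; exact: IM.
  - by move=> x; rewrite -!(mem_gauge_img I) -gauge_star; exact: IS.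
  apply/mem_slice_twisted_Delta => x; rewrite -mem_gauge_img => /ID.
  rewrite Delta_gauge => xI.
  have -> : twisted_Delta x = tensor (star U) (star U) * (tensor U U *
      twisted_Delta x * tensor (star U) (star U)) * tensor U U.
    rewrite !mulrA tensorM gauge_unitaryV -mulrA tensorM gauge_unitaryV.
    by rewrite -(lam1 F gT) tensor_lam mul1r mulr1.
  by apply: tensorv_conj xI => y yI; rewrite -/(ungauge y) -mem_gauge_imgE.
split.
- by rewrite -gauge1 mem_gauge_img.
- move=> x y; rewrite -[x]ungaugeK -[y]ungaugeK -gaugeM !mem_gauge_img.
  exact: IM.
- by move=> x; rewrite -[x]ungaugeK gauge_star !mem_gauge_img; exact: IS.
move=> x; rewrite -[x]ungaugeK mem_gauge_img => /ID xI; rewrite Delta_gauge.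
by apply: tensorv_conj xI => y yI; rewrite -/(gauge y) mem_gauge_img.
Qed.

(** The unitary [U] is 1 on the range of P+. *)
Lemma gauge_fix x : x * Pp = x -> gauge x = x.
Proof.
suff UPp : U * Pp = Pp.
  have PU : Pp * star U = Pp by rewrite -{1}Pp_star -starM UPp Pp_star.
  move=> xP; rewrite /gauge -[in LHS]xP -PpC !mulrA UPp PpC -mulrA.
  by rewrite PU.
rewrite /gauge_unitary (Pp_klein F n a b) (kleinM zC zz bb); apply: eq_klein => i.
rewrite sum4 /gauge_coef /Pp_coef.
move: (i0 : C) => I; elim/ord4_ind: i; rewrite /= ?(mulr0, addr0);
 by field.
Qed.

(** The antipode is anti-multiplicative and fixes the Klein group pointwise. *)
Lemma inva_gauge x : inva (gauge x) = star U * inva x * U.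
Proof.
have SU c : inva (klein n a b c) = klein n a b c.
  rewrite linear_sum; apply: eq_bigr => i _; rewrite linearZ /= inva_lam.
  by rewrite (Omega_indexV zC zz bb).
have star_klein : star U = klein n a b (fun i => (gauge_coef i0 i)^*).
  rewrite star_sum; apply: eq_bigr => i _.
  by rewrite starZ (lam_inv_klein F zC zz bb).
by rewrite /gauge !invaM star_klein !SU mulrA.
Qed.

End GaugeAutomorphism.

(** * Dihedral groups *)

Section Dihedral.

Variables (gT : finGroupType) (N : nat) (a b : gT).
Hypothesis N_gt0 : (0 < N)%N.
Hypothesis D : dihedral_generators N a b.
Local Open Scope group_scope.
Implicit Types (e f : bool) (i j k : nat) (g h : gT).

Lemma dih_bb : b * b = 1.
Proof. by case: D => _. Qed.

Lemma dih_aN : a ^+ N = 1.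
Proof. by case: D. Qed.

Lemma dih_bV : b^-1 = b.
Proof. by apply: (mulgI b); rewrite mulgV dih_bb. Qed.

Lemma dih_conj i : b * a ^+ i * b = a ^- i.
Proof.
have -> : b * a ^+ i * b = (a ^+ i) ^ b by rewrite conjgE dih_bV mulgA.
case: D => _ _ ba _ _; rewrite -expgVn conjXg conjgE dih_bV mulgA ba.
by rewrite -mulgA dih_bb mulg1.
Qed.

Lemma dih_aVb i : b * a ^- i = a ^+ i * b.
Proof. by rewrite -dih_conj !mulgA dih_bb mul1g. Qed.

Lemma dih_aV i : a ^- i = a ^+ (i * N.-1).
Proof.
apply: (mulgI (a ^+ i)); rewrite mulgV -expgD -mulnS prednK // mulnC expgM.
by rewrite dih_aN expg1n.
Qed.

Lemma dih_ab i : a ^+ i * b = b * a ^+ (i * N.-1).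
Proof. by rewrite -dih_aV dih_aVb. Qed.

Lemma dih_mul e i f j :
  (b ^+ e * a ^+ i) * (b ^+ f * a ^+ j) =
  b ^+ (e (+) f) * a ^+ ((if f then i * N.-1 else i) + j)%N.
Proof.
case: f => /=; last by rewrite addbF mul1g -mulgA -expgD.
rewrite expg1 !mulgA -(mulgA _ _ b) dih_ab expgD !mulgA; congr (_ * _ * _).
by case: e; rewrite /= ?mul1g // expg1 dih_bb.
Qed.

Lemma dih_form g : exists e, exists2 k, (k < N)%N & g = b ^+ e * a ^+ k.
Proof.
suff [e [k ->]] : exists e k, g = b ^+ e * a ^+ k.
  by exists e, (k %% N)%N; rewrite ?ltn_mod // expg_mod // dih_aN.
pose S := [set b ^+ p.1 * a ^+ p.2 | p : bool * 'I_N].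
have memS (e : bool) k : b ^+ e * a ^+ k \in S.
  apply/imsetP; exists (e, Ordinal (ltn_pmod k N_gt0)) => //=.
  by rewrite expg_mod // dih_aN.
have gS : group_set S.
  apply/group_setP; split; first by have := memS false 0%N; rewrite mul1g.
  move=> x y /imsetP[[e i] _ ->] /imsetP[[f j] _ ->] /=.
  by rewrite dih_mul memS.
have : g \in <<[set a; b]>> by case: D => _ _ _ -> _; rewrite inE.
have /fintype.subsetP : <<[set a; b]>> \subset Group gS.
  rewrite gen_subG; apply/fintype.subsetP => x /set2P[]->.
    by have := memS false 1%N; rewrite mul1g.
  by have := memS true 0%N; rewrite mulg1.
by move=> sub /sub /imsetP[[e k] _ ->]; exists e, k.
Qed.

(** The group has order [2 * N], so its [2 * N] normal forms are distinct. *)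
Lemma dih_inj e f i j : (i < N)%N -> (j < N)%N ->
  b ^+ e * a ^+ i = b ^+ f * a ^+ j -> e = f /\ i = j.
Proof.
move=> iN jN E.
pose F (p : bool * 'I_N) := b ^+ p.1 * a ^+ p.2.
have /imset_injP Finj : #|F @: [set: bool * 'I_N]| == #|[set: bool * 'I_N]|.
  rewrite cardsT card_prod card_bool card_ord.
  have [_ _ _ _ <-] := D; rewrite -cardsT; apply/eqP/eq_card => g.
  rewrite inE; have [h [k kN ->]] := dih_form g.
  by apply/imsetP; exists (h, Ordinal kN).
have := Finj (e, Ordinal iN) (f, Ordinal jN); rewrite !inE /F /= E.
by case/(_ isT isT erefl) => -> ->.
Qed.

Lemma dih_order : #[a] = N.
Proof.
apply/eqP; rewrite eqn_leq; apply/andP; split.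
  by rewrite dvdn_leq // order_dvdn dih_aN.
rewrite leqNgt; apply/negP => aN.
have [] // := @dih_inj false false 0%N #[a].
  by rewrite !mul1g expg_order.
by move=> _ E; have := order_gt0 a; rewrite -E.
Qed.

Definition refl g : bool := g \notin <[a]>.

Lemma dih_refl e k : refl (b ^+ e * a ^+ k) = e.
Proof.
rewrite /refl groupMr ?mem_cycle //; case: e; last by rewrite group1.
apply/negP => ba; have /cycleP[i bi] : b \in <[a]> := ba.
have [|||] := @dih_inj true false 0%N (i %% N)%N; rewrite ?ltn_mod //.
by rewrite expg_mod ?dih_aN // mul1g mulg1 bi.
Qed.

Lemma reflM g h : refl (g * h) = refl g (+) refl h.
Proof.
have [e [i _ ->]] := dih_form g; have [f [j _ ->]] := dih_form h.
by rewrite dih_mul !dih_refl.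
Qed.

Lemma refl_a k : refl (a ^+ k) = false.
Proof. by rewrite -[a ^+ k]mul1g (dih_refl false). Qed.

Lemma refl_ba k : refl (b * a ^+ k) = true.
Proof. exact: (dih_refl true). Qed.

Lemma reflN g : ~~ refl g -> exists2 k, (k < N)%N & g = a ^+ k.
Proof.
have [e [k kN ->]] := dih_form g; rewrite dih_refl => /negbTE->.
by exists k; rewrite ?mul1g.
Qed.

Lemma reflT g : refl g -> exists2 k, (k < N)%N & g = b * a ^+ k.
Proof.
by have [e [k kN ->]] := dih_form g; rewrite dih_refl => ->; exists k.
Qed.

Lemma sum_dih (V : nmodType) (f : gT -> V) :
  (\sum_g f g = \sum_(k < N) (f (a ^+ k)%g + f (b * a ^+ k)%g))%R.
Proof.
rewrite (reindex (fun p : bool * 'I_N => b ^+ p.1 * a ^+ p.2)) /=; last first.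
  apply: onW_bij; apply: inj_card_bij => [[e i] [f' j] /= /dih_inj|].
    by move=> [//|//|-> /val_inj ->].
  by rewrite card_prod card_bool card_ord; case: D => _ _ _ _ ->.
rewrite -(pair_bigA _ (fun (e : bool) (k : 'I_N) => f (b ^+ e * a ^+ k))) /=.
by rewrite big_bool /= addrC -big_split; apply: eq_bigr => k _; rewrite mul1g.
Qed.

Hypothesis N_even : ~~ odd N.

(** The parity of [k] in the normal form [b ^+ e * a ^+ k], a homomorphism to Z/2
    because [N] is even. *)
Definition par g : bool :=
  g \in [set b ^+ p.1 * a ^+ p.2 | p : bool * 'I_N & odd p.2].

Lemma dih_par e k : par (b ^+ e * a ^+ k) = odd k.
Proof.
have kN : (k %% N < N)%N by rewrite ltn_mod.
have oddk : odd (k %% N) = odd k.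
  by rewrite [in RHS](divn_eq k N) oddD oddM (negbTE N_even) andbF.
rewrite -(expg_mod k dih_aN) -oddk; apply/imsetP/idP => [[[f j]] |odk].
  by rewrite inE /= => oj /dih_inj [//|//|_ ->].
by exists (e, Ordinal kN); rewrite ?inE.
Qed.

Lemma parM g h : par (g * h) = par g (+) par h.
Proof.
have [e [i _ ->]] := dih_form g; have [f [j _ ->]] := dih_form h.
rewrite dih_mul !dih_par oddD; case: f => //.
by rewrite oddM -subn1 oddB // (negbTE N_even) andbT.
Qed.

Lemma par_a k : par (a ^+ k) = odd k.
Proof. by rewrite -[a ^+ k]mul1g (dih_par false). Qed.

Lemma par_ba k : par (b * a ^+ k) = odd k.
Proof. exact: (dih_par true). Qed.

End Dihedral.

Section DihedralOrder8.

Variables (gT : finGroupType) (m : nat) (a b : gT).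
Hypothesis m_gt0 : (0 < m)%N.
Hypothesis D : dihedral_generators (2 * (2 * m)) a b.
Local Open Scope group_scope.

Let N_gt0 : (0 < 2 * (2 * m))%N. Proof. by rewrite !muln_gt0. Qed.

Lemma dih_center g : a ^+ (2 * m) * g = g * a ^+ (2 * m).
Proof.
have [e [k _ ->]] := dih_form N_gt0 D g; rewrite mulgA.
have zb : a ^+ (2 * m) * b ^+ e = b ^+ e * a ^+ (2 * m).
  case: e; last by rewrite mul1g mulg1.
  rewrite expg1 -(dih_aVb D); congr (_ * _).
  apply: (mulgI (a ^+ (2 * m))); rewrite mulgV -expgD addnn -mul2n.
  by rewrite (dih_aN D).
by rewrite zb -!mulgA -!expgD addnC.
Qed.

Lemma dih_zz : a ^+ (2 * m) * a ^+ (2 * m) = 1.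
Proof. by rewrite -expgD addnn -mul2n (dih_aN D). Qed.

Lemma dih_z_neq1 : a ^+ (2 * m) != 1.
Proof.
rewrite -order_dvdn (dih_order N_gt0 D); apply/negP => /dvdn_leq.
by rewrite muln_gt0 m_gt0 => /(_ isT); lia.
Qed.

(** As <a> has index 2, [L] meets it in a group of order at least 4; this group is
    cyclic of order 4 or 8, so it contains the only subgroup of order 4 of <a>. *)
Lemma order8_quarter (L : {group gT}) : #|L| = 8%N -> a ^+ m \in L.
Proof.
move=> cL; pose H := (L :&: <[a]>)%G.
have oa := dih_order N_gt0 D; have [_ _ _ _ cG] := D.
have cH : (4 %| #|H|)%N.
  have := mul_cardG L <[a]>; rewrite cL -orderE oa => E.
  have le : (#|(L * <[a]>)%g| <= 2 * (2 * (2 * m)))%N by rewrite -cG max_card.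
  have : (#|H| %| 8)%N by rewrite -cL cardSg ?subsetIl.
  move: E le; move: #|(L * <[a]>)%g| => s; rewrite -/H; move: #|H| => t E le tD.
  have : (4 <= t)%N by nia.
  have t8 := dvdn_leq (isT : (0 < 8)%N) tD.
  by move: t8 tD; case: t {E} => [|[|[|[|[|[|[|[|[|t]]]]]]]]].
have /cyclicP[c Hc] : cyclic H by exact: cyclicS (subsetIr _ _) (cycle_cyclic a).
have oc : #|H| = #[c] by rewrite Hc.
have o4 : #[c ^+ (#[c] %/ 4)] = 4%N.
  rewrite orderXdiv ?dvdn_div // -?oc //.
  by rewrite -{1}(divnK cH) mulKn // divn_gt0 // dvdn_leq.
have c4 : c ^+ (#[c] %/ 4) \in H by rewrite Hc mem_cycle.
have oam : #[a ^+ m] = 4%N.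
  by rewrite orderXdiv oa ?dvdn_mull // mulnA mulnK.
have : <[a ^+ m]> == <[c ^+ (#[c] %/ 4)]>.
  rewrite (eq_subG_cyclic (cycle_cyclic a)) ?cycle_subG ?mem_cycle //.
    by rewrite -!orderE o4 oam.
  by move: c4; rewrite inE => /andP[].
move=> /eqP E; have : a ^+ m \in <[a ^+ m]> by rewrite cycle_id.
rewrite E => /(fintype.subsetP _) ->//; rewrite cycle_subG.
by move: c4; rewrite inE => /andP[].
Qed.

Lemma order8_cyclic (L : {group gT}) : #|L| = 8%N -> L \subset <[a]> ->
  ~~ odd m /\ L :=: <[a ^+ m./2]>.
Proof.
move=> cL La; have oa := dih_order N_gt0 D.
have m2 : ~~ odd m.
  have := cardSg La; rewrite cL -orderE oa => /dvdnP[q E].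
  by rewrite -dvdn2; apply/dvdnP; exists q; lia.
split=> //; apply/eqP; rewrite (eq_subG_cyclic (cycle_cyclic a)) // ?cycle_subG ?mem_cycle //.
rewrite cL -orderE; apply/eqP; symmetry.
have E : (2 * (2 * m) = 8 * m./2)%N by rewrite -{1}(even_halfK m2); lia.
by rewrite orderXdiv oa E ?dvdn_mull // mulnK // half_gt0; case: (m) m_gt0 m2 => [|[]].
Qed.

End DihedralOrder8.

(** * Spans of group elements *)

Section SpanClosure.

Variables (F : fieldType) (gT : finGroupType).
Local Notation A := (group_algebra F gT).
Local Notation lam := (@ga_lambda F gT).

Lemma span_ind (V : vectType F) (P : V -> Prop) (s : seq V) :
    P 0 -> (forall x y, P x -> P y -> P (x + y)) ->
    (forall c x, x \in s -> P (c *: x)) ->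
  forall x, x \in <<s>>%VS -> P x.
Proof.
move=> P0 PD PZ x xs; rewrite (coord_span (X := in_tuple s) xs).
apply: big_ind => // i _; apply: PZ; rewrite mem_nth //.
Qed.

Definition lam_span (S : {set gT}) : {vspace A} := <<[seq lam g | g <- enum S]>>%VS.

Lemma mem_lam_span (S : {set gT}) (x : A) :
  reflect (forall g, g \notin S -> x g = 0) (x \in lam_span S).
Proof.
apply: (iffP idP) => [xS g gS | xS]; last first.
  rewrite [x]ga_expand; apply: rpred_sum => g _.
  have [gS|gS] := boolP (g \in S); last by rewrite (xS g gS) scale0r mem0v.
  by rewrite memvZ // memv_span // map_f // mem_enum.
elim/span_ind: x / xS => [|x y x0 y0|c y /mapP[h]].
- exact: ffunE.
- by rewrite ga_addE x0 y0 addr0.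
rewrite mem_enum => hS ->; rewrite ga_scaleE lamE.
by case: eqP hS => [<-|_ _]; rewrite ?mulr0 // (negbTE gS).
Qed.

Lemma lam_in_span (S : {set gT}) g : (lam g \in lam_span S) = (g \in S).
Proof.
apply/mem_lam_span/idP => [gS|gS h hS].
  apply/negPn/negP => /gS/eqP; rewrite lamE eqxx; exact/negP/oner_neq0.
by rewrite lamE; case: eqP hS => // ->; rewrite gS.
Qed.

Lemma dim_lam_span (S : {set gT}) : \dim (lam_span S) = #|S|.
Proof.
suff fr r : uniq r -> free [seq lam g | g <- r].
  by have /eqP := fr _ (enum_uniq S); rewrite size_map cardE.
elim: r => [|g r IH] /=; first by rewrite nil_free.
move=> /andP[gr ur]; rewrite free_cons (IH ur) andbT; apply/negP => gs.
have : lam g \in lam_span [set h in r].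
  suff /subvP : (<<[seq lam h | h <- r]>> <= lam_span [set h in r])%VS by apply.
  by apply/span_subvP => _ /mapP[h hr ->]; rewrite lam_in_span inE.
by rewrite lam_in_span inE (negbTE gr).
Qed.

End SpanClosure.

(** * Components over the quotient by z *)

Lemma lmod_combD (F : fieldType) (V : lmodType F) (s s' t t' : F) (p q : V) :
  (s + s') *: p + (t + t') *: q = (s *: p + t *: q) + (s' *: p + t' *: q).
Proof. by rewrite !scalerDl addrACA. Qed.

Lemma lmod_combZ (F : fieldType) (V : lmodType F) (r s t : F) (p q : V) :
  (r * s) *: p + (r * t) *: q = r *: (s *: p + t *: q).
Proof. by rewrite scalerDr !scalerA. Qed.

Lemma alg_combM (F : fieldType) (B : algType F) (s t s' t' : F) (p q p' q' : B) :
    p * q' = 0 -> q * p' = 0 ->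
  (s *: p + t *: q) * (s' *: p' + t' *: q') =
  (s * s') *: (p * p') + (t * t') *: (q * q').
Proof.
move=> pq qp; rewrite mulrDl !mulrDr -!scalerAl -!scalerAr pq qp.
by rewrite !scaler0 addr0 add0r !scalerA.
Qed.

Lemma memvZl (F : fieldType) (V : vectType F) (U : {vspace V}) (v : V) (c : F) :
  c != 0 -> (c *: v \in U) = (v \in U).
Proof. by move=> c0; rewrite rpredZeq (negbTE c0). Qed.

Lemma notin_span (F : fieldType) (V : vectType F) (f : V -> F) (v : V) (r : seq V) :
    (forall x y, f (x + y) = f x + f y) -> (forall s x, f (s *: x) = s * f x) ->
    all (fun x => f x == 0) r -> f v != 0 -> v \notin <<r>>%VS.
Proof.
move=> fD fZ /allP r0 fv; apply: contra fv; elim/span_ind: v / => [|x y|s x xr].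
- by rewrite -(scale0r (0 : V)) fZ mul0r.
- by rewrite fD => /eqP-> /eqP->; rewrite addr0.
- by rewrite fZ (eqP (r0 x xr)) mulr0.
Qed.

(** The matrix of the values [f i (x j)] is triangular with a nonzero diagonal. *)
Lemma free_iota (F : fieldType) (V : vectType F) (f : nat -> V -> F) (x : nat -> V) k :
    (forall i v w, f i (v + w) = f i v + f i w) ->
    (forall i s v, f i (s *: v) = s * f i v) ->
    (forall i, (i < k)%N -> f i (x i) != 0) ->
    (forall i j, (i < j < k)%N -> f i (x j) = 0) ->
  free [seq x i | i <- iota 0 k].
Proof.
move=> fD fZ fx fx0.
suff fr l i0 : (i0 + l <= k)%N -> free [seq x i | i <- iota i0 l] by exact: fr.
elim: l i0 => [|l IH] i0 /=; first by rewrite nil_free.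
move=> lk; rewrite free_cons IH ?andbT; last by rewrite addSnnS.
apply: (notin_span (f := f i0) (fD i0) (fZ i0)); last by apply: fx; lia.
apply/allP => _ /mapP[j + ->]; rewrite mem_iota => jl; apply/eqP/fx0; lia.
Qed.

Section TwistedCoideals.

Variables (F : numClosedFieldType) (gT : finGroupType) (n : nat) (a b : gT).
Local Notation A := (group_algebra F gT).
Local Notation lam := (@ga_lambda F gT).
Local Notation z := (a ^+ n)%g.
Hypothesis zC : forall g, (z * g = g * z)%g.
Hypothesis zz : (z * z = 1)%g.
Hypothesis bb : (b * b = 1)%g.
Hypothesis z_neq1 : z != 1%g.
Implicit Types (x y : A) (I J : {vspace A}) (g h k : gT) (s t : F).

Local Notation Pp := (Pp F n a).
Local Notation Pm := (Pm F n a).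
Local Notation pl := (pl F n a).
Local Notation mi := (mi F n a).
Local Notation pcoef := (@pcoef F gT n a).
Local Notation mcoef := (@mcoef F gT n a).
Local Notation homog := (@homog F gT n a).
Local Notation hflip := (@hflip F gT n a b).
Local Notation twisted_coideal := (@twisted_coideal F gT n a b).
Local Notation conjb g := (b * g * b)%g.

Lemma pl1 : pl 1 = Pp. Proof. by rewrite /pl lam1 mulr1. Qed.
Lemma pl_mi1 : pl 1 + mi 1 = 1.
Proof. by rewrite -lam_pl_mi lam1. Qed.

Lemma pcoefD g x y : pcoef g (x + y) = pcoef g x + pcoef g y.
Proof. by rewrite /pcoef !ga_addE addrACA. Qed.
Lemma mcoefD g x y : mcoef g (x + y) = mcoef g x + mcoef g y.
Proof. by rewrite /mcoef !ga_addE opprD addrACA. Qed.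
Lemma pcoefZ g s x : pcoef g (s *: x) = s * pcoef g x.
Proof. by rewrite /pcoef !ga_scaleE mulrDr. Qed.
Lemma mcoefZ g s x : mcoef g (s *: x) = s * mcoef g x.
Proof. by rewrite /mcoef !ga_scaleE mulrBr. Qed.
Lemma pcoef0 g : pcoef g 0 = 0.
Proof. by rewrite -(scale0r (0 : A)) pcoefZ mul0r. Qed.
Lemma mcoef0 g : mcoef g 0 = 0.
Proof. by rewrite -(scale0r (0 : A)) mcoefZ mul0r. Qed.

Lemma homogD g x y : homog g (x + y) = homog g x + homog g y.
Proof. by rewrite /homog pcoefD mcoefD; exact: lmod_combD. Qed.
Lemma homogZ g s x : homog g (s *: x) = s *: homog g x.
Proof. by rewrite /homog pcoefZ mcoefZ; exact: lmod_combZ. Qed.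
Lemma homog0 g : homog g 0 = 0.
Proof. by rewrite -(scale0r (0 : A)) homogZ !scale0r. Qed.
Lemma hflipD g x y : hflip g (x + y) = hflip g x + hflip g y.
Proof. by rewrite /hflip pcoefD mcoefD; exact: lmod_combD. Qed.
Lemma hflipZ g s x : hflip g (s *: x) = s *: hflip g x.
Proof. by rewrite /hflip pcoefZ mcoefZ; exact: lmod_combZ. Qed.
Lemma hflip0 g : hflip g 0 = 0.
Proof. by rewrite -(scale0r (0 : A)) hflipZ !scale0r. Qed.

Definition eqmodz g h : bool := (g == h) || (g == (h * z)%g).
(** The scalar that relates [mi g] to [mi h] when [g] and [h] agree modulo [z]:
    see [eqmodz_mi]. *)
Definition zsign g h : F := (g == h)%:R - (g == (h * z)%g)%:R.

Lemma eq_mulz g h : (g * z == h)%g = (g == h * z)%g.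
Proof. by rewrite -(inj_eq (mulIg z)) zNK. Qed.

Lemma neq_mulz g : (g == g * z)%g = false.
Proof. by rewrite -[X in X == _]mulg1 (inj_eq (mulgI g)) eq_sym (negbTE z_neq1). Qed.

Lemma pcoef_pl g h : pcoef g (pl h) = (eqmodz g h)%:R.
Proof.
rewrite /pcoef !(plE F zC) eq_mulz (inj_eq (mulIg z)) /eqmodz.
have [->|_] := eqVneq g h; first by rewrite neq_mulz /= addr0 add0r; field.
by case: (_ == _); rewrite /= ?addr0 ?add0r; field.
Qed.

Lemma mcoef_pl g h : mcoef g (pl h) = 0.
Proof.
by rewrite /mcoef !(plE F zC) eq_mulz (inj_eq (mulIg z)); field.
Qed.

Lemma mcoef_mi g h : mcoef g (mi h) = zsign g h.
Proof.
rewrite /mcoef !(miE F zC) eq_mulz (inj_eq (mulIg z)) /zsign.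
by field.
Qed.

Lemma pcoef_mi g h : pcoef g (mi h) = 0.
Proof.
rewrite /pcoef !(miE F zC) eq_mulz (inj_eq (mulIg z)).
by field.
Qed.

Lemma eqmodzxx g : eqmodz g g. Proof. by rewrite /eqmodz eqxx. Qed.
Lemma zsignxx g : zsign g g = 1.
Proof. by rewrite /zsign eqxx neq_mulz subr0. Qed.
Lemma zsign0 g h : ~~ eqmodz g h -> zsign g h = 0.
Proof. by rewrite negb_or /zsign => /andP[/negbTE-> /negbTE->]; rewrite subrr. Qed.
Lemma eqmodz_sym g h : eqmodz g h = eqmodz h g.
Proof. by rewrite /eqmodz (eq_sym g h) -(eq_mulz g h) (eq_sym (g * z)%g). Qed.
Lemma eqmodz_conj g h : eqmodz (conjb g) (conjb h) = eqmodz g h.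
Proof.
have -> : eqmodz (conjb g) (conjb h) = (conjb g == conjb h) || (conjb g == conjb (h * z)).
  by rewrite /eqmodz -!mulgA zC.
by rewrite !(inj_eq (mulIg b)) !(inj_eq (mulgI b)).
Qed.
Lemma conj1 : conjb 1 = 1%g. Proof. by rewrite mulg1 bb. Qed.
Lemma conjK g : conjb (conjb g) = g.
Proof. by rewrite !mulgA bb mul1g -mulgA bb mulg1. Qed.
Lemma conjM g h : (conjb g * conjb h = conjb (g * h))%g.
Proof. by rewrite !mulgA -(mulgA _ b b) bb mulg1. Qed.
Lemma conjz g : conjb (g * z)%g = (conjb g * z)%g.
Proof. by rewrite -!mulgA zC. Qed.

Lemma eqmodz_pl g h : eqmodz g h -> pl g = pl h.
Proof. by case/orP => /eqP ->; rewrite ?(pl_mulz F zC zz). Qed.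
Lemma eqmodz_mi g h : eqmodz g h -> mi g = zsign g h *: mi h.
Proof.
case/orP => /eqP ->; first by rewrite zsignxx scale1r.
by rewrite (mi_mulz F zC zz) /zsign eqxx eq_sym neq_mulz sub0r scaleN1r.
Qed.
Lemma zsign_sqr g h : zsign g h * zsign g h = (eqmodz g h)%:R.
Proof.
rewrite /zsign /eqmodz; have [->|_] := eqVneq g h; first by rewrite neq_mulz subr0 mulr1.
by case: (_ == _); rewrite /= sub0r ?mulrNN ?mulr1 ?oppr0 ?mul0r.
Qed.
Lemma zsign_conj g h : zsign (conjb g) (conjb h) = zsign g h.
Proof.
rewrite /zsign -conjz.
by rewrite !(inj_eq (mulIg b)) !(inj_eq (mulgI b)).
Qed.

Lemma pcoef_comb g h s t :
  pcoef g (s *: pl h + t *: mi h) = s * (eqmodz g h)%:R.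
Proof. by rewrite pcoefD !pcoefZ pcoef_pl pcoef_mi mulr0 addr0. Qed.

Lemma mcoef_comb g h s t :
  mcoef g (s *: pl h + t *: mi h) = t * zsign g h.
Proof. by rewrite mcoefD !mcoefZ mcoef_pl mcoef_mi mulr0 add0r. Qed.

Lemma homog_comb g h s t :
  homog g (s *: pl h + t *: mi h) = ((eqmodz g h)%:R : F) *: (s *: pl h + t *: mi h).
Proof.
rewrite /homog pcoef_comb mcoef_comb.
have [gh|gh] := boolP (eqmodz g h); last first.
  by rewrite (zsign0 gh) !mulr0 !scale0r addr0.
by rewrite (eqmodz_pl gh) (eqmodz_mi gh) scalerA -mulrA zsign_sqr gh !mulr1 scale1r.
Qed.

Lemma hflip_comb g h s t : hflip g (s *: pl h + t *: mi h) =
  zsign g h *: (t *: pl (conjb h) + s *: mi (conjb h)).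
Proof.
rewrite /hflip pcoef_comb mcoef_comb.
have [gh|gh] := boolP (eqmodz g h); last first.
  by rewrite (zsign0 gh) !mulr0 !scale0r addr0.
have gh' : eqmodz (conjb g) (conjb h) by rewrite eqmodz_conj.
rewrite (eqmodz_pl gh') (eqmodz_mi gh') zsign_conj scalerA mulr1 scalerDr !scalerA.
by rewrite (mulrC t) (mulrC s).
Qed.

Lemma star_comb h s t :
  star (s *: pl h + t *: mi h) = s^* *: pl h^-1 + t^* *: mi h^-1.
Proof. by rewrite starD !starZ (pl_star F zC zz) (mi_star F zC zz). Qed.

Lemma mul_comb g h s t s' t' :
  (s *: pl g + t *: mi g) * (s' *: pl h + t' *: mi h) =
  (s * s') *: pl (g * h)%g + (t * t') *: mi (g * h)%g.
Proof.
rewrite -(plM F zC zz) -(miM F zC zz).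
apply: alg_combM; [exact: pl_mi | exact: mi_pl].
Qed.

Lemma twisted_coideal_span (r : seq A) :
    1 \in <<r>>%VS -> {in r &, forall x y, x * y \in <<r>>%VS} ->
    {in r, forall x, star x \in <<r>>%VS} ->
    {in r, forall x g, homog g x \in <<r>>%VS /\ hflip g x \in <<r>>%VS} ->
  twisted_coideal <<r>>%VS.
Proof.
move=> r1 rM rS rD; split=> //.
- have rV y : y \in r -> forall x, x \in <<r>>%VS -> x * y \in <<r>>%VS.
    move=> yr x; elim/span_ind: x / => [|x x' xy x'y|c x xr].
    + by rewrite mul0r mem0v.
    + by rewrite mulrDl memvD.
    + by rewrite -scalerAl memvZ // rM.
  move=> x y xr; elim/span_ind: y / => [|y y' xy xy'|c y yr].
  + by rewrite mulr0 mem0v.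
  + by rewrite mulrDr memvD.
  + by rewrite -scalerAr memvZ // rV.
- move=> x; elim/span_ind: x / => [|x x' xy x'y|c x xr].
  + by rewrite star0 mem0v.
  + by rewrite starD memvD.
  + by rewrite starZ memvZ // rS.
- move=> x g; elim/span_ind: x / => [|x x' [xy xf] [x'y x'f]|c x xr].
  + by rewrite homog0 hflip0 mem0v.
  + by rewrite homogD hflipD; split; [exact: memvD xy x'y | exact: memvD xf x'f].
  + by rewrite homogZ hflipZ; have [h1 h2] := rD x xr g; split; apply: memvZ.
Qed.

Lemma pl_lam_span (S : {group gT}) g : z \in S -> g \in S -> pl g \in lam_span F S.
Proof.
move=> zS gS; rewrite /pl /Pp -scalerAl mulrDl mul1r lamM.
by rewrite memvZ // memvD // lam_in_span // groupM.
Qed.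

Lemma mi_lam_span (S : {group gT}) g : z \in S -> g \in S -> mi g \in lam_span F S.
Proof.
move=> zS gS; rewrite /mi /Pm -scalerAl mulrBl mul1r lamM.
by rewrite memvZ // memvB // lam_in_span // groupM.
Qed.

(** * Two families of twisted coideals *)

Lemma pl_comb g : pl g = 1 *: pl g + 0 *: mi g.
Proof. by rewrite scale0r addr0 scale1r. Qed.
Lemma mi_comb g : mi g = 0 *: pl g + 1 *: mi g.
Proof. by rewrite scale0r add0r scale1r. Qed.
Lemma lam_comb g : lam g = 1 *: pl g + 1 *: mi g.
Proof. by rewrite !scale1r -(lam_pl_mi F n a). Qed.

Lemma eqmodzM g h g' h' : eqmodz g h -> eqmodz g' h' -> eqmodz (g * g')%g (h * h')%g.
Proof.
have zM k l : (k * z * l = k * l * z)%g by rewrite -!mulgA zC.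
case/orP => /eqP -> /orP[]/eqP ->; rewrite /eqmodz ?zM ?mulgA ?eqxx ?orbT //.
by rewrite (zNK zz) eqxx.
Qed.

Lemma eqmodz_trans g h k : eqmodz g h -> eqmodz h k -> eqmodz g k.
Proof.
move=> gh; case/orP => /eqP E; first by rewrite -E.
case/orP: gh => /eqP ->; rewrite E /eqmodz ?(zNK zz) eqxx ?orbT //.
Qed.

Lemma eqmodzV g h : eqmodz g h -> eqmodz g^-1 h^-1.
Proof.
case/orP => /eqP ->; rewrite /eqmodz ?eqxx // invMg (zV zz) -zC eqxx orbT //.
Qed.

Lemma lam_span_coideal (S : {group gT}) :
  (forall g, g \in S -> conjb g \in S) -> twisted_coideal (lam_span F S).
Proof.
move=> Sb; have lamS g : g \in S -> lam g \in lam_span F S by rewrite lam_in_span.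
apply: twisted_coideal_span.
- by rewrite -lam1 lamS.
- move=> x y /mapP[g + ->] /mapP[h + ->]; rewrite !mem_enum => gS hS.
  by rewrite lamM lamS // groupM.
- by move=> x /mapP[g + ->]; rewrite mem_enum => gS; rewrite star_lam lamS ?groupV.
move=> x /mapP[g + ->] h; rewrite mem_enum => gS.
rewrite lam_comb homog_comb hflip_comb -!lam_comb.
by split; rewrite memvZ // lamS // Sb.
Qed.

(** The elements [pl g] and [mi (conjb g)], for [g] in the group generated modulo [z]
    by an element [h] of square 1 modulo [z]. *)
Definition involution_coideal h : {vspace A} :=
  <<[:: pl 1; mi 1; pl h; mi (conjb h)]>>%VS.

Lemma pl_involution h g : eqmodz g 1 || eqmodz g h -> pl g \in involution_coideal h.
Proof.
by case/orP=> /eqmodz_pl ->; rewrite memv_span // !inE eqxx ?orbT.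
Qed.

Lemma mi_involution h g :
  eqmodz g 1 || eqmodz g h -> mi (conjb g) \in involution_coideal h.
Proof.
rewrite -[eqmodz g 1]eqmodz_conj -[eqmodz g h]eqmodz_conj conj1.
case/orP=> /eqmodz_mi ->; rewrite memvZ // memv_span // !inE eqxx ?orbT //.
Qed.

Lemma involution_coideal_mem h x : x \in [:: pl 1; mi 1; pl h; mi (conjb h)] ->
  exists2 g, eqmodz g 1 || eqmodz g h & x = pl g \/ x = mi (conjb g).
Proof.
rewrite !inE => /or4P[]/eqP->; [exists 1%g|exists 1%g|exists h|exists h];
  rewrite ?eqmodzxx ?orbT ?conj1 //; by [left|right].
Qed.

Lemma involution_coidealP h : eqmodz (h * h) 1 -> twisted_coideal (involution_coideal h).
Proof.
move=> hh; pose inH g := eqmodz g 1 || eqmodz g h.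
have inHM g k : inH g -> inH k -> inH (g * k)%g.
  case/orP=> gg /orP[] kk; have gk := eqmodzM gg kk; apply/orP.
  - by left; rewrite mulg1 in gk.
  - by right; rewrite mul1g in gk.
  - by right; rewrite mulg1 in gk.
  - by left; apply: eqmodz_trans gk hh.
have inHV g : inH g -> inH g^-1%g.
  case/orP=> /eqmodzV gg; apply/orP; first by left; rewrite invg1 in gg.
  right; apply: eqmodz_trans gg _; have := eqmodzM hh (eqmodzxx h^-1%g).
  by rewrite mulgK mul1g eqmodz_sym.
have plV g : inH g -> pl g \in involution_coideal h := @pl_involution h g.
have miV g : inH g -> mi (conjb g) \in involution_coideal h := @mi_involution h g.
apply: twisted_coideal_span.
- by rewrite -pl_mi1 -{2}conj1 memvD ?plV ?miV // /inH eqmodzxx.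
- move=> x y /involution_coideal_mem[g gH gx] /involution_coideal_mem[k kH ky].
  case: gx => ->; case: ky => ->.
  + by rewrite (plM F zC zz) plV ?inHM.
  + by rewrite (pl_mi F zC zz) mem0v.
  + by rewrite (mi_pl F zC zz) mem0v.
  + by rewrite (miM F zC zz) conjM miV ?inHM.
- move=> x /involution_coideal_mem[g gH [] ->].
    by rewrite (pl_star F zC zz) plV ?inHV.
  rewrite (mi_star F zC zz) (_ : (conjb g)^-1 = conjb g^-1)%g ?miV ?inHV //.
  by rewrite !invMg -[b^-1%g]mulg1 -bb mulKg mulgA.
move=> x /involution_coideal_mem[k kH [] ->] g.
  rewrite pl_comb homog_comb hflip_comb !scale0r !scale1r addr0 add0r.
  by rewrite !memvZ ?plV ?miV.
rewrite mi_comb homog_comb hflip_comb !scale0r !scale1r addr0 add0r conjK.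
by rewrite !memvZ ?plV ?miV.
Qed.

Lemma involution_coideal_coef h x g : x \in involution_coideal h ->
  ~~ eqmodz g 1 -> ~~ eqmodz g h -> pcoef g x = 0.
Proof.
move=> + g1 gh; elim/span_ind: x / => [|x y x0 y0|s x].
- exact: pcoef0.
- by rewrite pcoefD x0 y0 addr0.
rewrite pcoefZ !inE => /or4P[]/eqP->;
  by rewrite ?pcoef_mi ?pcoef_pl ?(negbTE g1) ?(negbTE gh) mulr0.
Qed.

Lemma dim_involution_coideal h : ~~ eqmodz h 1 -> \dim (involution_coideal h) = 4.
Proof.
move=> h1; have h1' : eqmodz 1 h = false by rewrite eqmodz_sym (negbTE h1).
have hb1 : eqmodz (conjb h) 1 = false by rewrite -[in LHS]conj1 eqmodz_conj (negbTE h1).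
apply/eqP; change (free [:: pl 1; mi 1; pl h; mi (conjb h)]).
rewrite !free_cons nil_free !andbT; apply/and4P; split.
- apply: (notin_span (f := pcoef 1)); [exact: pcoefD|exact: pcoefZ| |].
    by rewrite /= !pcoef_mi pcoef_pl h1' !eqxx.
  by rewrite pcoef_pl eqmodzxx oner_neq0.
- apply: (notin_span (f := mcoef 1)); [exact: mcoefD|exact: mcoefZ| |].
    by rewrite /= mcoef_pl mcoef_mi zsign0 ?eqxx // eqmodz_sym hb1.
  by rewrite mcoef_mi zsignxx oner_neq0.
- apply: (notin_span (f := pcoef h)); [exact: pcoefD|exact: pcoefZ| |].
    by rewrite /= !pcoef_mi !eqxx.
  by rewrite pcoef_pl eqmodzxx oner_neq0.
- apply: (notin_span (f := mcoef (conjb h))); [exact: mcoefD|exact: mcoefZ| |] => //.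
  by rewrite mcoef_mi zsignxx oner_neq0.
Qed.

Lemma involution_coideal_inj h k : ~~ eqmodz h 1 ->
  involution_coideal h = involution_coideal k -> eqmodz h k.
Proof.
move=> h1 E; apply/negPn/negP => hk.
have plh : pl h \in involution_coideal k by rewrite -E pl_involution ?eqmodzxx ?orbT.
have /eqP := involution_coideal_coef plh h1 hk.
by rewrite pcoef_pl eqmodzxx oner_eq0.
Qed.

Lemma involution_coideal_eq h k : eqmodz h k ->
  involution_coideal h = involution_coideal k.
Proof.
suff sub h' k' : eqmodz h' k' -> (involution_coideal h' <= involution_coideal k')%VS.
  by move=> hk; apply/eqP; rewrite eqEsubv !sub // eqmodz_sym.
move=> hk; apply/span_subvP => x /involution_coideal_mem[g gH].
have gk : eqmodz g 1 || eqmodz g k'.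
  by case/orP: gH => [->//|gh]; rewrite (eqmodz_trans gh hk) orbT.
by case=> ->; [exact: pl_involution|exact: mi_involution].
Qed.

(** When [w ^+ 4 = z] and [c ^+ 4 = -1], increasing [i] by 4 changes the sign of
    [c ^+ i] and that of [mi (w ^+ i)], so [cyclic_elt w c i] has period 4. *)
Definition cyclic_elt (w : gT) (c : F) (i : nat) : A :=
  pl (w ^+ i) + c ^+ i *: mi (w ^+ i).
Definition cyclic_coideal (w : gT) (c : F) : {vspace A} :=
  <<[seq cyclic_elt w c i | i <- iota 0 4]>>%VS.

Lemma cyclic_eltE w c i : cyclic_elt w c i = 1 *: pl (w ^+ i) + c ^+ i *: mi (w ^+ i).
Proof. by rewrite scale1r. Qed.

Section Cyclic.

Variables (w : gT) (c : F).
Hypothesis w4 : (w ^+ 4 = z)%g.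
Hypothesis c4 : c ^+ 4 = -1.
Local Notation X := (cyclic_elt w c).
Local Notation V := (cyclic_coideal w c).

Lemma cyclic_elt_mem i : X i \in V.
Proof.
rewrite (divn_eq i 4) addnC mulnC; elim: (i %/ 4)%N => [|q IH].
  by rewrite muln0 addn0 memv_span // map_f // mem_iota ltn_mod.
rewrite mulnSr addnA /cyclic_elt expgD w4 exprD c4 (pl_mulz F zC zz) (mi_mulz F zC zz).
by rewrite scalerN mulrN1 scaleNr opprK.
Qed.

(** [hflip] inverts [w ^+ i] and exchanges the coordinates 1 and [c ^+ i], whose ratio
    becomes [c ^- i]: it maps [cyclic_elt w c i] to a multiple of
    [cyclic_elt w c (7 * i)], where [7 * i] stands for [- i] modulo 8. *)
Lemma cyclic_coidealP : conjb w = (w^-1)%g -> twisted_coideal V.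
Proof.
move=> wb.
have w8 : (w ^+ 8 = 1)%g by rewrite (expgM w 4 2) w4 expgS expg1 zz.
have c8 : c ^+ 8 = 1 by rewrite (exprM c 4 2) c4 sqrrN expr1n.
have wV i : (w ^- i = w ^+ (7 * i))%g.
  by apply: (mulgI (w ^+ i)%g); rewrite mulgV -expgD -mulSn expgM w8 expg1n.
have cV i : c ^+ i * c ^+ (7 * i) = 1.
  by rewrite -exprD -mulSn exprM c8 expr1n.
have wbi i : conjb (w ^+ i) = (w ^+ (7 * i)%N)%g.
  rewrite -wV -expgVn -wb; elim: i => [|i IH]; first by rewrite !expg0 conj1.
  by rewrite !expgS -IH conjM.
have cc i : (c ^+ i)^* = c ^+ (7 * i).
  have nc : `|c| = 1.
    by apply/eqP; rewrite -(@pexpr_eq1 _ _ 4) // -normrX c4 normrN1.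
  rewrite -[RHS]mul1r -[1](_ : (c ^+ i)^* * c ^+ i = 1) -?mulrA ?cV ?mulr1 //.
  by rewrite mulrC -normCK normrX nc !expr1n.
apply: twisted_coideal_span.
- by rewrite -pl_mi1 (_ : _ + _ = X 0) ?cyclic_elt_mem // /cyclic_elt scale1r.
- move=> x y /mapP[i _ ->] /mapP[j _ ->].
  by rewrite !cyclic_eltE mul_comb mul1r -expgD -exprD -cyclic_eltE cyclic_elt_mem.
- move=> x /mapP[i _ ->].
  rewrite cyclic_eltE star_comb rmorph1 cc wV -cyclic_eltE.
  exact: cyclic_elt_mem.
move=> x /mapP[i _ ->] g; rewrite cyclic_eltE homog_comb hflip_comb -cyclic_eltE.
split; first by rewrite memvZ ?cyclic_elt_mem.
rewrite memvZ // wbi (_ : _ + _ = c ^+ i *: X (7 * i)) ?memvZ ?cyclic_elt_mem //.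
by rewrite scalerDr scalerA cV.
Qed.

Hypothesis w_indep : [/\ ~~ eqmodz w 1, ~~ eqmodz (w ^+ 2) 1 & ~~ eqmodz (w ^+ 3) 1].

Lemma dim_cyclic_coideal : \dim V = 4.
Proof.
have [w1 w2 w3] := w_indep.
have wij i j : ~~ eqmodz (w ^+ j) 1 -> eqmodz (w ^+ i) (w ^+ (i + j)) = false.
  move=> wj; rewrite expgD; apply/negbTE; apply: contra wj => E.
  by have := eqmodzM (eqmodzxx (w ^- i)%g) E; rewrite mulVg mulKg eqmodz_sym.
change (\dim <<[seq X i | i <- iota 0 4]>> = size [seq X i | i <- iota 0 4]).
apply/eqP/(free_iota (f := fun i => pcoef (w ^+ i))) => [i|i|i _|i j ij].
- exact: pcoefD.
- exact: pcoefZ.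
- by rewrite cyclic_eltE pcoef_comb eqmodzxx mulr1 oner_neq0.
have [d d0 ->] : exists2 d, (0 < d < 4)%N & j = (i + d)%N by exists (j - i)%N; lia.
rewrite cyclic_eltE pcoef_comb wij ?mulr0 //.
by case: d d0 => [|[|[|[|]]]].
Qed.

End Cyclic.

(** * Dimension four over a central involution *)

Lemma coef_half g x : x g = 2^-1 * (pcoef g x + mcoef g x).
Proof. by rewrite /pcoef /mcoef; field. Qed.

Section WithCoideal.

Variable I : {vspace A}.
Hypothesis tcI : twisted_coideal I.

Lemma mi_of_pl g : pl g \in I -> mi (conjb g) \in I.
Proof.
case: tcI => _ _ _ ID /(ID _ g)[_]; rewrite pl_comb hflip_comb zsignxx.
by rewrite !scale1r scale0r add0r.
Qed.

(** Where [x] takes the same value at [g] and [g * z], its component on this coset is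
    a multiple of [pl g]; [hflip] then provides [mi (conjb g)]. *)
Lemma lam_span_sub (S : {set gT}) x c : c != 0 -> x \in I ->
    (forall g, g \in S -> (g * z)%g \in S /\ conjb g \in S) ->
    (forall g, g \in S -> x g = c) ->
  (lam_span F S <= I)%VS.
Proof.
move=> c0 xI Sz Sx.
have c2 : c + c != 0 by rewrite -mulr2n mulrn_eq0.
have plI g : g \in S -> pl g \in I.
  move=> gS; have [gz _] := Sz g gS.
  have [_ _ _ ID] := tcI; have [+ _] := ID x g xI.
  by rewrite /homog /pcoef /mcoef !Sx // subrr scale0r addr0 memvZl.
apply/span_subvP => _ /mapP[g + ->]; rewrite mem_enum => gS.
rewrite (lam_pl_mi F n a) memvD ?plI // -[g]conjK mi_of_pl // plI //.
by have [] := Sz g gS.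
Qed.

Section SplitCase.

Hypothesis plI : pl 1 \in I.

Lemma mem_pl x g : x \in I -> pcoef g x != 0 -> pl g \in I.
Proof.
case: tcI => _ IM _ ID xI px; have [+ _] := ID x g xI.
move=> /(IM _ _ plI); rewrite mulrDr -!scalerAr (plM F zC zz) (pl_mi F zC zz).
by rewrite scaler0 addr0 mul1g memvZl.
Qed.

Lemma mem_mi x g : x \in I -> mcoef g x != 0 -> pl (conjb g) \in I.
Proof.
case: tcI => _ IM _ ID xI px; have [_ +] := ID x g xI.
move=> /(IM _ _ plI); rewrite mulrDr -!scalerAr (plM F zC zz) (pl_mi F zC zz).
by rewrite scaler0 addr0 mul1g memvZl.
Qed.

(** Some [h] outside <z> has [pl h] in [I], for otherwise [I] would lie in the span of
    1 and [z]; then [pl 1], [mi 1], [pl h] and [mi (conjb h)] exhaust the dimension,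
    and [pl (h * h)] can only be [pl 1]. *)
Lemma split_coideal : \dim I = 4 ->
  exists h, [/\ ~~ eqmodz h 1, eqmodz (h * h) 1 & I = involution_coideal h].
Proof.
move=> dI; have miI : mi 1 \in I by rewrite -conj1 mi_of_pl.
have [h /andP[h1 hI]|noh] := pickP (fun h => ~~ eqmodz h 1 && (pl h \in I)); last first.
  have nopl g : ~~ eqmodz g 1 -> pl g \notin I.
    by move=> g1; have := noh g; rewrite g1 /= => ->.
  suff : (I <= lam_span F [set 1%g; z])%VS.
    by move=> /dimvS; rewrite dI dim_lam_span cards2; case: (_ != _).
  apply/subvP => x xI; apply/mem_lam_span => g; rewrite !inE => g1.
  have {}g1 : ~~ eqmodz g 1 by rewrite /eqmodz mul1g.
  have gb1 : ~~ eqmodz (conjb g) 1 by rewrite -[X in eqmodz _ X]conj1 eqmodz_conj.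
  have [pg|/(mem_pl xI)] := eqVneq (pcoef g x) 0; last by rewrite (negbTE (nopl _ g1)).
  have [mg|/(mem_mi xI)] := eqVneq (mcoef g x) 0; last by rewrite (negbTE (nopl _ gb1)).
  by rewrite coef_half pg mg addr0 mulr0.
have IE : I = involution_coideal h.
  symmetry; apply/eqP; rewrite eqEdim dim_involution_coideal // dI leqnn andbT.
  by apply/span_subvP => x; rewrite !inE => /or4P[]/eqP-> //; exact: mi_of_pl.
exists h; split=> //; apply/negPn/negP => hh.
have hhh : ~~ eqmodz (h * h) h.
  apply: contra h1 => hh1; have := eqmodzM (eqmodzxx h^-1%g) hh1.
  by rewrite mulKg mulVg.
have [_ IM _ _] := tcI; have := IM _ _ hI hI; rewrite (plM F zC zz) IE => hhI.
have /eqP := involution_coideal_coef hhI hh hhh.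
by rewrite pcoef_pl eqmodzxx oner_eq0.
Qed.

End SplitCase.

Section NonsplitCase.

Hypothesis plNI : pl 1 \notin I.

(** The product of [s *: pl h + t *: mi h] with its adjoint is
    [s * s^* *: pl 1 + t * t^* *: mi 1]; if the two scalars differed, this and
    [1 = pl 1 + mi 1] would put [pl 1] in [I]. *)
Lemma nonsplit_norm h s t : s *: pl h + t *: mi h \in I -> s * s^* = t * t^*.
Proof.
case: tcI => I1 IM IS _ xI; have := IM _ _ xI (IS _ xI).
rewrite star_comb mul_comb mulgV => stI; apply/eqP; rewrite -subr_eq0.
apply: contraR plNI => st; rewrite -(memvZl _ _ st).
rewrite (_ : _ *: _ = s * s^* *: pl 1 + t * t^* *: mi 1 - (t * t^*) *: (pl 1 + mi 1)).
  by rewrite pl_mi1 memvB // memvZ.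
by rewrite scalerDr opprD addrACA subrr addr0 -scalerBl.
Qed.

(** The difference of the two elements has coordinate 0 on [pl h]. *)
Lemma nonsplit_uniq h c c' :
  pl h + c *: mi h \in I -> pl h + c' *: mi h \in I -> c = c'.
Proof.
move=> cI c'I; have := memvB cI c'I.
rewrite opprD addrACA subrr add0r -scalerBl => dI.
have := @nonsplit_norm h 0 (c - c'); rewrite scale0r add0r mul0r => /(_ dI)/esym/eqP.
by rewrite mul_conjC_eq0 subr_eq0 => /eqP.
Qed.

Definition nonsplit_support := [set h | `[< exists c, pl h + c *: mi h \in I >]].
Local Notation L := nonsplit_support.

Lemma nonsplitP h : reflect (exists c, pl h + c *: mi h \in I) (h \in L).
Proof. by rewrite inE; exact: asboolP. Qed.

Lemma nonsplit_mem h s t : s *: pl h + t *: mi h \in I -> s != 0 \/ t != 0 -> h \in L.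
Proof.
move=> xI st; have N := nonsplit_norm xI.
have s0 : s != 0.
  case: st => //; apply: contra => /eqP s0; move: N; rewrite s0 mul0r => /esym/eqP.
  by rewrite mul_conjC_eq0.
apply/nonsplitP; exists (s^-1 * t).
by rewrite -[pl h]scale1r -(mulVf s0) -!scalerA -scalerDr memvZ.
Qed.

Lemma nonsplit_group : group_set L.
Proof.
case: tcI => I1 IM _ _; apply/group_setP; split.
  by apply/nonsplitP; exists 1; rewrite scale1r pl_mi1.
move=> g h /nonsplitP[c gI] /nonsplitP[c' hI].
apply/nonsplitP; exists (c * c'); have := IM _ _ gI hI.
by rewrite -{1}[pl g]scale1r -{1}[pl h]scale1r mul_comb mulr1 scale1r.
Qed.

Lemma nonsplit_mulz g : (g * z \in L)%g = (g \in L).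
Proof.
suff sub k : k \in L -> (k * z)%g \in L.
  by apply/idP/idP => [/sub|/sub //]; rewrite (zNK zz).
move=> /nonsplitP[c gI]; apply/nonsplitP; exists (- c).
by rewrite (pl_mulz F zC zz) (mi_mulz F zC zz) scalerN scaleNr opprK.
Qed.

Lemma pcoef_lamz g x : pcoef g (lam z * x) = pcoef g x.
Proof.
by rewrite /pcoef !mullamE (zV zz) [in LHS]zC (zC (g * z)%g) (zNK zz) addrC.
Qed.

Lemma mcoef_lamz g x : mcoef g (lam z * x) = - mcoef g x.
Proof.
by rewrite /mcoef !mullamE (zV zz) [in LHS]zC (zC (g * z)%g) (zNK zz) opprB.
Qed.

(** Multiplication by [z] changes the sign of the coordinates on the [mi g]; it maps
    [I] to a complement of [I] in the span of [L]. *)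
Lemma card_nonsplit : #|L| = (2 * \dim I)%N.
Proof.
have [_ IM _ ID] := tcI.
have zu : lam z \is a GRing.unit.
  by apply/unitrP; exists (lam z); rewrite lamM zz lam1.
pose J := (amull (lam z) @: I)%VS.
have dJ : \dim J = \dim I by apply: limg_dim_eq; rewrite (eqP (lker0_amull zu)) capv0.
have IJ0 : (I :&: J = 0)%VS.
  apply/eqP; rewrite -subv0; apply/subvP => x /memv_capP[xI /memv_imgP[y yI xE]].
  have {}yI : lam z * x \in I by rewrite xE lfunE /= mulrA lamM zz lam1 mul1r.
  rewrite memv0; apply/eqP/ffunP => g; rewrite [RHS]ffunE.
  have [xg _] := ID _ g xI; have [yg _] := ID _ g yI.
  move: yg; rewrite /homog pcoef_lamz mcoef_lamz scaleNr => yg.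
  have u0 : pcoef g x = 0.
    have := memvD xg yg; rewrite addrACA subrr addr0 -scalerDl.
    have := @nonsplit_norm g (pcoef g x + pcoef g x) 0.
    rewrite scale0r addr0 mul0r => N /N/eqP.
    by rewrite mul_conjC_eq0 -mulr2n mulrn_eq0 => /eqP.
  move: xg; rewrite /homog u0 scale0r add0r => xg.
  have := @nonsplit_norm g 0 (mcoef g x); rewrite scale0r add0r mul0r => /(_ xg)/esym/eqP.
  by rewrite mul_conjC_eq0 coef_half u0 => /eqP ->; rewrite addr0 mulr0.
rewrite -(dim_lam_span F) mul2n -addnn -{2}dJ -dimv_disjoint_sum //.
congr (\dim _); apply/eqP; rewrite eqEsubv; apply/andP; split.
  apply/span_subvP => _ /mapP[h + ->]; rewrite mem_enum => /nonsplitP[c hI].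
  have c0 : c != 0.
    have := @nonsplit_norm h 1 c; rewrite scale1r rmorph1 mulr1 => /(_ hI) N.
    by apply/eqP => c0; move: N; rewrite c0 mul0r; apply/eqP/oner_neq0.
  have hJ : pl h - c *: mi h \in J.
    apply/memv_imgP; exists (pl h + c *: mi h); rewrite // lfunE /=.
    rewrite lam_comb -[X in _ * (X + _)]scale1r mul_comb !mul1r scale1r zC.
    by rewrite (pl_mulz F zC zz) (mi_mulz F zC zz) scalerN.
  have hI' := subvP (addvSl I J) _ hI; have hJ' := subvP (addvSr I J) _ hJ.
  have plIJ : pl h \in (I + J)%VS.
    by rewrite -[pl h](scaler_half_sum _ (c *: mi h)) memvD ?memvZ.
  have miIJ : c *: mi h \in (I + J)%VS.
    by rewrite -[c *: mi h](scaler_half_diff (pl h)) memvB ?memvZ.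
  by rewrite (lam_pl_mi F n a) memvD // -(memvZl _ _ c0).
have IL x : x \in I -> x \in lam_span F L.
  move=> xI; apply/mem_lam_span => g gL; have [xg _] := ID x g xI.
  rewrite coef_half; have [->|p0] := eqVneq (pcoef g x) 0; last first.
    by rewrite (nonsplit_mem xg) // in gL; left.
  have [->|m0] := eqVneq (mcoef g x) 0; first by rewrite addr0 mulr0.
  by rewrite (nonsplit_mem xg) // in gL; right.
rewrite subv_add; apply/andP; split; first by apply/subvP.
apply/subvP => _ /memv_imgP[x xI ->]; rewrite lfunE /=; apply/mem_lam_span => g gL.
rewrite mullamE (zV zz) zC; have /mem_lam_span := IL x xI; apply.
by rewrite nonsplit_mulz.
Qed.

End NonsplitCase.

End WithCoideal.

End TwistedCoideals.

(** * Classification for the dihedral group *)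

Section DihedralClassification.

Variables (F : numClosedFieldType) (gT : finGroupType) (m : nat) (a b : gT).
Hypothesis m_gt0 : (0 < m)%N.
Hypothesis D : dihedral_generators (2 * (2 * m)) a b.
Local Notation A := (group_algebra F gT).
Local Notation n := (2 * m)%N.
Local Notation N := (2 * n)%N.
Local Notation z := (a ^+ n)%g.
Implicit Types (I : {vspace A}) (g h : gT) (c : F).

Let N_gt0 : (0 < N)%N. Proof. by rewrite !muln_gt0. Qed.
Let zC := dih_center m_gt0 D.
Let zz := dih_zz D.
Let bb := dih_bb D.
Let z_neq1 := dih_z_neq1 m_gt0 D.

Local Notation pl := (pl F n a).
Local Notation mi := (mi F n a).
Local Notation twisted_coideal := (@twisted_coideal F gT n a b).
Local Notation eqmodz := (@eqmodz gT n a).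
Local Notation involution_coideal := (@involution_coideal F gT n a b).
Local Notation cyclic_coideal := (@cyclic_coideal F gT n a (a ^+ m./2)%g).

Lemma dih_am_z g : refl a g -> (g * a ^+ m = a ^+ m * g * z)%g.
Proof.
move=> /(reflT N_gt0 D)[k _ ->].
have E : (a ^+ m * b = b * a ^+ m * z)%g.
  have -> : (b * a ^+ m * z = b * a ^- m)%g.
    rewrite -mulgA; congr (_ * _)%g; apply: (mulgI (a ^+ m)%g).
    by rewrite mulgV -!expgD -(dih_aN D); congr (_ ^+ _)%g; lia.
  by rewrite (dih_aVb D).
rewrite -mulgA -expgD addnC expgD mulgA.
rewrite !mulgA E -!mulgA; congr (_ * (_ * _))%g.
by rewrite mulgA zC -mulgA zz mulg1.
Qed.

Lemma cyclic_w4 : ~~ odd m -> ((a ^+ m./2) ^+ 4 = z)%g.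
Proof. by move=> m2; rewrite -expgM; congr (_ ^+ _)%g; lia. Qed.

Lemma expg_a_eq i k : (i < N)%N -> (k < N)%N -> (a ^+ i == a ^+ k)%g = (i == k).
Proof.
move=> iN kN; apply/eqP/eqP => [E|->//].
by have [] // := @dih_inj _ _ _ _ N_gt0 D false false i k; rewrite ?mul1g.
Qed.

Lemma cyclic_w_indep : ~~ odd m ->
  [/\ ~~ eqmodz (a ^+ m./2)%g 1, ~~ eqmodz ((a ^+ m./2) ^+ 2)%g 1
    & ~~ eqmodz ((a ^+ m./2) ^+ 3)%g 1].
Proof.
move=> m2; have nz i : (0 < i < n)%N -> ~~ eqmodz (a ^+ i)%g 1.
  move=> /andP[i0 iN]; rewrite /eqmodz mul1g negb_or.
  by rewrite -[1%g](expg0 a) !expg_a_eq; lia.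
by rewrite -!expgM; split; apply: nz; lia.
Qed.

(** The elements of [I] above a reflection [g] and above [a ^+ m] multiply in both orders
    to elements of [I] above the same coset of z; by [nonsplit_uniq] they would commute,
    whereas [g] and [a ^+ m] commute only up to [z].  So the support of [I] is a group of
    eight rotations. *)
Lemma nonsplit_classification I : twisted_coideal I -> pl 1 \notin I -> \dim I = 4 ->
  ~~ odd m /\ exists2 c, c ^+ 4 = -1 & I = cyclic_coideal c.
Proof.
move=> tcI plNI dI; pose L := Group (nonsplit_group zC zz tcI).
have cL : #|L| = 8%N by rewrite (card_nonsplit zC zz tcI plNI) dI.
have amL := order8_quarter m_gt0 D cL.
have mulL := mul_comb zC zz.
have [I1 IM _ _] := tcI.
have LP h : reflect (exists c, pl h + c *: mi h \in I) (h \in L) by exact: nonsplitP.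
have uniqL h c c' : pl h + c *: mi h \in I -> pl h + c' *: mi h \in I -> c = c'.
  exact: (nonsplit_uniq zC zz tcI plNI).
have La : L \subset <[a]>%g.
  apply/fintype.subsetP => g gL; apply/negPn/negP => gr.
  have /LP[c gI] := gL; have /LP[d rI] := amL.
  have d0 : d != 0.
    have := nonsplit_norm zC zz tcI plNI (h := (a ^+ m)%g) (s := 1) (t := d).
    rewrite scale1r rmorph1 mulr1 => /(_ rI) E; apply/eqP => d0.
    by move: E; rewrite d0 mul0r; apply/eqP/oner_neq0.
  have c0 : c != 0.
    have := nonsplit_norm zC zz tcI plNI (h := g) (s := 1) (t := c).
    rewrite scale1r rmorph1 mulr1 => /(_ gI) E; apply/eqP => c0.
    by move: E; rewrite c0 mul0r; apply/eqP/oner_neq0.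
  have := IM _ _ gI rI; have := IM _ _ rI gI.
  rewrite -[pl g]scale1r -[pl (a ^+ m)]scale1r !mulL mulr1 !scale1r.
  rewrite (dih_am_z gr) (pl_mulz F zC zz) (mi_mulz F zC zz) scalerN -scaleNr.
  move=> x1 x2; have /eqP := uniqL _ _ _ x1 x2.
  by rewrite mulrC -addr_eq0 -mulr2n mulrn_eq0 /= mulf_eq0 (negbTE c0) (negbTE d0).
have [m2 LE] := order8_cyclic m_gt0 D cL La; split=> //.
have : (a ^+ m./2)%g \in (L : {set gT}) by rewrite LE cycle_id.
move=> /LP[c cI].
have XI i : cyclic_elt n a (a ^+ m./2)%g c i \in I.
  elim: i => [|i IH]; first by rewrite /cyclic_elt scale1r (pl_mi1 F n a).
  have := IM _ _ cI IH; rewrite !cyclic_eltE -[pl _ + c *: _]/(_ + _).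
  rewrite -[X in X + c *: _]scale1r mulL mul1r.
  by rewrite -expgS -exprS.
have c4 : c ^+ 4 = -1.
  have := XI 4%N; rewrite /cyclic_elt (cyclic_w4 m2).
  rewrite -[z]mul1g (pl_mulz F zC zz) (mi_mulz F zC zz) scalerN -scaleNr.
  move=> x1; have /(uniqL _ _ _ x1) <- : pl 1 + 1 *: mi 1 \in I.
    by rewrite scale1r (pl_mi1 F n a).
  by rewrite opprK.
exists c => //; symmetry; apply/eqP; rewrite eqEdim.
rewrite (dim_cyclic_coideal zC zz z_neq1 _ (cyclic_w_indep m2)) dI leqnn andbT.
by apply/span_subvP => _ /mapP[i _ ->].
Qed.

Lemma split_classification I : twisted_coideal I -> pl 1 \in I -> \dim I = 4 ->
  (exists2 k, (k < n)%N & I = involution_coideal (b * a ^+ k)%g) \/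
  I = involution_coideal (a ^+ m)%g.
Proof.
move=> tcI plI dI.
have [h [h1 hh IE]] := split_coideal zC zz bb z_neq1 tcI plI dI.
have [hr|/(reflN N_gt0 D)[j jN hE]] := boolP (refl a h).
  have [k kN hE] := reflT N_gt0 D hr; left.
  have [kn|kn] := ltnP k n; first by exists k; rewrite ?IE ?hE.
  exists (k - n)%N; first by lia.
  rewrite IE hE; apply: (involution_coideal_eq F zC zz bb z_neq1).
  by apply/orP; right; rewrite -mulgA -expgD subnK.
right; rewrite IE; apply: (involution_coideal_eq F zC zz bb z_neq1).
move: h1 hh; rewrite {h IE}hE -expgD /eqmodz !mul1g negb_or.
rewrite -[1%g](expg0 a) !(expg_a_eq jN) ?ltn_Pmull //; try lia.
(* the condition on the square of [a ^+ j] is [2 * j = 0 or n] modulo [N] *)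
rewrite -(expg_mod (j + j) (dih_aN D)) !expg_a_eq ?ltn_mod //; try lia.
have -> : ((j + j) %% N = if j + j < N then j + j else j + j - N)%N.
  case: ltnP => jjN; first by rewrite modn_small.
  by rewrite -{1}(subnK jjN) modnDr modn_small //; lia.
move=> /andP[j0 jn] jj; rewrite -expgD !expg_a_eq //; first by move: jj; case: ltnP; lia.
by lia.
Qed.

Theorem twisted_classification I : twisted_coideal I -> \dim I = 4 ->
  [\/ exists2 k, (k < n)%N & I = involution_coideal (b * a ^+ k)%g,
      I = involution_coideal (a ^+ m)%g |
      ~~ odd m /\ exists2 c, c ^+ 4 = -1 & I = cyclic_coideal c].
Proof.
move=> tcI dI; have [plI|plNI] := boolP (pl 1 \in I).
  by have [?|?] := split_classification tcI plI dI; [apply: Or31|apply: Or32].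
by apply: Or33; exact: nonsplit_classification.
Qed.

End DihedralClassification.

(** * Roots of unity as the dual of a dihedral group *)

Lemma geometric_root (F : idomainType) n (x : F) : x ^+ n = 1 ->
  \sum_(k < n) x ^+ k = if x == 1 then n%:R else 0.
Proof.
move=> xn; case: eqP => [->|/eqP x1].
  under eq_bigr do rewrite expr1n; by rewrite sumr_const card_ord.
have := subrX1 x n; rewrite xn subrr => /esym/eqP.
by rewrite mulf_eq0 subr_eq0 (negbTE x1) => /eqP.
Qed.

Section CharacterDuality.

Variables (F : numClosedFieldType) (hT : finGroupType) (n : nat) (al be : hT).
Variable eps : F.
Hypothesis n_gt0 : (0 < n)%N.
Local Notation N := (2 * n)%N.
Hypothesis Dn : dihedral_generators n al be.
Hypothesis eps_prim : N.-primitive_root eps.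
Implicit Types (s t : hT) (k l : nat) (f : {ffun hT -> F^o}).

Let N_gt0 : (0 < N)%N. Proof. by rewrite muln_gt0. Qed.

(** The exponent [k] in the normal form [be ^+ e * al ^+ k] of [s]. *)
Definition rot_exp s : nat :=
  if [pick k : 'I_n | be ^+ refl al s * al ^+ k == s]%g is Some k then k else 0.

Lemma rot_expP s : (s = be ^+ refl al s * al ^+ rot_exp s)%g.
Proof.
rewrite /rot_exp; case: pickP => [k /eqP -> //|nok].
have [e [k kn sE]] := dih_form n_gt0 Dn s.
by have := nok (Ordinal kn); rewrite {1 2}sE (dih_refl n_gt0 Dn) /= eqxx.
Qed.

(** The rotations are sent to the even powers of [eps] and the reflections to the odd
    ones; the choice of [eps / r] rather than [eps * r] makes [root_ofM] hold. *)
Definition root_of s : F :=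
  let r := eps ^+ (2 * rot_exp s) in if refl al s then eps / r else r.

Lemma eps_neq0 : eps != 0.
Proof.
apply/eqP => e0; have := prim_expr_order eps_prim; rewrite e0 expr0n.
by rewrite eqn0Ngt N_gt0 => /eqP; rewrite eq_sym oner_eq0.
Qed.

Lemma root_ofE (e : bool) k :
  root_of (be ^+ e * al ^+ k)%g = if e then eps / eps ^+ (2 * k) else eps ^+ (2 * k).
Proof.
rewrite /root_of (dih_refl n_gt0 Dn).
have := rot_expP (be ^+ e * al ^+ k)%g; rewrite (dih_refl n_gt0 Dn) => E.
have kE : (k %% n = rot_exp (be ^+ e * al ^+ k)%g %% n)%N.
  have := @dih_inj _ _ _ _ n_gt0 Dn e e (k %% n) (rot_exp (be ^+ e * al ^+ k)%g %% n).
  by rewrite !ltn_mod !(expg_mod _ (dih_aN Dn)) => /(_ n_gt0 n_gt0 E) [].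
have eE j : eps ^+ (2 * j) = eps ^+ (2 * (j %% n)).
  by rewrite muln_modr (prim_expr_mod eps_prim).
by rewrite eE -kE -eE.
Qed.

Lemma root_of_order s : root_of s ^+ N = 1.
Proof.
rewrite /root_of; case: ifP => _.
  by rewrite expr_div_n (prim_expr_order eps_prim) -exprM mulnC exprM
    (prim_expr_order eps_prim) expr1n divr1.
by rewrite -exprM mulnC exprM (prim_expr_order eps_prim) expr1n.
Qed.

Lemma root_of_neq0 s : root_of s != 0.
Proof. by rewrite /root_of; case: ifP; rewrite ?mulf_neq0 ?invr_eq0 ?expf_neq0 ?eps_neq0. Qed.

Lemma eps_half : eps ^+ n = -1.
Proof.
have : eps ^+ n ^+ 2 == 1 by rewrite -exprM mulnC (prim_expr_order eps_prim).
rewrite sqrf_eq1 => /orP[|/eqP //].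
rewrite -(prim_order_dvd eps_prim) => /dvdn_leq => /(_ n_gt0).
by rewrite mul2n -addnn -[X in (_ <= X)%N]addn0 leq_add2l leqNgt n_gt0.
Qed.

Lemma root_of_half s : root_of s ^+ n = (-1) ^+ refl al s.
Proof.
rewrite /root_of; case: (refl al s); rewrite ?expr_div_n -exprM mulnAC
  exprM (prim_expr_order eps_prim) expr1n ?divr1 ?eps_half //.
Qed.

(** The inversion on the right of a reflection reflects the coproduct
    [pl g (x) g + mi g (x) bgb], as [b] inverts the powers of [a]. *)
Lemma root_ofM s t :
  root_of (s * t)%g = root_of s * (if refl al s then (root_of t)^-1 else root_of t).
Proof.
rewrite [s in LHS]rot_expP [t in LHS]rot_expP (dih_mul n_gt0 Dn) root_ofE.
rewrite [in RHS]/root_of; set i := rot_exp s; set j := rot_exp t.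
have eV k : eps ^+ (2 * (k * n.-1)) = (eps ^+ (2 * k))^-1.
  apply: (mulfI (expf_neq0 (2 * k) eps_neq0)); rewrite mulfV ?expf_neq0 ?eps_neq0 //.
  rewrite -exprD -mulnDr -mulnS prednK // mulnCA mulnC exprM.
  by rewrite (prim_expr_order eps_prim) expr1n.
have e0 k : eps ^+ k != 0 by rewrite expf_neq0 ?eps_neq0.
case: (refl al s); case: (refl al t); rewrite /= mulnDr exprD ?eV.
- by field; rewrite ?e0 eps_neq0.
- by field; rewrite ?e0.
- by field; rewrite ?e0.
- by [].
Qed.

Lemma root_of1 : root_of 1%g = 1.
Proof. by have := root_ofE false 0; rewrite mulg1 muln0. Qed.

Lemma root_ofV s :
  root_of s^-1%g = if refl al s then root_of s else (root_of s)^-1.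
Proof.
have sV := root_ofM s s^-1%g; rewrite mulgV root_of1 in sV.
have s0 := root_of_neq0 s; have sV0 := root_of_neq0 s^-1%g.
move: sV; case: (refl al s) => E; first by rewrite -[LHS]mul1r E divfK.
by apply: (mulfI s0); rewrite -E mulfV.
Qed.

Lemma root_of_inj : injective root_of.
Proof.
move=> s t st.
have rst : refl al s = refl al t.
  have := root_of_half t; rewrite -st root_of_half => /eqP.
  case: (refl al s); case: (refl al t) => //; rewrite ?expr0 ?expr1 ?[1 == _]eq_sym;
  by rewrite -subr_eq0 -opprD oppr_eq0 -[1 + 1]/(2%:R) pnatr_eq0.
have E : eps ^+ (2 * rot_exp s) = eps ^+ (2 * rot_exp t).
  move: st; rewrite /root_of rst; case: (refl al t) => //.
  by move=> /(mulfI eps_neq0)/invr_inj.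
rewrite [s]rot_expP [t]rot_expP rst; congr (_ * _)%g.
move/eqP: E; rewrite (eq_prim_root_expr eps_prim) -!muln_modr eqn_pmul2l // => /eqP E.
by rewrite -(expg_mod (rot_exp s) (dih_aN Dn)) E (expg_mod _ (dih_aN Dn)).
Qed.

Lemma sum_root_of k : \sum_s root_of s ^+ k = if (N %| k)%N then N%:R else 0.
Proof.
case: ifP => [/dvdnP[q ->]|Nk].
  under eq_bigr do rewrite mulnC exprM root_of_order expr1n.
  have [_ _ _ _ cT] := Dn.
  by rewrite sumr_const -[in RHS]cT; congr (_ *+ _); exact: eq_card.
(* the rotations give a geometric sum of ratio [eps ^+ (2 * k)], and the reflections
   give [eps ^+ k] times the sum of the inverses; if the ratio is 1, then
   [eps ^+ k = -1] *)
have e0 j : eps ^+ j != 0 by rewrite expf_neq0 ?eps_neq0.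
rewrite (sum_dih n_gt0 Dn) big_split /=.
pose x := eps ^+ (2 * k).
have -> : \sum_(i < n) root_of (al ^+ i)%g ^+ k = \sum_(i < n) x ^+ i.
  apply: eq_bigr => i _; have := root_ofE false i; rewrite mul1g => ->.
  by rewrite -!exprM; congr (_ ^+ _); lia.
have -> : \sum_(i < n) root_of (be * al ^+ i)%g ^+ k = \sum_(i < n) eps ^+ k * x^-1 ^+ i.
  apply: eq_bigr => i _; have := root_ofE true i; rewrite expg1 => ->.
  by rewrite expr_div_n exprVn -!exprM; congr (_ / (_ ^+ _)); lia.
have xn : x ^+ n = 1.
  by rewrite -exprM mulnAC exprM (prim_expr_order eps_prim) expr1n.
rewrite -mulr_sumr !geometric_root ?exprVn ?xn ?invr1 // invr_eq1.
case: (x =P 1) => [x1|_]; last by rewrite mulr0 addr0.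
have /eqP : eps ^+ k ^+ 2 = 1 by rewrite -exprM mulnC.
rewrite sqrf_eq1 -(prim_order_dvd eps_prim) Nk => /eqP ->.
by rewrite mulN1r subrr.
Qed.

Definition root_char k : {ffun hT -> F^o} := [ffun s => root_of s ^+ k : F^o].

Definition fourier_coef f k : F := N%:R^-1 * \sum_s (f s : F) * root_of s ^- k.

Lemma fourier_at f t : \sum_(k < N) fourier_coef f k * root_of t ^+ k = f t :> F.
Proof.
transitivity (\sum_(k < N) \sum_s N%:R^-1 * (f s : F) * (root_of t / root_of s) ^+ k).
  apply: eq_bigr => k _; rewrite /fourier_coef -mulrA mulr_suml mulr_sumr.
  by apply: eq_bigr => s _; rewrite expr_div_n -!mulrA [_^-1 * root_of t ^+ _]mulrC.
rewrite exchange_big /= (bigD1 t) //= [X in _ + X]big1 ?addr0 => [|s st].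
  rewrite -mulr_sumr divff ?root_of_neq0 // geometric_root ?expr1n // eqxx.
  by rewrite mulrAC mulVf ?mul1r // pnatr_eq0 -lt0n.
rewrite -mulr_sumr geometric_root ?expr_div_n ?root_of_order ?divr1 //.
rewrite ifF ?mulr0 //; apply/eqP => E; case/eqP: st; apply: root_of_inj.
by rewrite -[RHS](divfK (root_of_neq0 s)) E mul1r.
Qed.

Lemma fourier_inv f : f = \sum_(k < N) fourier_coef f k *: root_char k.
Proof.
apply/ffunP => t; rewrite sum_ffunE -[LHS]fourier_at.
by apply: eq_bigr => k _; rewrite !ffunE.
Qed.

Lemma root_of_expN s k : (k <= N)%N -> root_of s ^+ (N - k) = root_of s ^- k.
Proof.
move=> kN; apply: (mulIf (expf_neq0 k (root_of_neq0 s))).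
by rewrite -exprD subnK // root_of_order mulVf ?expf_neq0 ?root_of_neq0.
Qed.

Lemma fourier_char k l : (k < N)%N ->
  fourier_coef (root_char l) k = (k == l %% N)%N%:R.
Proof.
move=> kN; rewrite /fourier_coef.
have -> : \sum_s (root_char l s : F) * root_of s ^- k =
    \sum_s root_of s ^+ (l + (N - k)).
  by apply: eq_bigr => s _; rewrite ffunE exprD root_of_expN // ltnW.
rewrite sum_root_of (_ : (N %| l + (N - k)) = (k == l %% N))%N.
  by case: eqP; rewrite ?mulr0 // mulVf // pnatr_eq0 -lt0n.
rewrite -{2}(modn_small kN) eq_sym -(eqn_modDr (N - k)) subnKC ?(ltnW kN) //.
by rewrite modnn.
Qed.

End CharacterDuality.

(** * The Fourier transform of the dihedral group *)

Section DihedralDual.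

Variables (F : numClosedFieldType) (i0 : F) (gT hT : finGroupType) (m : nat).
Variables (a b : gT) (al be : hT) (eps : F).
Hypothesis II : i0 * i0 = -1.
Hypothesis Ic : i0^* = - i0.
Hypothesis m_gt0 : (0 < m)%N.
Local Notation n := (2 * m)%N.
Local Notation N := (2 * n)%N.
Hypothesis D : dihedral_generators N a b.
Hypothesis Dn : dihedral_generators n al be.
Hypothesis eps_prim : N.-primitive_root eps.
Local Notation A := (group_algebra F gT).
Local Notation lam := (@ga_lambda F gT).
Local Notation Fun := {ffun hT -> F^o}.
Local Notation z := (a ^+ n)%g.
Implicit Types (s t : hT) (k l : nat) (f g : Fun).

Let n_gt0 : (0 < n)%N. Proof. by rewrite muln_gt0. Qed.
Let N_gt0 : (0 < N)%N. Proof. by rewrite !muln_gt0. Qed.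
Let zC := dih_center m_gt0 D.
Let zz := dih_zz D.
Let bb := dih_bb D.

Local Notation root_of := (root_of n al be eps).
Local Notation root_char := (root_char n al be eps).
Local Notation fourier_coef := (@fourier_coef F hT n al be eps).
Local Notation pl := (pl F n a).
Local Notation mi := (mi F n a).
Local Notation gauge := (gauge i0 n a b).

Fact fourier_coef_linear k : linear (fun f => fourier_coef f k : F^o).
Proof.
move=> c f g; rewrite /fourier_coef.
transitivity (N%:R^-1 * (\sum_s (c * (f s : F) * root_of s ^- k + (g s : F) * root_of s ^- k))).
  by congr (_ * _); apply: eq_bigr => s _; rewrite !ffunE -mulrDl.
rewrite big_split mulrDr /=; congr (_ + _).
rewrite -[RHS]/(_ * _) mulrCA; congr (_ * _); rewrite mulr_sumr.
by apply: eq_bigr => s _; rewrite mulrA.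
Qed.

(** The isomorphism of algebras from the functions on D_n to the span of <a> that sends
    the [k]-th power of [root_of] to [a ^+ k]. *)
Definition dual_map f : A := \sum_(k < N) fourier_coef f k *: lam (a ^+ k)%g.

Fact dual_map_linear : linear dual_map.
Proof.
move=> c f g; rewrite /dual_map scaler_sumr -big_split /=; apply: eq_bigr => k _.
rewrite scalerA -scalerDl; congr (_ *: _).
exact: (fourier_coef_linear k c f g).
Qed.
HB.instance Definition _ := GRing.isLinear.Build F Fun A *:%R
  dual_map dual_map_linear.

Lemma dual_map_char k : dual_map (root_char k) = lam (a ^+ k)%g.
Proof.
have kN : (k %% N < N)%N by rewrite ltn_mod.
rewrite /dual_map (bigD1 (Ordinal kN)) //= big1 => [|l lk].
  rewrite (fourier_char n_gt0 Dn eps_prim) // eqxx scale1r addr0.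
  by rewrite (expg_mod _ (dih_aN D)).
rewrite (fourier_char n_gt0 Dn eps_prim) // (_ : (_ == _) = false) ?scale0r //.
by apply: contra_neqF lk => /eqP lk; apply: val_inj.
Qed.

Lemma char_ind (P : Fun -> Prop) : P 0 -> (forall f g, P f -> P g -> P (f + g)) ->
  (forall c k, P (c *: root_char k)) -> forall f, P f.
Proof.
move=> P0 PD PZ f; rewrite (fourier_inv n_gt0 Dn eps_prim f).
by apply: big_ind => // k _; exact: PZ.
Qed.

Lemma dual_map_coef f k : (k < N)%N -> dual_map f (a ^+ k)%g = fourier_coef f k :> F.
Proof.
move=> kN; rewrite /dual_map ga_sumE (bigD1 (Ordinal kN)) //= big1 ?addr0 => [|l lk].
  by rewrite ga_scaleE lamE eqxx mulr1.
rewrite ga_scaleE lamE (expg_a_eq m_gt0 D) // (_ : (_ == _) = false) ?mulr0 //.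
by apply: contra_neqF lk => /eqP lk; apply: val_inj.
Qed.

Lemma dual_map_inj f : dual_map f = 0 -> f = 0.
Proof.
move=> f0; rewrite (fourier_inv n_gt0 Dn eps_prim f) big1 // => k _.
by rewrite -dual_map_coef // f0 [X in X *: _]ffunE scale0r.
Qed.

(** The powers of [root_of] span the functions. *)
Lemma dual_map_img x : x \in lam_span F <[a]>%g <-> exists f, x = dual_map f.
Proof.
split=> [|[f ->]]; last first.
  apply: rpred_sum => k _; rewrite memvZ // lam_in_span mem_cycle //.
elim/span_ind: x / => [|x y [f ->] [g ->]|c x /mapP[h + ->]].
- by exists 0; rewrite linear0.
- by exists (f + g); rewrite linearD.
rewrite mem_enum => /cycleP[k ->]; exists (c *: root_char k).
by rewrite linearZ /= dual_map_char.
Qed.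

Lemma dual_map1 : dual_map [ffun=> 1] = 1.
Proof.
by rewrite (_ : [ffun=> 1] = root_char 0) ?dual_map_char //; apply/ffunP => s; rewrite !ffunE.
Qed.

Lemma dual_mapM f g : dual_map [ffun s => f s * g s] = dual_map f * dual_map g.
Proof.
elim/char_ind: f => [|f f' IH IH'|c k].
- rewrite linear0 mul0r -[RHS](linear0 dual_map); congr dual_map.
  by apply/ffunP => s; rewrite !ffunE mul0r.
- rewrite linearD mulrDl -IH -IH' -linearD; congr dual_map.
  by apply/ffunP => s; rewrite !ffunE mulrDl.
rewrite linearZ /= -scalerAl.
transitivity (c *: dual_map [ffun s => root_char k s * g s]).
  rewrite -linearZ /=; congr dual_map; apply/ffunP => s; rewrite !ffunE.
  by rewrite -[LHS]/(_ * _ * _) -[RHS]/(_ * (_ * _)) mulrA.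
congr (_ *: _); elim/char_ind: g => [|g g' IH IH'|d l].
- rewrite linear0 mulr0 -[RHS](linear0 dual_map); congr dual_map.
  by apply/ffunP => s; rewrite !ffunE mulr0.
- rewrite linearD mulrDr -IH -IH' -linearD; congr dual_map.
  by apply/ffunP => s; rewrite !ffunE mulrDr.
rewrite linearZ /= -scalerAr !dual_map_char lamM -expgD -dual_map_char -linearZ.
congr dual_map; apply/ffunP => s; rewrite !ffunE exprD.
by rewrite -[RHS]/(_ * (_ * _)) -[LHS]/(_ * (_ * _)) mulrCA.
Qed.

Lemma root_of_conj s : (root_of s)^* = (root_of s)^-1.
Proof.
have n1 : `|root_of s| = 1.
  apply/eqP; rewrite -(@pexpr_eq1 _ _ N) // -normrX.
  by rewrite (root_of_order al be eps_prim) normr1.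
by apply: (mulfI (root_of_neq0 al be n_gt0 eps_prim s)); rewrite -normCK n1 expr1n
  mulfV ?(root_of_neq0 al be n_gt0 eps_prim).
Qed.

Lemma root_of_powV s k : root_of s ^+ (k * N.-1) = root_of s ^- k.
Proof.
apply: (mulfI (expf_neq0 k (root_of_neq0 al be n_gt0 eps_prim s))).
rewrite -exprD -mulnS prednK // (mulnC k N) exprM (root_of_order al be eps_prim) expr1n.
by rewrite mulfV // expf_neq0 // (root_of_neq0 al be n_gt0 eps_prim).
Qed.

Lemma lam_aV k : lam (a ^- k)%g = dual_map (root_char (k * N.-1)).
Proof. by rewrite dual_map_char (dih_aV N_gt0 D). Qed.

Lemma dual_map_star f : dual_map [ffun s => (f s : F)^* : F^o] = star (dual_map f).
Proof.
elim/char_ind: f => [|f f' IH IH'|c k].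
- rewrite linear0 star0 -[RHS](linear0 dual_map); congr dual_map.
  by apply/ffunP => s; rewrite !ffunE rmorph0.
- rewrite linearD starD -IH -IH' -linearD; congr dual_map.
  by apply/ffunP => s; rewrite !ffunE rmorphD.
rewrite linearZ /= starZ dual_map_char star_lam lam_aV -linearZ; congr dual_map.
apply/ffunP => s; rewrite !ffunE -[X in X^*]/(_ * _) rmorphM rmorphXn /=.
by rewrite root_of_conj root_of_powV exprVn.
Qed.

Lemma dual_map_aug f : aug (dual_map f) = f 1%g :> F.
Proof.
elim/char_ind: f => [|f f' IH IH'|c k].
- by rewrite !linear0 ffunE.
- by rewrite !linearD /= IH IH' ffunE.
rewrite !linearZ /= dual_map_char aug_lam !ffunE.
by rewrite (root_of1 n_gt0 Dn eps_prim) expr1n.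
Qed.

(** The [n]-th power of [root_of] is 1 on rotations and -1 on reflections, so [dual_map]
    sends the indicator of the rotations to P+ and that of the reflections to P-. *)
Lemma dual_map_rot k :
  dual_map [ffun s => (if refl al s then 0 else root_of s ^+ k) : F^o] = pl (a ^+ k)%g.
Proof.
transitivity (dual_map (2^-1 *: (root_char k + root_char (k + n)))).
  congr dual_map; apply/ffunP => s; rewrite !ffunE exprD.
  rewrite (root_of_half al be n_gt0 eps_prim); rewrite -[RHS]/(_ * _).
  by case: (refl al s); rewrite ?expr0 ?expr1; field.
rewrite linearZ linearD /= !dual_map_char expgD (lam_pl_mi F n a) [lam (_ * z)%g](lam_pl_mi F n a).
rewrite (pl_mulz F zC zz) (mi_mulz F zC zz) addrACA subrr addr0.
exact: scaler_half.
Qed.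

Lemma dual_map_refl k :
  dual_map [ffun s => (if refl al s then root_of s ^+ k else 0) : F^o] = mi (a ^+ k)%g.
Proof.
apply: (addrI (pl (a ^+ k)%g)); rewrite -(lam_pl_mi F n a) -dual_map_rot -dual_map_char.
rewrite -linearD; congr dual_map; apply/ffunP => s; rewrite !ffunE.
by case: ifP; rewrite ?addr0 ?add0r.
Qed.

Definition delta s : Fun := [ffun t => (t == s)%:R : F^o].

Lemma dual_map_delta f : \sum_s (f s : F) *: dual_map (delta s) = dual_map f.
Proof.
transitivity (dual_map (\sum_s (f s : F) *: delta s)).
  by rewrite linear_sum; apply: eq_bigr => s _; rewrite linearZ.
congr dual_map; apply/ffunP => t; rewrite sum_ffunE (bigD1 t) //= big1 ?addr0.
  by rewrite !ffunE eqxx -[LHS]/(_ * _) mulr1.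
by move=> s st; rewrite !ffunE eq_sym (negbTE st) -[LHS]/(_ * _) mulr0.
Qed.

(** By [root_ofM], the function (s, t) |-> root_of (s t)^k is root_of s^k root_of t^k
    for [s] a rotation, and root_of s^k root_of t^-k for [s] a reflection;
    [dual_map_rot] and [dual_map_refl] turn the two parts into
    [pl (a ^+ k) (x) a ^+ k] and [mi (a ^+ k) (x) a ^- k]. *)
Lemma dual_map_Delta f : twisted_Delta n a b (dual_map f) =
  \sum_s \sum_t (f (s * t)%g : F) *: tensor (dual_map (delta s)) (dual_map (delta t)).
Proof.
elim/char_ind: f => [|f f' IH IH'|c k].
- rewrite !linear0 big1 // => s _; rewrite big1 // => t _.
  by rewrite [X in X *: _]ffunE scale0r.
- rewrite !linearD /= IH IH' -big_split; apply: eq_bigr => s _.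
  rewrite -big_split; apply: eq_bigr => t _ /=; rewrite -scalerDl.
  by congr (_ *: _); rewrite ffunE.
rewrite !linearZ /=; transitivity (c *: \sum_s \sum_t
   (root_char k (s * t)%g : F) *: tensor (dual_map (delta s)) (dual_map (delta t))); last first.
  rewrite scaler_sumr; apply: eq_bigr => s _; rewrite scaler_sumr.
  by apply: eq_bigr => t _; rewrite scalerA; congr (_ *: _); rewrite [in RHS]ffunE.
congr (_ *: _).
rewrite dual_map_char (twisted_Delta_lam F zC zz bb) (dih_conj D).
transitivity (\sum_s (root_char k s : F) *:
    tensor (dual_map (delta s)) (lam (if refl al s then a ^- k else a ^+ k)%g)); last first.
  apply: eq_bigr => s _.
  have -> : lam (if refl al s then a ^- k else a ^+ k)%g =
      dual_map (root_char (if refl al s then k * N.-1 else k)%N).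
    by case: (refl al s); rewrite ?lam_aV ?dual_map_char.
  rewrite -[dual_map (root_char _)]dual_map_delta tensor_sumr scaler_sumr.
  apply: eq_bigr => t _.
  rewrite tensorZr scalerA; congr (_ *: _); rewrite !ffunE.
  rewrite (root_ofM n_gt0 Dn eps_prim) exprMn; case: (refl al s) => //.
  by rewrite root_of_powV exprVn.
rewrite -dual_map_rot -dual_map_refl.
rewrite -[X in tensor X _ + _]dual_map_delta -[X in _ + tensor X _]dual_map_delta.
rewrite !tensor_suml -big_split; apply: eq_bigr => s _.
rewrite /= !tensorZl.
have -> : root_char k s = root_of s ^+ k by rewrite ffunE.
case: (boolP (refl al s)) => sr.
  rewrite [X in X *: _ + _](_ : _ = 0) ?[X in _ + X *: _](_ : _ = root_of s ^+ k)
    ?ffunE ?sr //.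
  by rewrite scale0r add0r.
rewrite [X in X *: _ + _](_ : _ = root_of s ^+ k) ?[X in _ + X *: _](_ : _ = 0)
  ?ffunE ?(negbTE sr) //.
by rewrite scale0r addr0.
Qed.

(** The square of (1 + b) / 2 + i (1 - b) / 2 is [b]. *)
Lemma gauge_unitary_sqr :
  gauge_unitary i0 n a b * gauge_unitary i0 n a b = pl 1 + mi b.
Proof.
transitivity (klein n a b (fun i => nth 0 [:: 2^-1; 2^-1; 2^-1; - 2^-1] i : F)).
  rewrite /gauge_unitary (kleinM zC zz bb); apply: eq_klein => i.
  by rewrite sum4 /gauge_coef; elim/ord4_ind: i => /=; field: II.
rewrite /klein sum4 !(tnth_nth 1%g) /= (pl1 F n a) /mi /Pp /Pm.
rewrite -scalerAl mulrBl mul1r lamM zC scalerDr scalerBr scaleNr !addrA.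
by [].
Qed.

(** The antipode turns [gauge] into conjugation by the adjoint of [U], so that
    conjugation by the square of [U] is to be compared with the inversion of
    [s], under which [root_of] is inverted on rotations and fixed on
    reflections. *)
Lemma inva_gauge_dual f :
  inva (gauge (dual_map f)) = gauge (dual_map [ffun s => f s^-1%g : F^o]).
Proof.
pose U := gauge_unitary i0 n a b.
have UU : U * star U = 1 := gauge_unitaryE II Ic zC zz bb.
have VV : star U * U = 1 := gauge_unitaryV II Ic zC zz bb.
suff E : inva (dual_map f) * (U * U) = U * U * dual_map [ffun s => f s^-1%g : F^o].
  rewrite (inva_gauge i0 zC zz bb) -/U.
  have -> : inva (dual_map f) = U * U * dual_map [ffun s => f s^-1%g : F^o] * star U * star U.
    by rewrite -E !mulrA -[_ * U * star U]mulrA UU mulr1 -mulrA UU mulr1.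
  by rewrite /gauge -/U !mulrA VV mul1r -[_ * star U * U]mulrA VV mulr1.
rewrite gauge_unitary_sqr; elim/char_ind: f => [|f g IH IH'|c k].
- rewrite !linear0 mul0r -[LHS](mulr0 (pl 1 + mi b)) -(linear0 dual_map).
  by congr (_ * dual_map _); apply/ffunP => s; rewrite !ffunE.
- rewrite !linearD /= mulrDl IH IH' -mulrDr -linearD.
  by congr (_ * dual_map _); apply/ffunP => s; rewrite !ffunE.
rewrite !linearZ /= -scalerAl.
transitivity ((pl 1 + mi b) * (c *: (pl (a ^- k)%g + mi (a ^+ k)%g))); last first.
  rewrite (dih_aV N_gt0 D) -dual_map_rot -dual_map_refl -linearD -linearZ.
  congr (_ * dual_map _); apply/ffunP => s; rewrite !ffunE.
  rewrite (root_ofV n_gt0 Dn eps_prim); case: (refl al s); rewrite ?add0r ?addr0 //.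
  by rewrite root_of_powV exprVn.
rewrite -scalerAr dual_map_char inva_lam; congr (_ *: _).
have M (g h g' h' : gT) : (pl g + mi h) * (pl g' + mi h') = pl (g * g')%g + mi (h * h')%g.
  have := @alg_combM F A 1 1 1 1 _ _ _ _ (pl_mi F zC zz g h') (mi_pl F zC zz h g').
  by rewrite !scale1r mulr1 !scale1r (plM F zC zz) (miM F zC zz).
rewrite (lam_pl_mi F n a) !M mulg1 mul1g; congr (_ + mi _).
by rewrite -(dih_conj D) -mulgA bb mulg1.
Qed.

Lemma involution_coideal_center :
  involution_coideal F n a b (a ^+ m)%g = lam_span F <[a ^+ m]>%g.
Proof.
have z_neq1 := dih_z_neq1 m_gt0 D.
have zm : z \in <[a ^+ m]>%g by rewrite mulnC expgM mem_cycle.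
have am : (a ^+ m)%g \in <[a ^+ m]>%g by rewrite cycle_id.
apply/eqP; rewrite eqEdim; apply/andP; split.
  apply/span_subvP => x; rewrite !inE => /or4P[]/eqP->.
  - by apply: pl_lam_span.
  - by apply: mi_lam_span.
  - by apply: pl_lam_span.
  - by rewrite (dih_conj D); apply: mi_lam_span; rewrite // groupV.
rewrite dim_lam_span (dim_involution_coideal F zC zz bb z_neq1).
  rewrite -orderE orderXdiv (dih_order N_gt0 D) ?dvdn_mull //.
  by rewrite mulnA mulnK.
by rewrite -[1%g](expg0 a) /eqmodz -(zC (a ^+ 0)%g) mulg1 !(expg_a_eq m_gt0 D); clear -m_gt0; lia.
Qed.

(** Translation by [al ^+ 2] multiplies the [k]-th power of [root_of] by
    [eps ^+ (4 * k)], which is 1 exactly when [m] divides [k]. *)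
Lemma J20_dual x : x \in lam_span F <[a ^+ m]>%g <->
  exists2 f : Fun, (forall s t, t \in (<[al ^+ 2]> :* s)%g -> f t = f s) & x = dual_map f.
Proof.
have al2 j s : root_of (al ^+ 2 ^+ j * s)%g = eps ^+ (4 * j) * root_of s.
  rewrite (root_ofM n_gt0 Dn eps_prim) -expgM (refl_a n_gt0 Dn); congr (_ * _).
  have := root_ofE n_gt0 Dn eps_prim false (2 * j); rewrite mul1g => ->.
  by congr (_ ^+ _); lia.
split=> [|[f fc ->]].
  elim/span_ind: x / => [|x y [f fc ->] [g gc ->]|c x /mapP[h + ->]].
  - by exists 0; rewrite ?linear0 // => s t _; rewrite !ffunE.
  - exists (f + g); rewrite ?linearD // => s t st.
    by rewrite !ffunE (fc s t) // (gc s t).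
  rewrite mem_enum => /cycleP[i ->]; exists (c *: root_char (m * i)).
    move=> s t /rcosetP[h0 /cycleP[j ->] ->]; rewrite !ffunE al2 exprMn -exprM.
    rewrite (_ : (4 * j * (m * i) = N * (j * i))%N); last by lia.
    by rewrite exprM (prim_expr_order eps_prim) expr1n mul1r.
  by rewrite linearZ /= dual_map_char -expgM.
apply: rpred_sum => k _.
have [->|fk] := eqVneq (fourier_coef f k) 0; first by rewrite scale0r mem0v.
rewrite memvZ // lam_in_span.
suff E : eps ^+ (4 * k) = 1.
  have N4 : (4 * m = N)%N by lia.
  have : (4 * m %| 4 * k)%N by rewrite N4 (prim_order_dvd eps_prim) E.
  by rewrite dvdn_pmul2l // => /dvdnP[q ->]; rewrite mulnC expgM mem_cycle.
(* shifting the sum that defines the coefficient by the rotation [al ^+ 2] *)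
have shift : fourier_coef f k = eps ^- (4 * k) * fourier_coef f k.
  rewrite {1}/fourier_coef (reindex_inj (mulgI (al ^+ 2)%g)) /=.
  rewrite /fourier_coef mulrCA; congr (_ * _); rewrite mulr_sumr.
  apply: eq_bigr => s _; rewrite (fc s (al ^+ 2 * s)%g); last first.
    by apply/rcosetP; exists (al ^+ 2)%g; rewrite ?cycle_id.
  have := al2 1%N s; rewrite expg1 muln1 => ->.
  by rewrite exprMn invfM -exprM mulrCA.
have : eps ^- (4 * k) = 1 by apply: (mulIf fk); rewrite -shift mul1r.
by move/(congr1 GRing.inv); rewrite invrK invr1.
Qed.

End DihedralDual.

(** * Inclusions between coideals and Jones projections *)

Section Inclusions.

Variables (F : numClosedFieldType) (gT : finGroupType) (m : nat) (a b : gT).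
Hypothesis m_gt0 : (0 < m)%N.
Local Notation n := (2 * m)%N.
Local Notation N := (2 * n)%N.
Hypothesis D : dihedral_generators N a b.
Local Notation A := (group_algebra F gT).
Local Notation z := (a ^+ n)%g.
Implicit Types (I : {vspace A}) (g h : gT) (c : F) (k l : nat).

Let N_gt0 : (0 < N)%N. Proof. by rewrite !muln_gt0. Qed.
Let zC := dih_center m_gt0 D.
Let zz := dih_zz D.
Let bb := dih_bb D.
Let z_neq1 := dih_z_neq1 m_gt0 D.

Local Notation pl := (pl F n a).
Local Notation mi := (mi F n a).
Local Notation twisted_coideal := (@twisted_coideal F gT n a b).
Local Notation conjb g := (b * g * b)%g.
Local Notation eqmodz := (@eqmodz gT n a).
Local Notation involution_coideal := (@involution_coideal F gT n a b).
Local Notation w := (a ^+ m./2)%g.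
Local Notation cyclic_coideal := (@cyclic_coideal F gT n a w).

Lemma augZ c (x : A) : aug (c *: x) = c * aug x.
Proof. by rewrite /aug mulr_sumr; apply: eq_bigr => g _; rewrite ga_scaleE. Qed.

Section Kernel.

Variable chi : gT -> bool.
Hypothesis chiM : forall g h, chi (g * h)%g = chi g (+) chi h.

Lemma chi_kernel_group_set : group_set [set g | ~~ chi g].
Proof.
have chi1 : chi 1%g = false by have := chiM 1%g 1%g; rewrite mulg1 addbb.
apply/group_setP; split; first by rewrite inE chi1.
by move=> g h; rewrite !inE chiM => /negbTE -> /negbTE ->.
Qed.
Definition chi_kernel := Group chi_kernel_group_set.

Lemma mem_chi_kernel g : (g \in chi_kernel) = ~~ chi g.
Proof. by rewrite inE. Qed.

Lemma chi_kernel_conj g : g \in chi_kernel -> conjb g \in chi_kernel.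
Proof. by rewrite !mem_chi_kernel !chiM addbAC addbb. Qed.

Lemma chi_kernel_coideal : twisted_coideal (lam_span F chi_kernel).
Proof. exact: (lam_span_coideal F zC zz z_neq1 chi_kernel_conj). Qed.

Hypothesis chi_z : chi z = false.

Lemma chi_kernel_sub I (x : A) c : twisted_coideal I -> c != 0 -> x \in I ->
    (forall g, x g = if chi g then 0 else c) ->
  (lam_span F chi_kernel <= I)%VS.
Proof.
move=> tcI c0 xI xE; apply: (lam_span_sub zC zz bb z_neq1 tcI c0 xI) => g gS.
  split; last exact: chi_kernel_conj.
  by move: gS; rewrite !mem_chi_kernel chiM chi_z addbF.
by move: gS; rewrite mem_chi_kernel xE => /negbTE ->.
Qed.

Let zS : z \in chi_kernel. Proof. by rewrite mem_chi_kernel chi_z. Qed.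

Lemma involution_kernel h :
  (involution_coideal h <= lam_span F chi_kernel)%VS = ~~ chi h.
Proof.
rewrite -mem_chi_kernel; apply/idP/idP => [/subvP sub|hS]; last first.
  have S1 : 1%g \in chi_kernel by exact: group1.
  apply/span_subvP => x; rewrite !inE => /or4P[]/eqP->.
  - exact: pl_lam_span S1.
  - exact: mi_lam_span S1.
  - exact: pl_lam_span hS.
  - exact: mi_lam_span (chi_kernel_conj hS).
have /sub : pl h \in involution_coideal h by apply: pl_involution; rewrite // eqmodzxx orbT.
move=> /mem_lam_span plS; apply/negPn/negP => /plS/eqP.
by rewrite (plE F zC) eqxx neq_mulz // addr0 mulr1 invr_eq0 pnatr_eq0.
Qed.

Lemma cyclic_kernel c : ~~ chi a -> (cyclic_coideal c <= lam_span F chi_kernel)%VS.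
Proof.
move=> ca; have aS i : (a ^+ i)%g \in chi_kernel.
  by rewrite groupX // mem_chi_kernel.
apply/span_subvP => _ /mapP[i _ ->]; rewrite /cyclic_elt -expgM.
by rewrite memvD ?memvZ // ?pl_lam_span ?mi_lam_span.
Qed.

End Kernel.

Definition involution_projection h : A := 2^-1 *: (pl 1 + pl h).

Section Projection.

Variable h : gT.
Hypotheses (hh : (h * h = 1)%g) (h1 : ~~ eqmodz h 1).
Local Notation p := (involution_projection h).

Lemma aug_pl g : aug (pl g) = 1.
Proof.
rewrite /pl augM aug_lam mulr1 /Pp linearZ linearD /= -(lam1 F gT) !aug_lam.
exact: (@scaler_half F F^o 1).
Qed.

Lemma aug_mi g : aug (mi g) = 0.
Proof.
rewrite /mi augM aug_lam mulr1 /Pm linearZ linearB /= -(lam1 F gT) !aug_lam.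
by rewrite subrr scaler0.
Qed.

Lemma involution_projection_mem : p \in involution_coideal h.
Proof. by rewrite memvZ // memvD // pl_involution ?eqmodzxx ?orbT. Qed.

Lemma involution_projection_absorb y : y \in involution_coideal h -> y * p = aug y *: p.
Proof.
elim/span_ind: y / => [|x y xp yp|c y].
- by rewrite mul0r linear0 scale0r.
- by rewrite mulrDl xp yp linearD scalerDl.
move=> yG; rewrite -scalerAl augZ -scalerA; congr (_ *: _).
have plP g : pl g * p = 2^-1 *: (pl g + pl (g * h)%g).
  by rewrite -scalerAr mulrDr !(plM F zC zz) mulg1.
have miP g : mi g * p = 0.
  by rewrite -scalerAr mulrDr !(mi_pl F zC zz) addr0 scaler0.
move: yG; rewrite !inE => /or4P[]/eqP ->.
- by rewrite plP mul1g aug_pl scale1r.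
- by rewrite miP aug_mi scale0r.
- by rewrite plP hh aug_pl scale1r addrC.
- by rewrite miP aug_mi scale0r.
Qed.

Lemma involution_projection_star : star p = p.
Proof.
have hV : (h^-1 = h)%g by apply: (mulgI h); rewrite mulgV hh.
by rewrite starZ starD !(pl_star F zC zz) invg1 hV fmorphV rmorph_nat.
Qed.

Lemma involution_projection_Pp : p * Pp F n a = p.
Proof. by rewrite -(pl1 F n a) -scalerAl mulrDl !(plM F zC zz) !mulg1. Qed.

Lemma aug_involution_projection : aug p = 1.
Proof.
rewrite linearZ linearD /= !aug_pl; exact: (@scaler_half F F^o 1).
Qed.

Lemma involution_projection_idem : p * p = p.
Proof.
rewrite (involution_projection_absorb involution_projection_mem).
by rewrite aug_involution_projection scale1r.
Qed.

Lemma involution_projection_neq0 : p != 0.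
Proof.
by apply: contra_neq (oner_neq0 F) => p0; rewrite -aug_involution_projection p0 linear0.
Qed.

(** As [p] has coordinate 0 on the [mi g], its components put [pl 1] and [pl h] in [I];
    [mi_of_pl] provides the other two generators. *)
Lemma involution_projection_coideal I : twisted_coideal I -> \dim I = 4 ->
  p \in I -> I = involution_coideal h.
Proof.
move=> tcI dI pI.
have pp g : pcoef n a g p = 2^-1 * ((eqmodz g 1)%:R + (eqmodz g h)%:R).
  by rewrite pcoefZ pcoefD !(pcoef_pl F zC zz z_neq1).
have mp g : mcoef n a g p = 0.
  by rewrite mcoefZ mcoefD !(mcoef_pl F zC zz) addr0 mulr0.
have half_neq0 : (2^-1 : F) != 0 by rewrite invr_eq0 pnatr_eq0.
have plI : pl 1 \in I.
  have [_ _ _ ID] := tcI; have [+ _] := ID p 1%g pI.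
  rewrite /homog pp mp scale0r addr0 eqmodzxx (eqmodz_sym zz) (negbTE h1) addr0 mulr1.
  by rewrite memvZl.
have hI : pl h \in I.
  by apply: (mem_pl zC zz tcI plI pI); rewrite pp eqmodzxx (negbTE h1) add0r mulr1.
symmetry; apply/eqP; rewrite eqEdim (dim_involution_coideal F zC zz bb z_neq1 h1) dI leqnn andbT.
apply/span_subvP => x; rewrite !inE => /or4P[]/eqP-> //.
  by rewrite -(conj1 bb) (mi_of_pl zC zz z_neq1 tcI).
by rewrite (mi_of_pl zC zz z_neq1 tcI).
Qed.

End Projection.

Lemma reflection_sqr k : (b * a ^+ k * (b * a ^+ k) = 1)%g.
Proof. by rewrite mulgA (dih_conj D) mulVg. Qed.

Lemma reflection_neqmodz k : ~~ eqmodz (b * a ^+ k)%g 1.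
Proof.
rewrite /eqmodz mul1g negb_or; apply/andP; split; apply/negP => /eqP E.
  by have := refl_ba N_gt0 D k; rewrite E -(expg0 a) (refl_a N_gt0 D).
by have := refl_ba N_gt0 D k; rewrite E (refl_a N_gt0 D).
Qed.

Lemma reflection_eqmodz_inj k l : (k < n)%N -> (l < n)%N ->
  eqmodz (b * a ^+ k)%g (b * a ^+ l)%g -> k = l.
Proof.
move=> kn ln; rewrite /eqmodz -mulgA -expgD !(inj_eq (mulgI b)).
by rewrite !(expg_a_eq m_gt0 D); lia.
Qed.

Lemma am_neqmodz : ~~ eqmodz (a ^+ m)%g 1.
Proof.
by rewrite /eqmodz mul1g -[1%g](expg0 a) !(expg_a_eq m_gt0 D); lia.
Qed.

Lemma am_sqr : eqmodz (a ^+ m * a ^+ m)%g 1.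
Proof. by rewrite -expgD addnn -mul2n /eqmodz mul1g eqxx orbT. Qed.

Section EvenCase.

Hypothesis m_even : ~~ odd m.

(** On the coset of 1 the elements [cyclic_elt w c i] have equal coordinates, while
    [pl 1] has coordinates 1 and 0. *)
Lemma cyclic_nonsplit c : pl 1 \notin cyclic_coideal c.
Proof.
have [w1 w2 w3] := cyclic_w_indep m_gt0 D m_even.
have E x : x \in cyclic_coideal c -> pcoef n a 1 x = mcoef n a 1 x.
  elim/span_ind: x / => [|x y xE yE|d x /mapP[i + ->]].
  - by rewrite pcoef0 mcoef0.
  - by rewrite pcoefD mcoefD xE yE.
  rewrite mem_iota => i4; rewrite pcoefZ mcoefZ cyclic_eltE.
  rewrite (pcoef_comb zC zz z_neq1) (mcoef_comb zC zz) mul1r; congr (_ * _).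
  case: i i4 => [|i] i4; first by rewrite expg0 eqmodzxx zsignxx // expr0 mulr1.
  have wi : ~~ eqmodz 1 (w ^+ i.+1)%g by rewrite (eqmodz_sym zz); case: i i4 => [|[|[|]]].
  by rewrite (negbTE wi) zsign0 ?mulr0.
apply/negP => /E/eqP.
by rewrite (pcoef_pl F zC zz z_neq1) (mcoef_pl F zC zz) eqmodzxx oner_eq0.
Qed.

Lemma cyclic_coideal_twisted c : c ^+ 4 = -1 -> twisted_coideal (cyclic_coideal c).
Proof.
move=> c4; have w4 := cyclic_w4 m_gt0 D m_even.
apply: (cyclic_coidealP zC zz bb z_neq1 w4 c4).
exact: dih_conj D _.
Qed.

Lemma cyclic_coideal_inj c d : c ^+ 4 = -1 -> d ^+ 4 = -1 ->
  cyclic_coideal c = cyclic_coideal d -> c = d.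
Proof.
move=> c4 d4 E; have w4 := cyclic_w4 m_gt0 D m_even.
have := cyclic_elt_mem zC zz w4 c4 1; have := cyclic_elt_mem zC zz w4 d4 1.
rewrite -E /cyclic_elt !expr1 => dI cI.
exact: (nonsplit_uniq zC zz (cyclic_coideal_twisted c4) (cyclic_nonsplit c) cI dI).
Qed.

End EvenCase.

End Inclusions.

(** The fourth roots of -1 are the primitive eighth roots of unity, that is the odd
    powers of [eps ^+ m./2]. *)
Lemma fourth_roots (F : numClosedFieldType) (m : nat) (eps c : F) :
    (0 < m)%N -> ~~ odd m -> (2 * (2 * m)).-primitive_root eps ->
  c ^+ 4 = -1 <->
  exists2 i : nat, (i < 4)%N & c = eps ^+ (m./2 * (2 * i + 1)).
Proof.
move=> m_gt0 m_even eps_prim; have n_gt0 : (0 < 2 * m)%N by rewrite muln_gt0.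
pose N := (2 * (2 * m))%N.
have m2 := even_halfK m_even; have m2_gt0 : (0 < m./2)%N by lia.
pose o := eps ^+ m./2.
have o8 : 8.-primitive_root o.
  have -> : 8%N = (N %/ gcdn m./2 N)%N.
    have -> : gcdn m./2 N = m./2 by apply/gcdn_idPl/dvdnP; exists 8%N; rewrite /N; lia.
    by rewrite (_ : N = 8 * m./2)%N ?mulnK //; rewrite /N; lia.
  exact: exp_prim_root.
have o4 : o ^+ 4 = -1.
  rewrite -exprM (_ : (m./2 * 4 = 2 * m)%N); last by lia.
  exact: (eps_half n_gt0 eps_prim).
split=> [c4|[i _ ->]]; last first.
  rewrite exprM -/o exprAC o4 exprD exprM sqrrN !expr1n mul1r expr1 //.
have o0 : o != 0 by rewrite expf_neq0 // (eps_neq0 n_gt0 eps_prim).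
have q4 : 4.-primitive_root (o ^+ 2).
  by have := exp_prim_root o8 2.
have /(prim_rootP q4)[i iE] : (c / o) ^+ 4 = 1.
  by rewrite expr_div_n c4 o4 divrr // unitrN1.
exists i => //; rewrite exprM -/o exprD expr1 exprM -iE divfK //.
Qed.

(** * Values of the minimal projections *)

Section DihedralSums.

Variables (F : fieldType) (gT : finGroupType) (N : nat) (a b : gT).
Hypothesis N_gt0 : (0 < N)%N.
Hypothesis D : dihedral_generators N a b.
Local Notation lam := (@ga_lambda F gT).

Lemma dih_sumE (u v : nat -> F) (e : bool) k : (k < N)%N ->
  (\sum_(i < N) (u i *: lam (a ^+ i)%g + v i *: lam (b * a ^+ i)%g))
    (b ^+ e * a ^+ k)%g = (if e then v k else u k) :> F.
Proof.
move=> kN; rewrite ga_sumE (bigD1 (Ordinal kN)) //= big1 => [|i ik].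
  rewrite ga_addE !ga_scaleE !lamE addr0.
  have lamba (f : bool) : (b ^+ e * a ^+ k == b ^+ f * a ^+ k)%g = (e == f).
    apply/eqP/eqP => [E|-> //].
    by have [] // := @dih_inj _ _ _ _ N_gt0 D e f k k.
  have := lamba false; have := lamba true; rewrite mul1g expg1 => -> ->.
  by case: e {lamba}; rewrite !(mulr0, mulr1, addr0, add0r).
have ne (f : bool) : (b ^+ e * a ^+ k == b ^+ f * a ^+ i)%g = false.
  apply/eqP => E; have [] // := @dih_inj _ _ _ _ N_gt0 D e f k i.
  by move=> _ ki; case/eqP: ik; apply: val_inj.
rewrite ga_addE !ga_scaleE !lamE; have := ne false; have := ne true.
by rewrite mul1g expg1 => -> ->; rewrite !mulr0 addr0.
Qed.

End DihedralSums.

Lemma sum_pow_pairs (F : fieldType) (m : nat) (x : F) : (0 < m)%N ->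
    x ^+ (2 * m) = 1 ->
  \sum_(k < 2 * m) x ^+ k = 1 + x ^+ m + \sum_(1 <= j < m) (x ^- j + x ^+ j).
Proof.
move=> m_gt0 xn.
have x0 : x != 0.
  apply: contra_eq_neq xn => ->; rewrite expr0n muln_eq0 /= gtn_eqF //.
  by rewrite eq_sym oner_neq0.
have xV j : (j <= 2 * m)%N -> x ^+ (2 * m - j) = x ^- j.
  move=> jm; apply: (mulIf (expf_neq0 j x0)).
  by rewrite -exprD subnK // xn mulVf // expf_neq0.
rewrite -(big_mkord xpredT (fun k => x ^+ k)) (@big_cat_nat _ _ _ m) //=; last by lia.
rewrite big_ltn // expr0 [X in _ + X]big_ltn; last by lia.
have -> : \sum_(m.+1 <= i < 2 * m) x ^+ i = \sum_(1 <= j < m) x ^- j.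
  rewrite big_nat_rev /= -add1n big_addn (_ : 2 * m - m = m)%N; last by lia.
  apply: eq_big_nat => j jm; rewrite -xV; last by lia.
  by congr (_ ^+ _); lia.
by rewrite big_split /=; ring.
Qed.

(** The left-hand side is the value of [pJ] at a group element, [x] being the ratio that
    [pJE] compares with 1: the terms of the linear characters and those of the
    two-dimensional representations, which pair the indices [j] and [- j], make up a
    full geometric sum. *)
Lemma sum_root_pairs (F : numFieldType) (m : nat) (x : F) : (0 < m)%N ->
    x ^+ (2 * m) = 1 ->
  (4 * (2 * m))%:R^-1 * (1 + x ^+ m) +
    \sum_(1 <= j < m) 2^-1 * ((2 * (2 * m))%:R^-1 * (x ^- j + x ^+ j)) =
  if x == 1 then 4^-1 else 0.
Proof.
move=> m_gt0 xn; have m0 : m%:R != 0 :> F by rewrite pnatr_eq0 -lt0n.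
rewrite -mulr_sumr -mulr_sumr.
transitivity ((4 * (2 * m))%:R^-1 * \sum_(k < 2 * m) x ^+ k).
  rewrite (sum_pow_pairs m_gt0 xn) [RHS]mulrDr; congr (_ + _).
  by rewrite mulrA; congr (_ * _); rewrite !natrM; field.
rewrite (geometric_root xn); case: (x == 1); last by rewrite mulr0.
by rewrite !natrM; field.
Qed.

Section Expi.

Variable R : realType.
Local Open Scope complex_scope.

Lemma expiD (s t : R) : expi (s + t) = expi s * expi t.
Proof. by rewrite /expi cosD sinD; simpc; rewrite [sin s * cos t + _]addrC. Qed.

Lemma expi0 : expi (0 : R) = 1.
Proof. by rewrite /expi cos0 sin0. Qed.

Lemma expiMn (t : R) k : expi (k%:R * t) = expi t ^+ k.
Proof.
elim: k => [|k IH]; first by rewrite mul0r expi0 expr0.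
by rewrite -natr1 mulrDl mul1r expiD IH exprSr.
Qed.

Lemma expiN (t : R) : expi (- t) = (expi t)^-1.
Proof.
have E : expi (- t) * expi t = 1 by rewrite -expiD addNr expi0.
have e0 : expi t != 0.
  by apply: contra_eq_neq E => ->; rewrite mulr0 eq_sym oner_neq0.
by apply: (mulIf e0); rewrite E mulVf.
Qed.

(** The powers of exponent less than [n] have a positive imaginary part, and the [n]-th
    power is -1. *)
Lemma epsilon_prim n : (0 < n)%N -> (2 * n).-primitive_root (epsilon R n).
Proof.
move=> n_gt0; have n0 : n%:R != 0 :> R by rewrite pnatr_eq0 -lt0n.
have en : epsilon R n ^+ n = -1.
  rewrite /epsilon -expiMn mulrCA mulfV // mulr1 /expi cospi sinpi.
  by apply/eqP; rewrite eq_complex /= oppr0 !eqxx.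
have ek k : (0 < k < n)%N -> complex.Im (epsilon R n ^+ k) > 0.
  move=> /andP[k0 kn]; rewrite /epsilon -expiMn /=; apply: sin_gt0_pi.
  rewrite mulr_gt0 ?divr_gt0 ?pi_gt0 ?ltr0n //=.
  by rewrite mulrCA gtr_pMr ?pi_gt0 // ltr_pdivrMr ?ltr0n // mul1r ltr_nat.
apply/andP; split; first by rewrite muln_gt0.
apply/forallP => -[k' kn'] /=; apply/eqP; rewrite unity_rootE.
move: k'.+1 kn' (ltn0Sn k') => k kn k0.
have im1 (x : R[i]) : complex.Im x != 0 -> (x == 1) = false.
  by move=> x0; apply: contra_neqF x0 => /eqP ->.
have [kln|kgn|->] := ltngtP k n.
- rewrite im1; last by rewrite lt0r_neq0 // ek ?k0.
  by symmetry; apply/negbTE; lia.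
- have E : epsilon R n ^+ k = - epsilon R n ^+ (k - n).
    by rewrite -{1}(subnK (ltnW kgn)) exprD en mulrN1.
  have [->|k2n] := eqVneq k (2 * n)%N.
    by rewrite mulnC exprM en sqrrN expr1n eqxx.
  rewrite E im1 //; rewrite (raddfN (@complex.Im R)) oppr_eq0 lt0r_neq0 // ek //.
  by lia.
rewrite en; have -> : (-1 == 1 :> R[i]) = false.
  by apply/negbTE; rewrite -subr_eq0 -opprD oppr_eq0 -[1 + 1]/(2%:R) pnatr_eq0.
by symmetry; apply/negbTE; lia.
Qed.

End Expi.

Local Open Scope complex_scope.

(** For [P = exp (i beta)], the value at [b ^+ e * a ^+ l] of [q0 beta (2 * j)] in terms of
    the values of the four matrix units: reflections only see [e12] and [e21],
    which shift the exponent [l] by [k]. *)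
Lemma q_arith (F : numFieldType) (e : bool) (j k l : nat)
    (eps c P P' v11 v12 v21 v22 : F) :
    eps != 0 -> P = eps ^+ (2 * k * j) -> P' = P^-1 ->
    v11 = c * (if e then 0 else eps ^- (2 * j * l)) ->
    v12 = c * (if e then eps ^+ (2 * j * l) else 0) ->
    v21 = c * (if e then eps ^- (2 * j * l) else 0) ->
    v22 = c * (if e then 0 else eps ^+ (2 * j * l)) ->
  2^-1 * (v11 + P' * v12 + P * v21 + v22) =
  2^-1 * (c * ((eps ^+ (2 * l) / eps ^+ (2 * (if e then k else 0))) ^- j +
    (eps ^+ (2 * l) / eps ^+ (2 * (if e then k else 0))) ^+ j)).
Proof.
move=> e0 -> -> -> -> -> ->; congr (_ * _).
have E1 : eps ^+ (2 * j * l) = eps ^+ (2 * l) ^+ j by rewrite -exprM; congr (_ ^+ _); lia.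
have E2 : eps ^+ (2 * k * j) = eps ^+ (2 * k) ^+ j by rewrite -exprM.
rewrite !E1 !E2; have x0 := expf_neq0 (2 * l) e0; have y0 := expf_neq0 (2 * k) e0.
case: e; last by rewrite !mulr0 !addr0 muln0 expr0 divr1 mulrDr.
rewrite expr_div_n invfM invrK; ring.
Qed.

Lemma q_comb_coef (F : fieldType) (gT : finGroupType) (r s t : F)
    (x y v w : group_algebra F gT) g :
  (r *: (x + s *: y + t *: v + w)) g = r * (x g + s * y g + t * v g + w g) :> F.
Proof. by rewrite ga_scaleE !ga_addE !ga_scaleE. Qed.

Section ProjectionValues.

Variables (F : numClosedFieldType) (gT : finGroupType) (m : nat) (a b : gT) (eps : F).
Hypothesis m_gt0 : (0 < m)%N.
Local Notation n := (2 * m)%N.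
Local Notation N := (2 * n)%N.
Hypothesis D : dihedral_generators N a b.
Hypothesis eps_prim : N.-primitive_root eps.

Lemma dih_eq (e f : bool) i j : (i < N)%N -> (j < N)%N ->
  (b ^+ e * a ^+ i == b ^+ f * a ^+ j)%g = (e == f) && (i == j).
Proof.
move=> iN jN; have N_gt0 : (0 < N)%N by rewrite !muln_gt0 m_gt0.
apply/eqP/andP => [/(dih_inj N_gt0 D iN jN)[-> ->] // | [/eqP-> /eqP-> //]].
Qed.

Lemma root_ratio_eq1 k l : (k < n)%N -> (l < N)%N ->
  (eps ^+ (2 * l) / eps ^+ (2 * k) == 1) = (l == k) || (l == k + n)%N.
Proof.
move=> kn lN; have n_gt0 : (0 < n)%N by rewrite muln_gt0 m_gt0.
have e0 : eps ^+ (2 * k) != 0 by rewrite expf_neq0 // (eps_neq0 n_gt0 eps_prim).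
rewrite -(inj_eq (mulIf e0)) divfK // mul1r (eq_prim_root_expr eps_prim).
rewrite -!muln_modr eqn_pmul2l // (modn_small kn).
clear eps_prim e0; have [ln|nl] := ltnP l n; first by rewrite modn_small //; lia.
by rewrite -{1}(subnK nl) modnDr modn_small; lia.
Qed.

Lemma root_ratio_pow k l : (eps ^+ (2 * l) / eps ^+ (2 * k)) ^+ n = 1.
Proof.
have pow i : eps ^+ (2 * i) ^+ n = 1.
  by rewrite -exprM mulnAC exprM (prim_expr_order eps_prim) expr1n.
by rewrite expr_div_n !pow divr1.
Qed.

Lemma root_ratio_half k l :
  (eps ^+ (2 * l) / eps ^+ (2 * k)) ^+ m = (-1) ^+ (odd l (+) odd k).
Proof.
have n_gt0 : (0 < n)%N by rewrite muln_gt0 m_gt0.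
have pow i : eps ^+ (2 * i) ^+ m = (-1) ^+ i.
  by rewrite -exprM mulnAC exprM (eps_half n_gt0 eps_prim).
by rewrite expr_div_n !pow signr_addb !signr_odd -[(-1) ^- k]exprVn invrN1.
Qed.

Lemma involution_projectionE (e : bool) k l : (k < n)%N -> (l < N)%N ->
  (involution_projection F m a (b * a ^+ k)%g : {ffun gT -> F^o}) (b ^+ e * a ^+ l)%g =
  (if eps ^+ (2 * l) / eps ^+ (2 * (if e then k else 0)) == 1 then 4^-1 else 0) :> F.
Proof.
move=> kn lN; have N_gt0 : (0 < N)%N by rewrite !muln_gt0 m_gt0.
have zC := dih_center m_gt0 D.
rewrite /involution_projection ga_scaleE ga_addE !(plE F zC) root_ratio_eq1 //; last first.
  by case: e; rewrite // muln_gt0 m_gt0.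
have one : 1%g = (b ^+ false * a ^+ 0)%g by rewrite mulg1.
have zE : (1 * a ^+ n = b ^+ false * a ^+ n)%g by [].
have bk : (b * a ^+ k = b ^+ true * a ^+ k)%g by [].
rewrite zE bk -mulgA -expgD {1}one !dih_eq //; try lia.
have half (p q : bool) : ~~ (p && q) ->
    2^-1 * (2^-1 * (p%:R + q%:R)) = (if p || q then 4^-1 else 0) :> F.
  by case: p; case: q => //= _; rewrite ?addr0 ?add0r ?mulr1 ?mulr0 -?invfM -?natrM.
case: e => /=; rewrite ?addr0 ?add0r ?mulr0 ?addr0 ?add0r ?add0n half //; lia.
Qed.

End ProjectionValues.

Section KD.

Variables (R : realType) (gT : finGroupType) (m : nat) (a b : gT).
Hypothesis m_gt0 : (0 < m)%N.
Local Notation n := (2 * m)%N.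
Local Notation N := (2 * n)%N.
Hypothesis D : dihedral_generators N a b.
Local Notation C := R[i].
Local Notation A := (group_algebra C gT).
Local Notation lam := (@ga_lambda C gT).
Local Notation eps := (epsilon R n).
Implicit Types (e : bool) (k l : nat).

Let n_gt0 : (0 < n)%N. Proof. by rewrite muln_gt0. Qed.
Let N_gt0 : (0 < N)%N. Proof. by rewrite !muln_gt0. Qed.

Lemma weighted_sumE (x : A) (c : C) (u v : nat -> C) e k : (k < N)%N ->
    x = c *: \sum_(i < N) (u i *: lam (a ^+ i)%g + v i *: lam (b * a ^+ i)%g) ->
  x (b ^+ e * a ^+ k)%g = c * (if e then v k else u k) :> C.
Proof. by move=> kN ->; rewrite ga_scaleE (dih_sumE N_gt0 D). Qed.

Local Notation c4 := ((4 * n)%:R^-1 : C).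
Local Notation c2 := ((2 * n)%:R^-1 : C).

Lemma e1E e k : (k < N)%N -> e1 R n a b (b ^+ e * a ^+ k)%g = c4 :> C.
Proof.
move=> kN; rewrite -[RHS]mulr1.
rewrite (@weighted_sumE _ c4 (fun=> 1) (fun=> 1) e k kN); first by case: e.
by congr (_ *: _); apply: eq_bigr => i _; rewrite !scale1r.
Qed.

Lemma e2E e k : (k < N)%N -> e2 R n a b (b ^+ e * a ^+ k)%g = c4 * (-1) ^+ e :> C.
Proof.
move=> kN; rewrite (@weighted_sumE _ c4 (fun=> 1) (fun=> -1) e k kN); first by case: e.
by congr (_ *: _); apply: eq_bigr => i _; rewrite scale1r scaleN1r.
Qed.

Lemma e3E e k : (k < N)%N ->
  e3 R n a b (b ^+ e * a ^+ k)%g = c4 * (-1) ^+ (odd k (+) e) :> C.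
Proof.
move=> kN; rewrite signr_addb signr_odd.
rewrite (@weighted_sumE _ c4 (fun k => (-1) ^+ k) (fun k => - (-1) ^+ k) e k kN).
  by case: e; rewrite ?mulr1 // mulrN1.
by congr (_ *: _); apply: eq_bigr => i _; rewrite scalerBr scaleNr.
Qed.

Lemma e4E e k : (k < N)%N -> e4 R n a b (b ^+ e * a ^+ k)%g = c4 * (-1) ^+ odd k :> C.
Proof.
move=> kN; rewrite signr_odd.
rewrite (@weighted_sumE _ c4 (fun k => (-1) ^+ k) (fun k => (-1) ^+ k) e k kN).
  by case: e.
by congr (_ *: _); apply: eq_bigr => i _; rewrite scalerDr.
Qed.

Lemma e11E j e k : (k < N)%N ->
  e11 R n a j (b ^+ e * a ^+ k)%g = c2 * (if e then 0 else eps ^- (j * k)) :> C.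
Proof.
move=> kN; apply: (@weighted_sumE _ c2 (fun k => eps ^- (j * k)) (fun=> 0) e k kN).
by congr (_ *: _); apply: eq_bigr => i _; rewrite scale0r addr0.
Qed.

Lemma e22E j e k : (k < N)%N ->
  e22 R n a j (b ^+ e * a ^+ k)%g = c2 * (if e then 0 else eps ^+ (j * k)) :> C.
Proof.
move=> kN; apply: (@weighted_sumE _ c2 (fun k => eps ^+ (j * k)) (fun=> 0) e k kN).
by congr (_ *: _); apply: eq_bigr => i _; rewrite scale0r addr0.
Qed.

Lemma e12E j e k : (k < N)%N ->
  e12 R n a b j (b ^+ e * a ^+ k)%g = c2 * (if e then eps ^+ (j * k) else 0) :> C.
Proof.
move=> kN; apply: (@weighted_sumE _ c2 (fun=> 0) (fun k => eps ^+ (j * k)) e k kN).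
by congr (_ *: _); apply: eq_bigr => i _; rewrite scale0r add0r.
Qed.

Lemma e21E j e k : (k < N)%N ->
  e21 R n a b j (b ^+ e * a ^+ k)%g = c2 * (if e then eps ^- (j * k) else 0) :> C.
Proof.
move=> kN; apply: (@weighted_sumE _ c2 (fun=> 0) (fun k => eps ^- (j * k)) e k kN).
by congr (_ *: _); apply: eq_bigr => i _; rewrite scale0r add0r.
Qed.

Lemma q0E e j k l : (l < N)%N ->
  q0 n a b ((2 * k * j)%:R * pi / n%:R) (2 * j) (b ^+ e * a ^+ l)%g =
  2^-1 * (c2 * ((eps ^+ (2 * l) / eps ^+ (2 * (if e then k else 0))) ^- j +
    (eps ^+ (2 * l) / eps ^+ (2 * (if e then k else 0))) ^+ j)) :> C.
Proof.
move=> lN; have eps_prim := epsilon_prim R n_gt0.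
pose be := (2 * k * j)%:R * pi / n%:R : R; pose g := (b ^+ e * a ^+ l)%g.
transitivity (2^-1 * ((e11 R n a (2 * j) g : C) + expi (- be) * (e12 R n a b (2 * j) g : C) +
    expi be * (e21 R n a b (2 * j) g : C) + (e22 R n a (2 * j) g : C))).
  exact: q_comb_coef.
apply: q_arith (e11E _ _ lN) (e12E _ _ lN) (e21E _ _ lN) (e22E _ _ lN).
- exact: eps_neq0 n_gt0 eps_prim.
- by rewrite /be -mulrA expiMn.
- exact: expiN.
Qed.

(** At a group element with rotation exponent [l], both sides are a function of one 2m-th
    root of unity, [eps ^+ (2 * l)] or its quotient by [eps ^+ (2 * k)]: they detect
    whether it is 1, by [sum_root_pairs] and [involution_projectionE]. *)
Lemma pJE k : (k < n)%N -> pJ R n a b k = involution_projection C m a (b * a ^+ k)%g.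
Proof.
move=> kn; apply/ffunP => g; have [e [l lN ->]] := dih_form N_gt0 D g.
have eps_prim := epsilon_prim R n_gt0.
rewrite (involution_projectionE m_gt0 D eps_prim e kn lN).
have xn := root_ratio_pow eps_prim (if e then k else 0) l.
rewrite -(sum_root_pairs m_gt0 xn) (root_ratio_half m_gt0 eps_prim).
have n2 : (n./2 = m)%N by rewrite mul2n doubleK.
pose g0 := (b ^+ e * a ^+ l)%g.
transitivity ((e1 R n a b g0 : C) + ((if odd k then e3 R n a b else e4 R n a b) g0 : C) +
    \sum_(1 <= j < m) (q0 n a b ((2 * k * j)%:R * pi / n%:R) (2 * j) g0 : C)).
  by rewrite /pJ n2 ga_addE ga_addE ga_sumE.
congr (_ + _); last by apply: eq_big_nat => j _; exact: q0E.
rewrite mulrDr mulr1 e1E //; congr (_ + _).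
case ok: (odd k).
  by rewrite (e3E e lN); case: (e); rewrite ?ok ?addbF.
by rewrite (e4E e lN); case: (e); rewrite ?ok ?addbF.
Qed.

End KD.

(** * The coideal subalgebras of KD(2m) of dimension 4 *)

Lemma add_sign (F : fieldType) (c x y : F) (e : bool) :
  x = c -> y = c * (-1) ^+ e -> x + y = if e then 0 else c *+ 2.
Proof.
by move=> -> ->; case: e; rewrite ?expr1 ?mulrN1 ?subrr // expr0 mulr1 mulr2n.
Qed.

Section KDCoideals.

Variables (R : realType) (gT : finGroupType) (m : nat) (a b : gT).
Hypothesis m_gt0 : (0 < m)%N.
Local Notation n := (2 * m)%N.
Local Notation N := (2 * n)%N.
Hypothesis D : dihedral_generators N a b.
Local Notation C := R[i].
Local Notation A := (group_algebra C gT).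
Local Notation lam := (@ga_lambda C gT).
Local Notation z := (a ^+ n)%g.
Local Notation imi := (Complex 0 1 : C).
Implicit Types (I J : {vspace A}) (k l : nat).

Let n_gt0 : (0 < n)%N. Proof. by rewrite muln_gt0. Qed.
Let N_gt0 : (0 < N)%N. Proof. by rewrite !muln_gt0. Qed.
Let N_even : ~~ odd N. Proof. by rewrite mul2n odd_double. Qed.
Let zC := dih_center m_gt0 D.
Let zz := dih_zz D.
Let bb := dih_bb D.
Let z_neq1 := dih_z_neq1 m_gt0 D.

Lemma imi_sqr : imi * imi = -1.
Proof. by apply/eqP; rewrite eq_complex /=; apply/andP; split; apply/eqP; ring. Qed.

Lemma imi_conj : (imi : (C : numClosedFieldType))^*%R = - imi.
Proof. by apply/eqP; rewrite eq_complex /= oppr0 !eqxx. Qed.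

Lemma Omega_gauge_KD :
  Omega R n a b * @dcop C gT (gauge_unitary imi n a b) =
  tensor (gauge_unitary imi n a b) (gauge_unitary imi n a b) * twist C n a b.
Proof.
have -> : Omega R n a b = klein2 n a b (Omega_coef R).
  by apply: eq_bigr => i _; apply: eq_bigr => j _; rewrite tensor_lam.
have nuE : (-1 +i* 2)%C = -1 + 2 * imi :> C.
  by apply/eqP; rewrite eq_complex /=; apply/andP; split; apply/eqP; ring.
have nubE : ((-1 +i* 2)^*)%C = -1 - 2 * imi :> C.
  by apply/eqP; rewrite eq_complex /=; apply/andP; split; apply/eqP; ring.
apply: (Omega_gauge imi_sqr zC zz bb nuE nubE) => i j.
by rewrite /Omega_coef !mxE.
Qed.

Local Notation G := (@gauge_img C imi gT n a b).
Local Notation gauge := (@gauge C imi gT n a b).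
Local Notation twisted_coideal := (@twisted_coideal C gT n a b).
Local Notation coideal_subalgebra := (@coideal_subalgebra R gT n a b).

Lemma coideal_gaugeP I : coideal_subalgebra (G I) <-> twisted_coideal I.
Proof. exact: (coideal_gauge imi_sqr imi_conj zC zz bb Omega_gauge_KD). Qed.

Lemma coideal_img I : coideal_subalgebra I ->
  exists2 J, twisted_coideal J & I = G J.
Proof.
move=> cI; exists (linfun (ungauge imi n a b) @: I)%VS.
  by apply/coideal_gaugeP; rewrite (gauge_imgK imi_sqr imi_conj zC zz bb).
by rewrite (gauge_imgK imi_sqr imi_conj zC zz bb).
Qed.

Let memG I x : (gauge x \in G I) = (x \in I) :=
  mem_gauge_img imi_sqr imi_conj zC zz bb I x.
Let subG I J : (G I <= G J)%VS = (I <= J)%VS :=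
  gauge_img_sub imi_sqr imi_conj zC zz bb I J.
Let dimG I : \dim (G I) = \dim I := dim_gauge_img imi_sqr imi_conj zC zz bb I.
Let G_inj : injective G := @gauge_img_inj _ _ _ _ _ _ imi_sqr imi_conj zC zz bb.
Let gauge_fixP (x : A) : x * Pp C n a = x -> gauge x = x :=
  @gauge_fix _ imi _ _ _ _ zC zz bb x.

(** A multiple [f] of the indicator of the kernel of [chi] is invariant under [z], hence
    fixed by [gauge]; a twisted coideal that contains it contains the whole span of
    the kernel by [chi_kernel_sub]. *)
Lemma gen_coideal_kernel (chi : gT -> bool)
    (chiM : forall g h, chi (g * h)%g = chi g (+) chi h) (f : A) (c : C) :
    chi z = false -> c != 0 -> (forall g, f g = if chi g then 0 else c) ->
  gen_coideal n a b f = G (lam_span C (chi_kernel chiM)).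
Proof.
move=> chi_z c0 fE.
have fP : f * Pp C n a = f.
  have fz : f * lam z = f.
    rewrite -(mul_commlam _ zC); apply/ffunP => g; rewrite mullamE.
    by rewrite (zV zz) !fE chiM chi_z.
  by rewrite /Pp -scalerAr mulrDr mulr1 fz scaler_half.
have [cI fI minI] := gen_coidealP n a b f.
apply/eqP; rewrite eqEsubv; apply/andP; split.
  apply: minI; first exact/coideal_gaugeP/(chi_kernel_coideal C m_gt0 D).
  rewrite -(gauge_fixP fP) memG; apply/mem_lam_span => g.
  by rewrite inE fE negbK => ->.
have [J cJ JE] := coideal_img cI; rewrite JE subG.
move: fI; rewrite JE -(gauge_fixP fP) memG => fJ.
exact: (chi_kernel_sub m_gt0 D chiM chi_z cJ c0 fJ fE).
Qed.

Let reflM' := reflM N_gt0 D.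
Let parM' := parM N_gt0 D N_even.
Let chi3 g := par N a b g (+) refl a g.
Let chi3M g h : chi3 (g * h)%g = chi3 g (+) chi3 h.
Proof. by rewrite /chi3 parM' reflM' addbACA. Qed.

Lemma K2E : K2 R n a b = G (lam_span C (chi_kernel reflM')).
Proof.
apply: (@gen_coideal_kernel _ _ _ ((4 * n)%:R^-1 *+ 2)).
- exact: refl_a N_gt0 D n.
- by rewrite mulrn_eq0 /= invr_eq0 pnatr_eq0 muln_eq0 /= -lt0n.
move=> g; have [e [k kN ->]] := dih_form N_gt0 D g.
rewrite (dih_refl N_gt0 D).
exact: etrans (ga_addE _ _ _) (add_sign (e1E R m_gt0 D e kN) (e2E R m_gt0 D e kN)).
Qed.

Lemma K3E : K3 R n a b = G (lam_span C (chi_kernel chi3M)).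
Proof.
apply: (@gen_coideal_kernel _ _ _ ((4 * n)%:R^-1 *+ 2)).
- by rewrite /chi3 (par_a N_gt0 D N_even) (refl_a N_gt0 D) addbF oddM.
- by rewrite mulrn_eq0 /= invr_eq0 pnatr_eq0 muln_eq0 /= -lt0n.
move=> g; have [e [k kN ->]] := dih_form N_gt0 D g.
rewrite /chi3 (dih_refl N_gt0 D) (dih_par N_gt0 D N_even).
exact: etrans (ga_addE _ _ _) (add_sign (e1E R m_gt0 D e kN) (e3E R m_gt0 D e kN)).
Qed.

Lemma K4E : K4 R n a b = G (lam_span C (chi_kernel parM')).
Proof.
apply: (@gen_coideal_kernel _ _ _ ((4 * n)%:R^-1 *+ 2)).
- by rewrite (par_a N_gt0 D N_even) oddM.
- by rewrite mulrn_eq0 /= invr_eq0 pnatr_eq0 muln_eq0 /= -lt0n.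
move=> g; have [e [k kN ->]] := dih_form N_gt0 D g.
rewrite (dih_par N_gt0 D N_even).
exact: etrans (ga_addE _ _ _) (add_sign (e1E R m_gt0 D e kN) (e4E R m_gt0 D e kN)).
Qed.

Definition J_ k : {vspace A} := G (involution_coideal C n a b (b * a ^+ k)%g).
Definition J_center : {vspace A} := G (involution_coideal C n a b (a ^+ m)%g).
Definition J_cyclic (c : C) : {vspace A} := G (cyclic_coideal n a (a ^+ m./2)%g c).

Lemma coideals4_classification I : coideal_subalgebra I -> \dim I = 4 ->
  [\/ exists2 k, (k < n)%N & I = J_ k, I = J_center |
      ~~ odd m /\ exists2 c, c ^+ 4 = -1 & I = J_cyclic c].
Proof.
move=> /coideal_img[J cJ ->]; rewrite dimG => dJ.
have [[k kn ->]|->|[m2 [c c4 ->]]] := twisted_classification m_gt0 D cJ dJ.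
- by apply: Or31; exists k.
- exact: Or32.
- by apply: Or33; split=> //; exists c.
Qed.

Lemma J_coideal k : coideal_subalgebra (J_ k) /\ \dim (J_ k) = 4.
Proof.
split; last first.
  by rewrite dimG (dim_involution_coideal C zC zz bb z_neq1) // (reflection_neqmodz m_gt0 D).
apply/coideal_gaugeP/(involution_coidealP C zC zz bb z_neq1).
by rewrite (reflection_sqr D) eqmodzxx.
Qed.

Lemma J_center_coideal : coideal_subalgebra J_center /\ \dim J_center = 4.
Proof.
split; last by rewrite dimG (dim_involution_coideal C zC zz bb z_neq1) // (am_neqmodz m_gt0 D).
exact/coideal_gaugeP/(involution_coidealP C zC zz bb z_neq1)/am_sqr.
Qed.

Lemma J_cyclic_coideal c : ~~ odd m -> c ^+ 4 = -1 ->
  coideal_subalgebra (J_cyclic c) /\ \dim (J_cyclic c) = 4.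
Proof.
move=> m2 c4; split.
  exact/coideal_gaugeP/(cyclic_coideal_twisted m_gt0 D m2 c4).
by rewrite dimG (dim_cyclic_coideal zC zz z_neq1 _ (cyclic_w_indep m_gt0 D m2)).
Qed.

(** A coideal subalgebra of dimension 4 is determined by the projection [pJ k] that it
    contains ([involution_projection_coideal]), and [pJ k] absorbs [J_ k]. *)
Lemma is_JP k I : (k < n)%N -> is_J n a b k I <-> I = J_ k.
Proof.
move=> kn; have [cJ dJ] := J_coideal k.
have hh := reflection_sqr D k; have h1 := reflection_neqmodz m_gt0 D k.
set h := (b * a ^+ k)%g in hh h1.
have pE : pJ R n a b k = involution_projection C m a h := pJE R m_gt0 D kn.
have pP := involution_projection_Pp C m_gt0 D h.
split=> [[/coideal_img[I' cI' ->]]|->].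
  rewrite dimG => dI' [+ _ _ _ _]; rewrite pE -(gauge_fixP pP) memG => pI'.
  by rewrite (involution_projection_coideal m_gt0 D h1 cI' dI' pI').
split=> //; rewrite pE; split.
- by rewrite -(gauge_fixP pP) memG (involution_projection_mem C m_gt0 D).
- exact: involution_projection_neq0.
- exact: (involution_projection_idem C m_gt0 D hh).
- exact: (involution_projection_star C m_gt0 D hh).
move=> y; rewrite (mem_gauge_imgE imi_sqr imi_conj zC zz bb) => yI.
rewrite -[y](ungaugeK imi_sqr imi_conj zC zz bb).
rewrite -{1}(gauge_fixP pP) -(gaugeM imi_sqr imi_conj zC zz bb).
rewrite (involution_projection_absorb m_gt0 D hh yI) linearZ /= (gauge_fixP pP).
by rewrite -[counit _]/(aug _) (aug_gauge imi_sqr imi_conj zC zz bb).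
Qed.

Lemma J_inj k l : (k < n)%N -> (l < n)%N -> J_ k = J_ l -> k = l.
Proof.
move=> kn ln /G_inj E; apply: (reflection_eqmodz_inj m_gt0 D kn ln).
exact: (involution_coideal_inj zC zz z_neq1 (reflection_neqmodz m_gt0 D k) E).
Qed.

Lemma J_sub_K2 k : (J_ k <= K2 R n a b)%VS = false.
Proof.
by rewrite K2E subG (involution_kernel _ m_gt0 D) ?(refl_a N_gt0 D) // (refl_ba N_gt0 D).
Qed.

Lemma J_sub_K3 k : (J_ k <= K3 R n a b)%VS = odd k.
Proof.
rewrite K3E subG (involution_kernel _ m_gt0 D).
  by rewrite /chi3 (par_ba N_gt0 D N_even) (refl_ba N_gt0 D) addbT negbK.
by rewrite /chi3 (par_a N_gt0 D N_even) (refl_a N_gt0 D) addbF oddM.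
Qed.

Lemma J_sub_K4 k : (J_ k <= K4 R n a b)%VS = ~~ odd k.
Proof.
rewrite K4E subG (involution_kernel _ m_gt0 D) ?(par_ba N_gt0 D N_even) //.
by rewrite (par_a N_gt0 D N_even) oddM.
Qed.

Lemma J_center_sub_K2 : (J_center <= K2 R n a b)%VS.
Proof. by rewrite K2E subG (involution_kernel _ m_gt0 D) !(refl_a N_gt0 D). Qed.

Lemma J_center_sub_K3 : (J_center <= K3 R n a b)%VS = ~~ odd m.
Proof.
rewrite K3E subG (involution_kernel _ m_gt0 D) /chi3 !(par_a N_gt0 D N_even)
  !(refl_a N_gt0 D) addbF //.
by rewrite oddM.
Qed.

Lemma J_center_sub_K4 : (J_center <= K4 R n a b)%VS = ~~ odd m.
Proof.
by rewrite K4E subG (involution_kernel _ m_gt0 D) !(par_a N_gt0 D N_even) ?oddM.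
Qed.

Lemma J_cyclic_sub_K2 c : (J_cyclic c <= K2 R n a b)%VS.
Proof.
rewrite K2E subG cyclic_kernel ?(refl_a N_gt0 D) //.
by have := refl_a N_gt0 D 1; rewrite expg1 => ->.
Qed.

Lemma J_center_neq_cyclic c : ~~ odd m -> J_center <> J_cyclic c.
Proof.
move=> m2 /G_inj E; have := cyclic_nonsplit m_gt0 D m2 c.
by rewrite -E pl_involution // eqmodzxx.
Qed.

Lemma J_cyclic_inj c d : ~~ odd m -> c ^+ 4 = -1 -> d ^+ 4 = -1 ->
  J_cyclic c = J_cyclic d -> c = d.
Proof. by move=> m2 c4 d4 /G_inj; exact: (cyclic_coideal_inj m_gt0 D m2 c4 d4). Qed.

End KDCoideals.

(** * The Kac algebra K_2 and its coideal J_20 *)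

Section GaugeDual.

Variables (F : numClosedFieldType) (i0 : F) (gT hT : finGroupType) (m : nat).
Variables (a b : gT) (al be : hT) (eps : F).
Hypothesis II : i0 * i0 = -1.
Hypothesis Ic : i0^*%R = - i0.
Hypothesis m_gt0 : (0 < m)%N.
Local Notation n := (2 * m)%N.
Local Notation N := (2 * n)%N.
Hypothesis D : dihedral_generators N a b.
Hypothesis Dn : dihedral_generators n al be.
Hypothesis eps_prim : N.-primitive_root eps.
Local Notation A := (group_algebra F gT).
Local Notation Fun := {ffun hT -> F^o}.
Implicit Types (f g : Fun).

Let N_gt0 : (0 < N)%N. Proof. by rewrite !muln_gt0. Qed.
Let zC := dih_center m_gt0 D.
Let zz := dih_zz D.
Let bb := dih_bb D.

Local Notation dual_map := (@dual_map F gT hT m a al be eps).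
Local Notation U := (gauge_unitary i0 n a b).
Local Notation gauge := (gauge i0 n a b).

Definition gauge_dual f : A := gauge (dual_map f).

Fact gauge_dual_linear : linear gauge_dual.
Proof. by move=> c f g; rewrite /gauge_dual !linearP. Qed.
HB.instance Definition _ := GRing.isLinear.Build F Fun A *:%R
  gauge_dual gauge_dual_linear.

Lemma gauge_dual_inj f : gauge_dual f = 0 -> f = 0.
Proof.
rewrite /gauge_dual -(linear0 gauge) => /(can_inj (gaugeK II Ic zC zz bb)).
exact: (dual_map_inj m_gt0 D Dn eps_prim).
Qed.

Lemma gauge_dual_img : limg (linfun gauge_dual) =
  gauge_img i0 n a b (lam_span F (chi_kernel (reflM N_gt0 D))).
Proof.
have E : chi_kernel (reflM N_gt0 D) =i <[a]>%g.
  by move=> g; rewrite inE /refl negbK.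
apply/vspaceP => x; rewrite (mem_gauge_imgE II Ic zC zz bb).
rewrite (_ : lam_span _ _ = lam_span F <[a]>%g); last first.
  by congr span; congr map; apply: eq_enum.
apply/memv_imgP/idP => [[f _ ->]|/(dual_map_img m_gt0 D Dn eps_prim)[f xE]].
  apply/(dual_map_img m_gt0 D Dn eps_prim); exists f.
  by rewrite lfunE /= (gaugeK II Ic zC zz bb).
exists f; rewrite ?memvf // lfunE /= /gauge_dual -xE.
by rewrite (ungaugeK II Ic zC zz bb).
Qed.

Lemma gauge_dual_Delta (Om : group_algebra F (gT * gT)%type) f :
    Om * dcop U = tensor U U * twist F n a b ->
  Delta_by Om (gauge_dual f) = \sum_s \sum_t
    (f (s * t)%g : F) *: tensor (gauge_dual (delta F s)) (gauge_dual (delta F t)).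
Proof.
move=> Om_gauge; rewrite (Delta_gauge Om_gauge) (dual_map_Delta m_gt0 D Dn eps_prim).
rewrite mulr_sumr mulr_suml; apply: eq_bigr => s _.
rewrite mulr_sumr mulr_suml; apply: eq_bigr => t _.
by rewrite -scalerAr -scalerAl !tensorM.
Qed.

End GaugeDual.

Section KacIsomorphism.

Variables (R : realType) (gT hT : finGroupType) (m : nat) (a b : gT) (al be : hT).
Hypothesis m_gt0 : (0 < m)%N.
Local Notation n := (2 * m)%N.
Local Notation N := (2 * n)%N.
Hypothesis D : dihedral_generators N a b.
Hypothesis Dn : dihedral_generators n al be.
Local Notation C := R[i].
Local Notation A := (group_algebra C gT).
Local Notation eps := (epsilon R n).
Local Notation imi := (Complex 0 1 : C).
Local Notation Fun := {ffun hT -> C^o}.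
Implicit Types (f : Fun) (s t : hT).

Let n_gt0 : (0 < n)%N. Proof. by rewrite muln_gt0. Qed.
Let zC := dih_center m_gt0 D.
Let zz := dih_zz D.
Let bb := dih_bb D.
Let eps_prim := epsilon_prim R n_gt0.

Local Notation gauge_dual := (@gauge_dual C imi gT hT m a b al be eps).

Definition kac_iso : 'Hom(Fun, A) := linfun gauge_dual.

Lemma kac_isoE f : kac_iso f = gauge_dual f.
Proof. by rewrite lfunE. Qed.

Lemma kac_isoP : kac_iso_functions n a b kac_iso (K2 R n a b).
Proof.
split.
- split; last first.
    rewrite (K2E R m_gt0 D).
    exact: etrans (gauge_dual_img (imi_sqr R) (imi_conj R) m_gt0 D Dn eps_prim) _.
  apply/eqP; rewrite -subv0; apply/subvP => f; rewrite memv_ker kac_isoE memv0.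
  by move=> /eqP/(gauge_dual_inj (imi_sqr R) (imi_conj R) m_gt0 D Dn eps_prim) ->.
- split=> [|f g]; rewrite !kac_isoE.
    rewrite /gauge_dual (dual_map1 m_gt0 D Dn eps_prim).
    exact: (gauge1 (imi_sqr R) (imi_conj R) zC zz bb).
  rewrite /gauge_dual (dual_mapM m_gt0 D Dn eps_prim).
  exact: (gaugeM (imi_sqr R) (imi_conj R) zC zz bb).
- move=> f; rewrite !kac_isoE /gauge_dual.
  refine (etrans _ (esym (gauge_star _ _ _ _ _))).
  congr (gauge _ _ _ _ _).
  exact: (dual_map_star m_gt0 D Dn eps_prim).
- move=> f; rewrite kac_isoE.
  refine (etrans (gauge_dual_Delta m_gt0 D Dn eps_prim f (Omega_gauge_KD R m_gt0 D)) _).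
  by apply: eq_bigr => s _; apply: eq_bigr => t _; rewrite !kac_isoE.
split=> f; rewrite !kac_isoE.
  refine (etrans (aug_gauge (imi_sqr R) (imi_conj R) zC zz bb _) _).
  exact: (dual_map_aug m_gt0 D Dn eps_prim).
exact: (inva_gauge_dual (imi_sqr R) (imi_conj R) m_gt0 D Dn eps_prim).
Qed.

Lemma J20P : is_J20 n a b al (J_center R m a b).
Proof.
exists kac_iso; first exact: kac_isoP.
move=> x; rewrite /J_center (mem_gauge_imgE (imi_sqr R) (imi_conj R) zC zz bb).
rewrite (involution_coideal_center C m_gt0 D).
split=> [/(J20_dual m_gt0 D Dn eps_prim)[f fc xE]|[f fc ->]].
  exists f => //; rewrite kac_isoE /gauge_dual -xE.
  by rewrite (ungaugeK (imi_sqr R) (imi_conj R) zC zz bb).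
apply/(J20_dual m_gt0 D Dn eps_prim); exists f => //.
by rewrite kac_isoE (gaugeK (imi_sqr R) (imi_conj R) zC zz bb).
Qed.

End KacIsomorphism.

Local Open Scope classical_set_scope.

(** * Counting the coideals of K_2 *)

Section FiveInK2.

Variables (R : realType) (gT : finGroupType) (m : nat) (a b : gT).
Hypothesis m_gt0 : (0 < m)%N.
Hypothesis m_even : ~~ odd m.
Local Notation n := (2 * m)%N.
Local Notation N := (2 * n)%N.
Hypothesis D : dihedral_generators N a b.
Local Notation C := R[i].
Local Notation A := (group_algebra C gT).
Local Notation eps := (epsilon R n).
Let n_gt0 : (0 < n)%N. Proof. by rewrite muln_gt0. Qed.
Let eps_prim := epsilon_prim R n_gt0.

Definition K2_coideal (i : nat) : {vspace A} :=
  if (i < 4)%N then J_cyclic m a b (eps ^+ (m./2 * (2 * i + 1)))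
  else J_center R m a b.

Let eps4 i : (i < 4)%N -> (eps ^+ (m./2 * (2 * i + 1))) ^+ 4 = -1.
Proof. by move=> i4; apply/(fourth_roots _ m_gt0 m_even eps_prim); exists i. Qed.

Lemma K2_coideal_inj : {in `I_5 &, injective K2_coideal}.
Proof.
move=> i j; rewrite !inE /= => i5 j5; rewrite /K2_coideal.
case: ltnP => i4; case: ltnP => j4.
- move=> /(J_cyclic_inj m_gt0 D m_even (eps4 i4) (eps4 j4))/eqP.
  rewrite (eq_prim_root_expr eps_prim) => /eqP.
  have -> : (2 * (2 * m) = m./2 * 8)%N by clear -m_even; lia.
  rewrite -!muln_modr => /eqP; rewrite eqn_pmul2l; last by clear -m_gt0 m_even; lia.
  by rewrite !modn_small => [/eqP||]; clear -i4 j4; lia.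
- by move=> /esym/(J_center_neq_cyclic m_gt0 D m_even).
- by move=> /(J_center_neq_cyclic m_gt0 D m_even).
by move=> _; clear -i5 j5 i4 j4; lia.
Qed.

End FiveInK2.

(** * Distribution among K_2, K_3 and K_4 *)

(** The set-theoretic content of the theorem: what the sets [c42], [c43], [c44] of coideals
    of K_2, K_3 and K_4 are, once the coideals [c4] are known to be the [J k], the
    coideal [Jc] of [a ^+ m] and the cyclic coideals [Jy]. *)
Section Assembly.

Variables (T : Type) (n : nat) (odd_idx : pred nat).
Variables (c4 c42 c43 c44 : set T) (J : 'I_n -> T) (Jc : T) (Jy : set T).
Hypothesis sorted : forall I, c4 I -> [\/ exists k, I = J k, I = Jc | Jy I].
Hypothesis c42_c4 : c42 `<=` c4.
Hypothesis c43_c4 : c43 `<=` c4.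
Hypothesis c44_c4 : c44 `<=` c4.
Hypothesis c42_J : forall k, ~ c42 (J k).
Hypothesis c43_J : forall k, c43 (J k) <-> odd_idx k.
Hypothesis c44_J : forall k, c44 (J k) <-> ~~ odd_idx k.
Hypothesis c42_Jc : c42 Jc.
Hypothesis c42_Jy : Jy `<=` c42.

Lemma sorted_union : c4 = c42 `|` c43 `|` c44.
Proof.
apply/seteqP; split=> [I /sorted[[k ->]|->|/c42_Jy cI]|I [[]|]].
- by case: (boolP (odd_idx k)) => [/c43_J|/c44_J]; [left; right | right].
- by left; left.
- by left; left.
- exact: c42_c4.
- exact: c43_c4.
- exact: c44_c4.
Qed.

Lemma sorted_c42 : c42 = [set Jc] `|` Jy.
Proof.
apply/seteqP; split=> [I cI|I [->|/c42_Jy]] //.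
case: (sorted (c42_c4 cI)) => [[k IE]|->|yI]; [|by left|by right].
by case: (c42_J (k := k)); rewrite -IE.
Qed.

Lemma sorted_c43 : c43 `\` c42 = [set I | exists2 k : 'I_n, odd_idx k & I = J k].
Proof.
apply/seteqP; split=> [I [cI nI]|_ [k ko ->]]; last by split; [exact/c43_J|exact: c42_J].
case: (sorted (c43_c4 cI)) => [[k IE]|IE|/c42_Jy//]; last by case: nI; rewrite IE.
by exists k => //; apply/c43_J; rewrite -IE.
Qed.

Lemma sorted_c44 : c44 `\` c42 = [set I | exists2 k : 'I_n, ~~ odd_idx k & I = J k].
Proof.
apply/seteqP; split=> [I [cI nI]|_ [k ko ->]]; last by split; [exact/c44_J|exact: c42_J].
case: (sorted (c44_c4 cI)) => [[k IE]|IE|/c42_Jy//]; last by case: nI; rewrite IE.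
by exists k => //; apply/c44_J; rewrite -IE.
Qed.

End Assembly.

Theorem proposition7p5 (R : realType) (m : nat) (gT hT : finGroupType)
    (a b : gT) (al be : hT)
    (m_gt0 : (0 < m)%N)
    (D2n : dihedral_generators (2 * (2 * m)) a b)
    (Dn : dihedral_generators (2 * m) al be) :
  let n := (2 * m)%N in
  let KD := group_algebra R[i] gT in
  let K2 : {vspace KD} := K2 R n a b in
  let K3 : {vspace KD} := K3 R n a b in
  let K4 : {vspace KD} := K4 R n a b in
  let coideals4 : {vspace KD} -> set {vspace KD} := coideals4 n a b in
  exists J : 'I_n -> {vspace KD},
    let J_odd := [set I | exists2 k : 'I_n, odd k & I = J k] in
    let J_even := [set I | exists2 k : 'I_n, ~~ odd k & I = J k] in
    [/\ (forall (k : 'I_n) I, is_J n a b k I <-> I = J k) /\ injective J,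
        coideals4 fullv = coideals4 K2 `|` coideals4 K3 `|` coideals4 K4,
        (odd m ->
          [/\ coideals4 K3 = J_odd, coideals4 K4 = J_even &
              exists2 J20, is_J20 n a b al J20 & coideals4 K2 = [set J20]]) &
        (~~ odd m ->
          [/\ coideals4 K3 `\` coideals4 K2 = J_odd,
              coideals4 K4 `\` coideals4 K2 = J_even &
              (coideals4 K2 #= `I_5)%card])].
Proof.
move=> n KD K2 K3 K4 c4.
pose Jy : set {vspace KD} :=
  [set I | ~~ odd m /\ exists2 c : R[i], c ^+ 4 = -1 & I = J_cyclic m a b c].
pose J (k : 'I_n) := J_ R m a b k; pose Jc := J_center R m a b.
have n_gt0 : (0 < n)%N by rewrite muln_gt0.
have eps_prim := epsilon_prim R n_gt0.
have sort I : c4 fullv I -> [\/ exists k, I = J k, I = Jc | Jy I].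
  case=> cI dI _; have [[k kn IE]|IE|IE] := coideals4_classification m_gt0 D2n cI dI.
  - by apply: Or31; exists (Ordinal kn).
  - exact: Or32.
  - exact: Or33.
have full K I : c4 K I -> c4 fullv I by case=> cI dI _; split=> //; exact: subvf.
have c2J k : ~ c4 K2 (J k) by case=> _ _; rewrite (J_sub_K2 R m_gt0 D2n).
have c3J k : c4 K3 (J k) <-> odd k.
  have [cJ dJ] := J_coideal R m_gt0 D2n k.
  by rewrite -(J_sub_K3 R m_gt0 D2n k); split=> [[]|].
have c4J k : c4 K4 (J k) <-> ~~ odd k.
  have [cJ dJ] := J_coideal R m_gt0 D2n k.
  by rewrite -(J_sub_K4 R m_gt0 D2n k); split=> [[]|].
have c2Jc : c4 K2 Jc.
  have [cJ dJ] := J_center_coideal R m_gt0 D2n.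
  by split=> //; exact: J_center_sub_K2.
have c2Jy : Jy `<=` c4 K2.
  move=> _ [m2 [c cc ->]]; have [cJ dJ] := J_cyclic_coideal m_gt0 D2n m2 cc.
  by split=> //; exact: J_cyclic_sub_K2.
have c2E := sorted_c42 sort (@full K2) c2J c2Jc c2Jy.
have c3E := sorted_c43 sort (@full K3) c2J c3J c2Jc c2Jy.
have c4E := sorted_c44 sort (@full K4) c2J c4J c2Jc c2Jy.
exists J => J_odd J_even; split.
- split=> [k I|k l /(J_inj m_gt0 D2n (ltn_ord k) (ltn_ord l))/val_inj //].
  exact: is_JP.
- exact: sorted_union sort (@full K2) (@full K3) (@full K4) c3J c4J c2Jc c2Jy.
- move=> m1.
  have c2E1 : c4 K2 = [set Jc].
    rewrite c2E (_ : Jy = set0) ?setU0 //; apply/seteqP; split=> // I [].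
    by rewrite m1.
  have dis K : ~ c4 K Jc -> c4 K `\` c4 K2 = c4 K.
    move=> nK; apply/seteqP; split=> [I []|I cI] //; split=> //.
    by rewrite c2E1 => IE; apply: nK; rewrite -IE.
  split.
  + apply: etrans (esym (dis _ _)) c3E => -[_ _].
    by rewrite (J_center_sub_K3 R m_gt0 D2n) m1.
  + apply: etrans (esym (dis _ _)) c4E => -[_ _].
    by rewrite (J_center_sub_K4 R m_gt0 D2n) m1.
  by exists Jc => //; exact: (J20P R m_gt0 D2n Dn).
move=> m2; split=> //.
rewrite (_ : c4 K2 = K2_coideal R m a b @` `I_5).
  exact/inj_card_eq/(K2_coideal_inj m_gt0 m2 D2n).
rewrite c2E; apply/seteqP; split=> [I|_ [i /= i5 <-]].
  case=> [->|[_ [c /(fourth_roots _ m_gt0 m2 eps_prim)[i i4 ->] ->]]].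
  + by exists 4%N.
  + by exists i; [exact: ltn_trans i4 _|rewrite /K2_coideal i4].
rewrite /K2_coideal; case: ltnP => i4; [right|by left].
split=> //; eexists; last reflexivity.
by apply/(fourth_roots _ m_gt0 m2 eps_prim); exists i.
Qed.
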